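(* Let $k\ge 1$ and $\kappa>1$, and let $W_\kappa:=\mathrm{shift}(x_0,x_1,\dots)$ with $x_n:=\sqrt{\frac{1+\kappa^{n+1}}{1+\kappa^n}}$ $(n\ge 0)$ (in particular $x_0=\sqrt{\frac{1+\kappa}{2}}$). For $y_0>0$ let $\mathbf{T}\equiv(T_1,T_2)$ be the commuting $2$-variable weighted shift with weights: $\alpha_{(i,0)}=x_i$ for $i\ge 0$ and $\alpha_{(i,j)}=1$ for $i\ge 0$, $j\ge 1$; $\beta_{(0,0)}=y_0$, $\beta_{(i,0)}=\frac{y_0}{x_0x_1\cdots x_{i-1}}$ for $i\ge 1$, and $\beta_{(i,j)}=1$ for $i\ge 0$, $j\ge 1$. Then there exists $0<y_0\le\sqrt{\frac12}$ which makes $\mathbf{T}$ $k$-hyponormal. Moreover, $$\sigma_T(\mathbf{T})=\sigma_r(\mathbf{T})=\left(\overline{\mathbb{D}}\times\overline{\mathbb{D}}\right)\cup\left(\sqrt{\kappa}\,\overline{\mathbb{D}}\times\{0\}\right),$$ $$\sigma_{Te}(\mathbf{T})=\sigma_{re}(\mathbf{T})=\left(\sqrt{\kappa}\,\mathbb{T}\times\{0\}\right)\cup\left(\mathbb{T}\times\overline{\mathbb{D}}\right)\cup\left(\overline{\mathbb{D}}\times\mathbb{T}\right),$$ and $\partial\sigma_T(\mathbf{T})\ne\sigma_{Te}(\mathbf{T})$.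
   Context: A $2$-variable weighted shift with bounded positive weights $\alpha_{(i,j)},\beta_{(i,j)}$ ($(i,j)\in\mathbb{Z}_+^2$) is the pair $\mathbf{T}\equiv(T_1,T_2)$ of bounded operators on $\ell^2(\mathbb{Z}_+^2)$, with canonical orthonormal basis $\{e_{(i,j)}\}$, given by $T_1e_{(i,j)}=\alpha_{(i,j)}e_{(i+1,j)}$ and $T_2e_{(i,j)}=\beta_{(i,j)}e_{(i,j+1)}$; it is commuting iff $\beta_{(i+1,j)}\alpha_{(i,j)}=\alpha_{(i,j+1)}\beta_{(i,j)}$ for all $i,j$. $\mathrm{shift}(w_0,w_1,\dots)$ denotes the unilateral weighted shift $e_n\mapsto w_ne_{n+1}$ on $\ell^2(\mathbb{Z}_+)$. A tuple $(S_1,\dots,S_n)$ is (jointly) hyponormal if the operator matrix $([S_j^*,S_i])_{i,j=1}^n$ is positive semidefinite, where $[S,R]:=SR-RS$; a commuting pair $\mathbf{T}=(T_1,T_2)$ is $k$-hyponormal if the tuple $(T_1,T_2,T_1^2,T_2T_1,T_2^2,\dots,T_1^k,T_2T_1^{k-1},\dots,T_2^k)$ is hyponormal. $\sigma_T$ and $\sigma_{Te}$ denote the Taylor spectrum and the Taylor essential spectrum (the set of $\lambda\in\mathbb{C}^2$ such that the Koszul complex of $\mathbf{T}-\lambda$ is not exact, respectively not Fredholm). $\sigma_r(\mathbf{T})$ is the right spectrum, the set of $\lambda$ such that $\sum_i(T_i-\lambda_i)(T_i-\lambda_i)^*$ is not invertible, and $\sigma_{re}(\mathbf{T})$ is the right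 essential spectrum, the set of $\lambda$ such that this operator is not Fredholm. $\mathbb{D}$ is the open unit disk, $\overline{\mathbb{D}}$ its closure, $\mathbb{T}$ the unit circle. For a compact set $K\subseteq\mathbb{C}^2$, $|K|:=\{(|z_1|,|z_2|):(z_1,z_2)\in K\}$; for a compact set $L\subseteq\mathbb{R}^2$, $\partial L$ is the outer boundary of $L$, i.e. the boundary of the unbounded connected component of $\mathbb{R}^2\setminus L$; and for a compact set $K\subseteq\mathbb{C}^2$, $\partial K:=\{(z_1,z_2)\in\mathbb{C}^2:(|z_1|,|z_2|)\in\partial|K|\}$. *)

(* Defs.v *)
From HB Require Import structures.
From mathcomp Require Import all_boot all_order all_algebra sesquilinear.
From mathcomp Require Import all_classical all_reals all_analysis.
From mathcomp Require Import complex lra ring.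

Set Implicit Arguments.
Unset Strict Implicit.
Unset Printing Implicit Defensive.

Import Order.TTheory GRing.Theory Num.Theory.
Import numFieldNormedType.Exports.

Local Open Scope classical_set_scope.
Local Open Scope complex_scope.
Local Open Scope ring_scope.

Section Summation.
Context {R : realType} {I : choiceType}.
Implicit Types f g h : I -> R.

Definition rsummable f : Prop := summable [set: I] (EFin \o f).

Definition nnsum f : R := fine (\esum_(i in [set: I]) (f i)%:E).

(* The sum of an absolutely summable real family, positive part minus negative
   part. *)
Definition rsum f : R :=
  nnsum (fun i => Num.max (f i) 0) - nnsum (fun i => Num.max (- f i) 0).

Definition csum (f : I -> R[i]) : R[i] :=
  rsum (fun i => complex.Re (f i)) +i* rsum (fun i => complex.Im (f i)).

Lemma rsummable_le f g :
  (forall i, `|f i| <= g i) -> rsummable g -> rsummable f.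
Proof.
move=> fg; apply: le_lt_trans; apply: le_esum => i _ /=.
by rewrite lee_fin (le_trans (fg i))// ler_norm.
Qed.

Lemma rsummableD f g :
  rsummable f -> rsummable g -> rsummable (fun i => f i + g i).
Proof. exact: summableD. Qed.

Lemma nnsumE f : (forall i, 0 <= f i) -> rsummable f ->
  (nnsum f)%:E = \esum_(i in [set: I]) (f i)%:E.
Proof.
move=> f0 sf; rewrite fineK// fin_real//; apply/andP; split.
  by rewrite (lt_le_trans (ltNyr 0))// esum_ge0// => i _; rewrite lee_fin.
move: sf; rewrite /rsummable /summable.
by under eq_esum do rewrite /= ger0_norm//.
Qed.

Lemma nnsum_ge0 f : (forall i, 0 <= f i) -> 0 <= nnsum f.
Proof.
by move=> f0; rewrite fine_ge0// esum_ge0// => i _; rewrite lee_fin.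
Qed.

Lemma nnsumD f g : (forall i, 0 <= f i) -> (forall i, 0 <= g i) ->
  rsummable f -> rsummable g ->
  nnsum (fun i => f i + g i) = nnsum f + nnsum g.
Proof.
move=> f0 g0 sf sg; apply: EFin_inj.
rewrite nnsumE//; [|by move=> i; exact: addr_ge0|exact: rsummableD].
rewrite EFinD !nnsumE// -esumD//.
- by move=> i _; rewrite lee_fin.
- by move=> i _; rewrite lee_fin.
Qed.

Lemma esumZ f (c : R) : (forall i, 0 <= f i) -> 0 <= c ->
  (\esum_(i in [set: I]) (c * f i)%:E =
   c%:E * \esum_(i in [set: I]) (f i)%:E)%E.
Proof.
move=> f0 c0; rewrite /esum -ereal_supZl//; last first.
  apply/set0P; exists 0%E; exists set0; first exact: fsets_set0.
  by rewrite fsbig_set0.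
congr ereal_sup; rewrite image_comp; apply: eq_imagel => A _ /=.
by rewrite ge0_mule_fsumr// => i; rewrite lee_fin.
Qed.

Lemma rsummableZ f (c : R) : rsummable f -> rsummable (fun i => c * f i).
Proof.
rewrite /rsummable /summable => sf.
rewrite (eq_esum (b := fun i => (`|c| * `|f i|)%:E)); last first.
  by move=> i _ /=; rewrite normrM.
by rewrite esumZ// lte_mul_pinfty.
Qed.

Lemma nnsumZ f (c : R) : (forall i, 0 <= f i) -> 0 <= c -> rsummable f ->
  nnsum (fun i => c * f i) = c * nnsum f.
Proof.
move=> f0 c0 sf; apply: EFin_inj; rewrite nnsumE//.
- by rewrite EFinM nnsumE// esumZ.
- by move=> i; exact: mulr_ge0.
- exact: rsummableZ.
Qed.

Lemma le_nnsum f g : (forall i, 0 <= f i <= g i) -> rsummable g ->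
  nnsum f <= nnsum g.
Proof.
move=> fg sg; have f0 i : 0 <= f i by case/andP: (fg i).
have g0 i : 0 <= g i by case/andP: (fg i) => /le_trans; exact.
rewrite -lee_fin !nnsumE//.
  by apply: le_esum => i _; rewrite lee_fin; case/andP: (fg i).
by apply: rsummable_le sg => i; rewrite ger0_norm//; case/andP: (fg i).
Qed.

Lemma nnsum_eq0 f : (forall i, 0 <= f i) -> rsummable f ->
  nnsum f = 0 -> forall i, f i = 0.
Proof.
move=> f0 sf e i; apply/eqP; rewrite eq_le f0 andbT -lee_fin -e nnsumE//.
rewrite (esumID [set i])//; last by move=> j _; rewrite lee_fin.
rewrite setTI esum_set1 ?lee_fin// leeDl// esum_ge0// => j _.
by rewrite lee_fin.
Qed.

Let posnegB (x : R) : Num.max x 0 - Num.max (- x) 0 = x.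
Proof.
have [x0|x0] := leP x 0.
  by rewrite max_l ?oppr_ge0// sub0r opprK.
by rewrite max_r ?oppr_le0 1?ltW// subr0.
Qed.

Lemma rsumB f g : (forall i, 0 <= f i) -> (forall i, 0 <= g i) ->
  rsummable f -> rsummable g ->
  rsum (fun i => f i - g i) = nnsum f - nnsum g.
Proof.
move=> f0 g0 sf sg.
have p0 i : 0 <= Num.max (f i - g i) 0 by rewrite le_max lexx orbT.
have n0 i : 0 <= Num.max (- (f i - g i)) 0 by rewrite le_max lexx orbT.
have sp : rsummable (fun i => Num.max (f i - g i) 0).
  apply: rsummable_le sf => i; rewrite ger0_norm// ge_max f0 andbT.
  by rewrite lerBlDr lerDl.
have sn : rsummable (fun i => Num.max (- (f i - g i)) 0).
  apply: rsummable_le sg => i; rewrite ger0_norm// ge_max g0 andbT opprB.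
  by rewrite lerBlDr lerDl.
apply/eqP; rewrite /rsum subr_eq addrAC eq_sym subr_eq; apply/eqP.
rewrite -!nnsumD//; congr nnsum; apply/funext => i.
by have := posnegB (f i - g i); set a := Num.max _ _; set b := Num.max _ _; lra.
Qed.

Let rpos f i : 0 <= Num.max (f i) 0.
Proof. by rewrite le_max lexx orbT. Qed.

Let rneg f i : 0 <= Num.max (- f i) 0.
Proof. by rewrite le_max lexx orbT. Qed.

Let sposneg f : rsummable f ->
  rsummable (fun i => Num.max (f i) 0) /\
  rsummable (fun i => Num.max (- f i) 0).
Proof.
move=> sf; have sf' : rsummable (fun i => `|f i|).
  rewrite /rsummable /summable; under eq_esum do rewrite /= normr_id.
  exact: sf.
split; apply: rsummable_le sf' => i; rewrite ger0_norm// ge_max normr_ge0.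
  by rewrite ler_norm.
by rewrite -normrN ler_norm.
Qed.

Lemma rsumD f g : rsummable f -> rsummable g ->
  rsum (fun i => f i + g i) = rsum f + rsum g.
Proof.
move=> /sposneg[sfp sfn] /sposneg[sgp sgn].
transitivity (rsum (fun i => (Num.max (f i) 0 + Num.max (g i) 0)
                    - (Num.max (- f i) 0 + Num.max (- g i) 0))).
  congr rsum; apply/funext => i.
  by rewrite opprD addrACA !posnegB.
have D0 (u v : I -> R) i : 0 <= Num.max (u i) 0 + Num.max (v i) 0.
  by rewrite addr_ge0// le_max lexx orbT.
rewrite (rsumB (D0 f g) (D0 (fun i => - f i) (fun i => - g i)) (rsummableD sfp sgp)
  (rsummableD sfn sgn)).
rewrite (nnsumD (rpos f) (rpos g) sfp sgp) (nnsumD (rneg f) (rneg g) sfn sgn).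
by rewrite /rsum opprD addrACA.
Qed.

Lemma rsumN f : rsum (fun i => - f i) = - rsum f.
Proof.
rewrite /rsum opprB; congr (_ - _); congr nnsum.
by apply/funext => i; rewrite opprK.
Qed.

Lemma rsumZ f (c : R) : rsummable f -> rsum (fun i => c * f i) = c * rsum f.
Proof.
have H g d : 0 <= d -> rsummable g -> rsum (fun i => d * g i) = d * rsum g.
  move=> d0 /sposneg[sp sn]; rewrite /rsum mulrBr -!nnsumZ//.
  by congr (nnsum _ - nnsum _); apply/funext => i;
    rewrite maxr_pMr// mulr0 ?mulrN.
have [c0|c0 sf] := leP 0 c; first exact: H.
rewrite -[c]opprK mulNr -H//; last by rewrite oppr_ge0 ltW.
by rewrite -rsumN; congr rsum; apply/funext => i; rewrite mulNr.
Qed.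

Lemma rsum_ge0E f : (forall i, 0 <= f i) -> rsum f = nnsum f.
Proof.
move=> f0; rewrite /rsum -[RHS]subr0; congr (_ - _).
  by congr nnsum; apply/funext => i; apply/max_idPl.
rewrite /nnsum esum1// => i _; congr EFin; apply/max_idPr.
by rewrite oppr_le0.
Qed.

End Summation.

Section L2.
Context (R : realType) (I : choiceType).
Local Notation C := R[i].
Local Notation normc := (@Normc.normc R).

Lemma normc_ge0 (z : C) : 0 <= normc z.
Proof. by case: z => a b; rewrite sqrtr_ge0. Qed.

Lemma normcCE (z : C) : `|z| = (normc z)%:C.
Proof. by case: z. Qed.

Lemma normcD_le (u v : C) : normc (u + v) <= normc u + normc v.
Proof. by rewrite -lecR rmorphD/= -!normcCE ler_normD. Qed.

Lemma sqr_normcE (z : C) : normc z ^+ 2 = complex.Re z ^+ 2 + complex.Im z ^+ 2.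
Proof. by case: z => a b; rewrite sqr_sqrtr// addr_ge0 ?sqr_ge0. Qed.

Definition l2_pred : {pred (I -> C)} :=
  fun f => `[< rsummable (fun i => normc (f i) ^+ 2) >].

Lemma l2_submod_closed : submod_closed l2_pred.
Proof.
split.
  apply/asboolP; rewrite /rsummable /summable esum1 ?ltry// => i _.
  by rewrite /comp/= !expr0n/= addr0 sqrtr0 expr0n/= normr0.
move=> c f g /asboolP sf /asboolP sg; apply/asboolP.
have s : rsummable (fun i => 2 * (normc c ^+ 2 * normc (f i) ^+ 2) +
                             2 * normc (g i) ^+ 2).
  exact: rsummableD (rsummableZ _ (rsummableZ _ sf)) (rsummableZ _ sg).
apply: rsummable_le s => i; rewrite ger0_norm ?sqr_ge0//.
rewrite -exprMn -Normc.normcM.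
set u := _ + _; have -> : u i = c * f i + g i by [].
have := normc_ge0 (c * f i + g i); have := normcD_le (c * f i) (g i).
set a := Normc.normc _; set b := Normc.normc _; set d := Normc.normc _ => h h0.
have : a ^+ 2 <= (b + d) ^+ 2 by rewrite lerXn2r// nnegrE ?addr_ge0 ?normc_ge0.
by have := sqr_ge0 (b - d); nra.
Qed.

HB.instance Definition _ := GRing.isSubmodClosed.Build _ _ l2_pred
  l2_submod_closed.

Record l2 := L2 { l2_fun :> I -> C ; l2_funP : l2_fun \in l2_pred }.

HB.instance Definition _ := [isSub for l2_fun].
HB.instance Definition _ := [Choice of l2 by <:].
HB.instance Definition _ := [SubChoice_isSubLmodule of l2 by <:].

Implicit Types x y z : l2.

Lemma l2P x y : (forall i, x i = y i) -> x = y.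
Proof. by move=> xy; apply/val_inj/funext. Qed.

Lemma l2_summable x : rsummable (fun i => normc (x i) ^+ 2).
Proof. exact/asboolP/l2_funP. Qed.

Lemma l2D x y i : (x + y) i = x i + y i. Proof. by []. Qed.

Lemma l2Z c x i : (c *: x) i = c * x i. Proof. by []. Qed.

Lemma l20 i : (0 : l2) i = 0. Proof. by []. Qed.

Lemma l2N x i : (- x) i = - x i. Proof. by []. Qed.

Definition l2norm x : R := Num.sqrt (nnsum (fun i => normc (x i) ^+ 2)).

Let sq0 x i : 0 <= normc (x i) ^+ 2. Proof. exact: sqr_ge0. Qed.

Lemma sqr_l2norm x : l2norm x ^+ 2 = nnsum (fun i => normc (x i) ^+ 2).
Proof. by rewrite sqr_sqrtr// nnsum_ge0. Qed.

Lemma l2norm_eq0 x : l2norm x = 0 -> x = 0.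
Proof.
move=> x0; apply: l2P => i; rewrite l20; apply: Normc.eq0_normc.
have e : nnsum (fun i => normc (x i) ^+ 2) = 0.
  by rewrite -sqr_l2norm x0 expr0n.
have /eqP := nnsum_eq0 (sq0 x) (l2_summable x) e i.
by rewrite sqrf_eq0 => /eqP.
Qed.

Lemma l2normZ c x : l2norm (c *: x) = normc c * l2norm x.
Proof.
apply/eqP; rewrite -(eqrXn2 (n := 2))//; last 2 first.
- exact: sqrtr_ge0.
- by rewrite mulr_ge0 ?normc_ge0 ?sqrtr_ge0.
rewrite exprMn !sqr_l2norm -nnsumZ ?sqr_ge0//; last exact: l2_summable.
by apply/eqP; congr nnsum; apply/funext => i; rewrite l2Z Normc.normcM exprMn.
Qed.

Lemma l2normD x y : l2norm (x + y) <= l2norm x + l2norm y.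
Proof.
have [/l2norm_eq0->|x0] := eqVneq (l2norm x) 0; first by rewrite add0r ler_wpDl ?sqrtr_ge0.
have [/l2norm_eq0->|y0] := eqVneq (l2norm y) 0; first by rewrite addr0 ler_wpDr ?sqrtr_ge0.
have xp : 0 < l2norm x by rewrite lt0r x0 sqrtr_ge0.
have yp : 0 < l2norm y by rewrite lt0r y0 sqrtr_ge0.
rewrite -(ler_pXn2r (n := 2))// ?nnegrE ?sqrtr_ge0 ?addr_ge0 ?sqrtr_ge0//.
pose t := l2norm y / l2norm x; pose s := l2norm x / l2norm y.
have t0 : 0 < t by rewrite divr_gt0.
have s0 : 0 < s by rewrite divr_gt0.
have ts : t * s = 1 by rewrite /t /s mulrA divfK// divff.
have tx : t * l2norm x = l2norm y by rewrite /t divfK.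
have sy : s * l2norm y = l2norm x by rewrite /s divfK.
have -> : (l2norm x + l2norm y) ^+ 2 =
    (1 + t) * l2norm x ^+ 2 + (1 + s) * l2norm y ^+ 2.
  by rewrite !mulrDl !mul1r !expr2 !mulrA tx sy; ring.
clearbody t s.
have t1 : 0 <= 1 + t by rewrite addr_ge0 ?ltW.
have s1 : 0 <= 1 + s by rewrite addr_ge0 ?ltW.
rewrite !sqr_l2norm -(nnsumZ (sq0 x) t1 (l2_summable x)).
rewrite -(nnsumZ (sq0 y) s1 (l2_summable y)) -nnsumD; last 4 first.
- by move=> i; rewrite mulr_ge0.
- by move=> i; rewrite mulr_ge0.
- exact/rsummableZ/l2_summable.
- exact/rsummableZ/l2_summable.
apply: le_nnsum; last by apply: rsummableD; exact/rsummableZ/l2_summable.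
move=> i; rewrite l2D sqr_ge0 andTb.
have := normc_ge0 (x i + y i); have := normcD_le (x i) (y i).
set a := Normc.normc _; set b := Normc.normc _; set d := Normc.normc _ => h h0.
have : a ^+ 2 <= (b + d) ^+ 2 by rewrite lerXn2r// nnegrE ?addr_ge0 ?normc_ge0.
move/le_trans; apply.
have : 0 <= s * (t * b - d) ^+ 2 by rewrite mulr_ge0 ?sqr_ge0// ltW.
have -> : s * (t * b - d) ^+ 2 = (t * s) * t * b ^+ 2 - (t * s) * b * d *+ 2 + s * d ^+ 2 by ring.
rewrite ts !mul1r; lra.
Qed.

Lemma l2norm_subproofD x y : (l2norm (x + y))%:C <= (l2norm x)%:C + (l2norm y)%:C.
Proof. by rewrite -rmorphD lecR l2normD. Qed.

Lemma l2norm_subproofZ c x : (l2norm (c *: x))%:C = `|c| * (l2norm x)%:C.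
Proof. by rewrite normcCE -rmorphM l2normZ. Qed.

Lemma l2norm_subproof0 x : (l2norm x)%:C = 0 -> x = 0.
Proof. by move=> [] /l2norm_eq0. Qed.

HB.instance Definition _ := Lmodule_isNormed.Build R[i] l2
  l2norm_subproofD l2norm_subproofZ l2norm_subproof0.

Definition l2dot x y : C := csum (fun i => x i * (y i)^*).

End L2.

Section Csum.
Context (R : realType) (I : choiceType).
Local Notation C := R[i].
Implicit Types f g : I -> C.

Definition csummable f : Prop := rsummable (fun i => Normc.normc (f i)).

Lemma csummable_ReIm f : csummable f ->
  rsummable (fun i => complex.Re (f i)) /\ rsummable (fun i => complex.Im (f i)).
Proof.
move=> sf; split; apply: rsummable_le sf => i; case: (f i) => a b /=;
  rewrite -sqrtr_sqr ler_sqrt ?addr_ge0 ?sqr_ge0//.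
  by rewrite lerDl sqr_ge0.
by rewrite lerDr sqr_ge0.
Qed.

Lemma csumD f g : csummable f -> csummable g ->
  csum (fun i => f i + g i) = csum f + csum g.
Proof.
move=> /csummable_ReIm[f1 f2] /csummable_ReIm[g1 g2].
rewrite /csum; apply/eqP; rewrite eq_complex/=; apply/andP; split; apply/eqP.
  rewrite -rsumD//; congr rsum; apply/funext => i.
  by case: (f i) => ? ?; case: (g i).
rewrite -rsumD//; congr rsum; apply/funext => i.
by case: (f i) => ? ?; case: (g i).
Qed.

Lemma csumZ (c : C) f : csummable f -> csum (fun i => c * f i) = c * csum f.
Proof.
move=> /csummable_ReIm[f1 f2]; case: c => a b.
rewrite /csum; apply/eqP; rewrite eq_complex/=; apply/andP; split; apply/eqP.
  rewrite -!rsumZ// -rsumN -rsumD//; last 2 first.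
  - exact: rsummableZ.
  - rewrite (_ : (fun i => _) = (fun i => (- b) * complex.Im (f i))).
      exact: rsummableZ.
    by apply/funext => i; rewrite mulNr.
  by congr rsum; apply/funext => i; case: (f i).
rewrite -!rsumZ// -rsumD//; last 2 first.
- exact: rsummableZ.
- exact: rsummableZ.
by congr rsum; apply/funext => i; case: (f i).
Qed.

Lemma csum_conj f : csum (fun i => (f i)^*) = (csum f)^*.
Proof.
rewrite /csum; apply/eqP; rewrite eq_complex/=; apply/andP; split; apply/eqP.
  by congr rsum; apply/funext => i; case: (f i).
by rewrite -rsumN; congr rsum; apply/funext => i; case: (f i).
Qed.

Implicit Types x y z : l2 R I.

Lemma l2_csummable x y : csummable (fun i => x i * (y i)^*).
Proof.
apply: rsummable_le (rsummableD (l2_summable x) (l2_summable y)) => i.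
rewrite ger0_norm ?normc_ge0// Normc.normcM.
have -> : Normc.normc (y i)^* = Normc.normc (y i).
  by case: (y i) => a b /=; rewrite sqrrN.
set a := Normc.normc _; set b := Normc.normc _.
have : 0 <= a by exact: normc_ge0.
have : 0 <= b by exact: normc_ge0.
by move=> a0 b0; have := sqr_ge0 (a - b); nra.
Qed.

Lemma l2dotC x y : l2dot x y = (-1) ^+ false * (l2dot y x)^*.
Proof.
rewrite mul1r /l2dot -csum_conj; congr csum; apply/funext => i.
by rewrite rmorphM/= conjCK mulrC.
Qed.

Lemma l2dotDZl z c x y : l2dot (c *: x + y) z = c * l2dot x z + l2dot y z.
Proof.
rewrite /l2dot -csumZ; last exact: l2_csummable.
rewrite -csumD; last 2 first.
- rewrite /csummable; have := rsummableZ (Normc.normc c) (l2_csummable x z).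
  congr rsummable; apply/funext => i /=.
  by rewrite -Normc.normcM.
- exact: l2_csummable.
congr csum; apply/funext => i.
by rewrite l2D l2Z mulrDl mulrA.
Qed.

Lemma l2dot_bilinear : bilinear_for
  (GRing.Scale.Law.clone _ _ *%R _) (GRing.Scale.Law.clone _ _ (@Num.conj C \; *%R) _)
  (@l2dot R I).
Proof.
split => [z|z] c x y; first exact: l2dotDZl.
rewrite [LHS]l2dotC l2dotDZl mul1r rmorphD rmorphM/=.
by congr (_ * _ + _); rewrite [RHS]l2dotC mul1r.
Qed.

HB.instance Definition _ := bilinear_isBilinear.Build C (l2 R I) (l2 R I) C _ _
  (@l2dot R I) l2dot_bilinear.

HB.instance Definition _ := isHermitianSesquilinear.Build C (l2 R I) false
  (@Num.conj C) (@l2dot R I) l2dotC.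

Lemma l2dotE x : l2dot x x = (l2norm x ^+ 2)%:C.
Proof.
rewrite sqr_l2norm -rsum_ge0E; last by move=> i; exact: sqr_ge0.
rewrite /l2dot /csum; apply/eqP; rewrite eq_complex/=; apply/andP; split; apply/eqP.
  congr rsum; apply/funext => i; rewrite sqr_normcE.
  by case: (x i) => a b /=; rewrite mulrN opprK !expr2.
transitivity (rsum (fun _ : I => 0 : R)).
  congr rsum; apply/funext => i.
  by case: (x i) => a b /=; rewrite mulrN addrC mulrC subrr.
by rewrite rsum_ge0E// /nnsum esum1.
Qed.

Lemma l2dot_gt0 x : x != 0 -> 0 < l2dot x x.
Proof.
move=> x0; rewrite l2dotE ltcR exprn_gt0// lt0r sqrtr_ge0 andbT.
by apply: contra_neq x0; exact: l2norm_eq0.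
Qed.

HB.instance Definition _ := isDotProduct.Build C (l2 R I) (@l2dot R I) l2dot_gt0.

End Csum.

Section Basis.
Context (R : realType) (I : choiceType).

Lemma l2_delta_subproof (i : I) : (fun j => (j == i)%:R : R[i]) \in @l2_pred R I.
Proof.
apply/asboolP; rewrite /rsummable /summable (esumID [set i])//.
rewrite setTI esum_set1// [X in (_ + X)%E]esum1 ?adde0 ?ltry// => j [_ /= ji].
by rewrite (introF eqP ji) /= !expr0n/= addr0 sqrtr0 expr0n normr0.
Qed.

Definition l2_delta (i : I) : l2 R I := L2 (l2_delta_subproof i).

Lemma l2_deltaE i j : l2_delta i j = (j == i)%:R.
Proof. by []. Qed.

End Basis.

Section Operators.
Context (R : realType) (I : choiceType).
Local Notation C := R[i].
Local Notation H := (l2 R I).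
Local Notation "''[' x , y ]" := (l2dot x y).
Implicit Types (A B : H -> H) (T : (H -> H) * (H -> H)) (lambda : C * C).

Lemma l2_normE (x : H) : `|x| = (l2norm x)%:C. Proof. by []. Qed.

Lemma l2_sqr_norm (x : H) : `|x| ^+ 2 = '[x, x].
Proof. by rewrite l2_normE l2dotE rmorphXn. Qed.

Definition bounded_op A : Prop :=
  linear A /\ exists M : C, forall x, `|A x| <= M * `|x|.

(* For a bounded A the set below is a singleton (Riesz); the default value is
   irrelevant. *)
Definition adjoint A : H -> H :=
  xget (fun=> 0) [set B | forall x y, '[A x, y] = '[x, B y]].

Definition commutator A B : H -> H := fun x => A (B x) - B (A x).

(* An n x n operator matrix M acts on H^n by (M v)_i = \sum_j M i j (v j). *)
Definition psd_opmx n (M : 'I_n -> 'I_n -> H -> H) : Prop :=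
  forall v : 'I_n -> H, 0 <= \sum_i '[\sum_j M i j (v j), v i].

Definition hyponormal n (S : 'I_n -> H -> H) : Prop :=
  psd_opmx (fun i j => commutator (adjoint (S j)) (S i)).

(* T1, T2, T1^2, T2 T1, T2^2, ..., T1^k, T2 T1^(k-1), ..., T2^k *)
Definition power_tuple k T : seq (H -> H) :=
  [seq iter q T.2 \o iter (m - q) T.1 | m <- iota 1 k, q <- iota 0 m.+1].

Definition k_hyponormal k T : Prop :=
  hyponormal (tnth (in_tuple (power_tuple k T))).

Definition op_shift A (c : C) : H -> H := fun x => A x - c *: x.

Definition pair_shift T lambda : (H -> H) * (H -> H) :=
  (op_shift T.1 lambda.1, op_shift T.2 lambda.2).

(* The Koszul complex 0 -> H -> H^2 -> H -> 0 of a pair. *)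
Definition koszul0 T : H -> H * H := fun x => (T.1 x, T.2 x).

Definition koszul1 T : H * H -> H := fun x => T.1 x.2 - T.2 x.1.

Definition ker (E F : zmodType) (f : E -> F) : set E := [set x | f x = 0].

Definition koszul_exact T : Prop :=
  [/\ ker (koszul0 T) = [set 0],
      ker (koszul1 T) = range (koszul0 T) &
      range (koszul1 T) = [set: H]].

(* dim (Z / B) < oo *)
Definition fin_dim_quotient (E : lmodType C) (Z B : set E) : Prop :=
  exists n (b : 'I_n -> E), (forall i, Z (b i)) /\
    forall z, Z z -> exists c : 'I_n -> C, B (z - \sum_i c i *: b i).

(* All homology spaces are finite dimensional; for bounded operators this
   forces the ranges to be closed. *)
Definition koszul_fredholm T : Prop :=
  [/\ fin_dim_quotient (ker (koszul0 T)) [set 0],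
      fin_dim_quotient (ker (koszul1 T)) (range (koszul0 T)) &
      fin_dim_quotient [set: H] (range (koszul1 T))].

Definition taylor_spectrum T : set (C * C) :=
  [set lambda | ~ koszul_exact (pair_shift T lambda)].

Definition taylor_essential_spectrum T : set (C * C) :=
  [set lambda | ~ koszul_fredholm (pair_shift T lambda)].

Definition invertible_op A : Prop :=
  exists B, [/\ bounded_op B, cancel A B & cancel B A].

Definition fredholm_op A : Prop :=
  fin_dim_quotient (ker A) [set 0] /\ fin_dim_quotient [set: H] (range A).

Definition row_square T : H -> H :=
  fun x => T.1 (adjoint T.1 x) + T.2 (adjoint T.2 x).

Definition right_spectrum T : set (C * C) :=
  [set lambda | ~ invertible_op (row_square (pair_shift T lambda))].

Definition right_essential_spectrum T : set (C * C) :=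
  [set lambda | ~ fredholm_op (row_square (pair_shift T lambda))].

End Operators.

Section PlaneSets.
Context (R : realType).
Local Notation C := R[i].

Definition boundary (X : topologicalType) (A : set X) : set X :=
  closure A `\` interior A.

(* Boundary of the unbounded component of the complement; for compact L there is
   exactly one. *)
Definition outer_boundary (L : set (R * R)) : set (R * R) :=
  [set p | exists x, let U := connected_component (~` L) x in
     [/\ (~` L) x, ~ bounded_set U & boundary U p]].

Definition modulus (z : C * C) : R * R := (Normc.normc z.1, Normc.normc z.2).

(* Not the topological boundary of K: the points of C^2 whose moduli lie on the
   outer boundary of |K| in the full plane R^2. *)
Definition reinhardt_boundary (K : set (C * C)) : set (C * C) :=
  [set z | outer_boundary (modulus @` K) (modulus z)].

Definition closed_disk : set C := [set z | `|z| <= 1].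

Definition unit_circle : set C := [set z | `|z| = 1].

Definition dilation (r : R) (A : set C) : set C := [set r%:C * z | z in A].

End PlaneSets.

Section WeightedShift.
Context (R : realType).
Local Notation C := R[i].
Local Notation H := (l2 R (nat * nat)%type).
Implicit Types (w : nat -> nat -> R).

Definition bounded_weights w : Prop := exists M, forall i j, `|w i j| <= M.

(* Coordinates of the image of x under e_(i,j) |-> w i j e_(i+1,j) and under
   e_(i,j) |-> w i j e_(i,j+1). *)
Definition shift1_coord w (x : nat * nat -> C) : nat * nat -> C :=
  fun p => if p.1 is i.+1 then (w i p.2)%:C * x (i, p.2) else 0.

Definition shift2_coord w (x : nat * nat -> C) : nat * nat -> C :=
  fun p => if p.2 is j.+1 then (w p.1 j)%:C * x (p.1, j) else 0.

(* For bounded weights the default value 0 is never used: see wshift1E,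
   wshift2E. *)
Definition wshift1 w : H -> H := fun x : H => insubd (0 : H) (shift1_coord w x).

Definition wshift2 w : H -> H := fun x : H => insubd (0 : H) (shift2_coord w x).

Lemma esum_push (s : nat * nat -> nat * nat) (F : nat * nat -> \bar R) :
  injective s -> (forall q, (forall p, q <> s p) -> F q = 0%E) ->
  (forall q, (0 <= F q)%E) ->
  (\esum_(q in [set: nat * nat]) F q = \esum_(p in [set: nat * nat]) F (s p))%E.
Proof.
move=> sI F0 Fge0; rewrite (esumID (range s))// setTI.
rewrite [X in (_ + X)%E]esum1 ?adde0; last first.
  by move=> q [_ Nq]; apply: F0 => p qp; apply: Nq; exists p.
by rewrite esum_image// => p q _ _; exact: sI.
Qed.

Lemma push_bound (s : nat * nat -> nat * nat) (c : nat * nat -> R) (M : R)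
    (x : H) (y : nat * nat -> C) : injective s ->
  (forall p, y (s p) = (c p)%:C * x p) ->
  (forall q, (forall p, q <> s p) -> y q = 0) ->
  (forall p, `|c p| <= M) ->
  rsummable (fun q => Normc.normc (y q) ^+ 2) /\
  nnsum (fun q => Normc.normc (y q) ^+ 2) <= M ^+ 2 * l2norm x ^+ 2.
Proof.
move=> sI ys y0 cM.
have M0 : 0 <= M by rewrite (le_trans _ (cM (0, 0)%N)).
have b p : `|Normc.normc (y (s p)) ^+ 2| <= M ^+ 2 * Normc.normc (x p) ^+ 2.
  rewrite ger0_norm ?sqr_ge0// ys Normc.normcM exprMn ler_wpM2r ?sqr_ge0//.
  by rewrite /= expr0n/= addr0 sqrtr_sqr lerXn2r// nnegrE.
have E (F : nat * nat -> R) : (forall q, (forall p, q <> s p) -> F q = 0) ->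
    (forall q, 0 <= F q) ->
    (\esum_(q in [set: nat * nat]) (F q)%:E =
     \esum_(p in [set: nat * nat]) (F (s p))%:E)%E.
  move=> F0 Fge0; rewrite (@esum_push s (fun q => (F q)%:E))//.
  by move=> q /F0 ->.
have ny0 q : (forall p, q <> s p) -> Normc.normc (y q) ^+ 2 = 0.
  by move=> /y0 ->; rewrite /= !expr0n/= addr0 sqrtr0 expr0n.
have nyge0 q : 0 <= Normc.normc (y q) ^+ 2 by exact: sqr_ge0.
have sx := rsummableZ (M ^+ 2) (l2_summable x).
have ss := rsummable_le b sx.
split.
  move: ss; rewrite /rsummable /summable => ss.
  rewrite (eq_esum (b := fun q => (Normc.normc (y q) ^+ 2)%:E)); last first.
    by move=> q _ /=; rewrite ger0_norm.
  rewrite E//; apply: le_lt_trans ss; apply: le_esum => p _ /=.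
  by rewrite lee_fin ler_norm.
rewrite sqr_l2norm -nnsumZ ?sqr_ge0//; [|by move=> i; exact: sqr_ge0|exact: l2_summable].
rewrite {1}/nnsum E// -/(nnsum (fun p => Normc.normc (y (s p)) ^+ 2)).
apply: le_nnsum => // p; rewrite sqr_ge0 andTb.
by rewrite (le_trans _ (b p))// ler_norm.
Qed.

Let s1 (p : nat * nat) := (p.1.+1, p.2).
Let s2 (p : nat * nat) := (p.1, p.2.+1).

Let s1I : injective s1. Proof. by move=> [? ?] [? ?] [-> ->]. Qed.
Let s2I : injective s2. Proof. by move=> [? ?] [? ?] [-> ->]. Qed.

Lemma wshift_bound1 w M (x : H) : (forall i j, `|w i j| <= M) ->
  rsummable (fun q => Normc.normc (shift1_coord w x q) ^+ 2) /\
  nnsum (fun q => Normc.normc (shift1_coord w x q) ^+ 2)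
    <= M ^+ 2 * l2norm x ^+ 2.
Proof.
move=> wM; apply: (@push_bound s1 (fun p => w p.1 p.2)) => //.
- by case.
- by case=> -[|i] j// /(_ (i, j)).
Qed.

Lemma wshift_bound2 w M (x : H) : (forall i j, `|w i j| <= M) ->
  rsummable (fun q => Normc.normc (shift2_coord w x q) ^+ 2) /\
  nnsum (fun q => Normc.normc (shift2_coord w x q) ^+ 2)
    <= M ^+ 2 * l2norm x ^+ 2.
Proof.
move=> wM; apply: (@push_bound s2 (fun p => w p.1 p.2)) => //.
- by case.
- by case=> i [|j]// /(_ (i, j)).
Qed.

Lemma wshift1E w (x : H) p : bounded_weights w ->
  wshift1 w x p = shift1_coord w x p.
Proof.
move=> [M wM]; rewrite /wshift1 -[l2_fun _]/(val _) insubdK//.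
by apply/asboolP; case: (wshift_bound1 x wM).
Qed.

Lemma wshift2E w (x : H) p : bounded_weights w ->
  wshift2 w x p = shift2_coord w x p.
Proof.
move=> [M wM]; rewrite /wshift2 -[l2_fun _]/(val _) insubdK//.
by apply/asboolP; case: (wshift_bound2 x wM).
Qed.

Let bounded_of (A : H -> H) (M : R) : linear A -> 0 <= M ->
  (forall x : H, nnsum (fun q => Normc.normc (A x q) ^+ 2) <= M ^+ 2 * l2norm x ^+ 2) ->
  bounded_op A.
Proof.
move=> lA M0 AM; split=> //; exists M%:C => x.
rewrite !l2_normE -rmorphM lecR.
rewrite -(ler_pXn2r (n := 2))// ?nnegrE ?mulr_ge0 ?sqrtr_ge0//.
by rewrite sqr_l2norm exprMn.
Qed.

Lemma wshift1_bounded w : bounded_weights w -> bounded_op (wshift1 w).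
Proof.
move=> bw; have [M wM] := bw; have M0 : 0 <= M by exact: le_trans (wM 0 0)%N.
apply: (@bounded_of _ M) => // [c x y|x].
  apply: l2P => -[[|i] j]; rewrite l2D l2Z !wshift1E// /shift1_coord/=.
    by rewrite mulr0 addr0.
  by rewrite mulrDr mulrCA.
have [_] := wshift_bound1 x wM; congr (nnsum _ <= _).
by apply/funext => q; rewrite wshift1E.
Qed.

Lemma wshift2_bounded w : bounded_weights w -> bounded_op (wshift2 w).
Proof.
move=> bw; have [M wM] := bw; have M0 : 0 <= M by exact: le_trans (wM 0 0)%N.
apply: (@bounded_of _ M) => // [c x y|x].
  apply: l2P => -[i [|j]]; rewrite l2D l2Z !wshift2E// /shift2_coord/=.
    by rewrite mulr0 addr0.
  by rewrite mulrDr mulrCA.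
have [_] := wshift_bound2 x wM; congr (nnsum _ <= _).
by apply/funext => q; rewrite wshift2E.
Qed.

Lemma wshift1_delta w i j : bounded_weights w ->
  wshift1 w (l2_delta R (i, j)) = (w i j)%:C *: l2_delta R (i.+1, j).
Proof.
move=> bw; apply: l2P => -[[|i'] j']; rewrite wshift1E// l2Z !l2_deltaE.
  by rewrite mulr0.
by rewrite /shift1_coord; cbn [fst snd]; rewrite l2_deltaE !xpair_eqE eqSS;
  case: eqP => [->|_]; case: eqP => [->|_]//=; rewrite !mulr0.
Qed.

Lemma wshift2_delta w i j : bounded_weights w ->
  wshift2 w (l2_delta R (i, j)) = (w i j)%:C *: l2_delta R (i, j.+1).
Proof.
move=> bw; apply: l2P => -[i' [|j']]; rewrite wshift2E// l2Z !l2_deltaE.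
  by rewrite xpair_eqE andbF mulr0.
by rewrite /shift2_coord; cbn [fst snd]; rewrite l2_deltaE !xpair_eqE eqSS;
  case: eqP => [->|_]; case: eqP => [->|_]//=; rewrite !mulr0.
Qed.

Lemma wshift_comm a b : bounded_weights a -> bounded_weights b ->
  (forall i j, b i.+1 j * a i j = a i j.+1 * b i j) ->
  forall x : H, wshift1 a (wshift2 b x) = wshift2 b (wshift1 a x).
Proof.
move=> ba bb ab x; apply: l2P => p; rewrite (wshift1E _ _ ba) (wshift2E _ _ bb).
case: p => [[|i] [|j]]; rewrite /shift1_coord /shift2_coord; cbn [fst snd].
- by [].
- by rewrite (wshift1E _ _ ba) /shift1_coord mulr0.
- by rewrite (wshift2E _ _ bb) /shift2_coord mulr0.
rewrite (wshift1E _ _ ba) (wshift2E _ _ bb) /shift1_coord /shift2_coord.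
by cbn [fst snd]; rewrite !mulrA -!rmorphM -ab mulrC.
Qed.

End WeightedShift.

Section ShiftPair.
Context (R : realType) (kappa y0 : R).

(* W_kappa = shift(xweight 0, xweight 1, ...) *)
Definition xweight (n : nat) : R :=
  Num.sqrt ((1 + kappa ^+ n.+1) / (1 + kappa ^+ n)).

Definition alpha (i j : nat) : R := if j is 0 then xweight i else 1.

Definition beta (i j : nat) : R :=
  if j is 0 then y0 / \prod_(k < i) xweight k else 1.

Definition shift_pair :
    (l2 R (nat * nat)%type -> l2 R (nat * nat)%type) *
    (l2 R (nat * nat)%type -> l2 R (nat * nat)%type) :=
  (wshift1 alpha, wshift2 beta).

Context (kappa_gt1 : 1 < kappa) (y0_gt0 : 0 < y0).

Let den_gt0 n : 0 < 1 + kappa ^+ n.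
Proof. by rewrite addr_gt0// exprn_gt0// (lt_trans ltr01). Qed.

Lemma xweight_ge1 n : 1 <= xweight n.
Proof.
rewrite -sqrtr1 ler_wsqrtr// ler_pdivlMr// mul1r lerD2l exprS.
by rewrite ler_peMl ?exprn_ge0 ?ltW// (lt_trans ltr01).
Qed.

Lemma xweight_le n : xweight n <= Num.sqrt kappa.
Proof.
rewrite ler_wsqrtr// ler_pdivrMr// mulrDr mulr1 -exprS lerD2r.
exact: ltW.
Qed.

Lemma alpha_gt0 i j : 0 < alpha i j.
Proof. by case: j => //=; rewrite (lt_le_trans ltr01)// xweight_ge1. Qed.

Lemma prod_xweight_ge1 n : 1 <= \prod_(k < n) xweight k.
Proof. by elim: n => [|n IHn]; rewrite ?big_ord0// big_ord_recr/= mulr_ege1// xweight_ge1. Qed.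

Lemma beta_gt0 i j : 0 < beta i j.
Proof.
by case: j => //=; rewrite divr_gt0// (lt_le_trans ltr01)// prod_xweight_ge1.
Qed.

Lemma alpha_bounded : bounded_weights alpha.
Proof.
exists (Num.sqrt kappa) => i j; rewrite gtr0_norm ?alpha_gt0//.
by case: j => [|j]/=; rewrite ?xweight_le// (le_trans (xweight_ge1 0))// xweight_le.
Qed.

Lemma beta_bounded : bounded_weights beta.
Proof.
exists (y0 + 1) => i j; rewrite gtr0_norm ?beta_gt0//.
case: j => [|j]/=; last by rewrite lerDr ltW.
rewrite (le_trans (y := y0))// ?lerDl//.
have p1 := prod_xweight_ge1 i.
by rewrite ler_pdivrMr ?(lt_le_trans ltr01)// ler_peMr// ltW.
Qed.

Lemma alpha_beta_comm i j : beta i.+1 j * alpha i j = alpha i j.+1 * beta i j.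
Proof.
case: j => [|j]//=; rewrite mul1r big_ord_recr/= invfM mulrA divfK//.
by rewrite gt_eqF// (lt_le_trans ltr01)// xweight_ge1.
Qed.

Lemma shift_pair_comm x :
  shift_pair.1 (shift_pair.2 x) = shift_pair.2 (shift_pair.1 x).
Proof.
exact: wshift_comm alpha_bounded beta_bounded alpha_beta_comm x.
Qed.

Lemma shift_pair_bounded : bounded_op shift_pair.1 /\ bounded_op shift_pair.2.
Proof.
split; [exact: wshift1_bounded alpha_bounded|].
exact: wshift2_bounded beta_bounded.
Qed.

End ShiftPair.

(* Main.v *)
Require Import Defs.
From mathcomp Require Import all_boot all_order all_algebra sesquilinear.
From mathcomp Require Import all_classical all_reals all_analysis.
From mathcomp Require Import complex zify lra ring.

Set Implicit Arguments.
Unset Strict Implicit.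
Unset Printing Implicit Defensive.

Import Order.TTheory GRing.Theory Num.Theory.
Import numFieldNormedType.Exports.

Local Open Scope classical_set_scope.
Local Open Scope complex_scope.
Local Open Scope ring_scope.

(** Let [g(i,j)] be the norm of [T1^i T2^j e_(0,0)]. Since [x_0 ... x_(i-1)] has
    square [(1 + kappa^i) / 2], we have [g(i,0)^2 = (1 + kappa^i) / 2] and
    [g(i,j) = y0] for [j > 0]. For [y0^2 = 1/2] the numbers [g(i,j)^2] are the
    moments of the measure with mass [1/2] at [(kappa, 0)] and at [(1, 1)], so
    that [T] is the restriction of a normal pair to an invariant subspace: the
    pair of coordinate functions on the disjoint union of a torus and of a
    circle. Subnormality implies [k]-hyponormality for every [k], by the
    criterion of Bram and Halmos ([hyponormal_dilation], [dilation_dot]).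

    For the spectra, [y0] may be any positive number. The upper rows form an
    invariant subspace on which [T] is a pair of unweighted shifts. Modulo that
    subspace, [T2] is zero and [T1] is [W_kappa], which is similar to
    [sqrt kappa] times the unweighted shift. The position of [(l1, l2)] with
    respect to the two corresponding polydisks, the closed unit bidisk and the
    disk of radius [sqrt kappa] in the axis [l2 = 0], decides everything.

    Away from the spectrum, or from the essential spectrum, every vector is of
    the form [(T1 - l1) z1 + (T2 - l2) z2], up to a multiple of [e_(0,0)] at the
    points of the spectrum, with a bound on the preimage: the equations are
    solved by Neumann series, running forward ([forward_solve]) where a shift is
    smaller than its parameter, and backward ([backward_solve]) where it is
    larger. Such a bound makes [A1 A1^* + A2 A2^*], for [A_i = T_i - l_i],
    coercive up to a rank one correction, hence invertible or Fredholm
    ([row_square_invertible], [row_square_fredholm]). The other homology spaces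
    of the Koszul complex are computed from the same solutions
    ([exact_l2_neq0], [exact_l1_large], [fredholm_bottom_row],
    [fredholm_bidisk]).

    At a point of the spectrum outside the essential spectrum, evaluation of
    power series at [(l1, l2)] is bounded and vanishes on the range of
    [(A1, A2)] ([evaluation_point]). At a point of the essential spectrum, the
    adjoints have approximate joint eigenvectors with supports that move to
    infinity, and then that range has infinite codimension: from disjoint
    approximate eigenvectors one builds, for every [n], a family of [n + 1]
    vectors that is independent modulo the range
    ([singular_sequence_infinite_codim]). In both cases neither the last map of
    the Koszul complex nor [A1 A1^* + A2 A2^*], whose range is smaller, can be
    onto or, respectively, have a range of finite codimension.

    Finally, the outer boundary of the moduli of the spectrum contains the open
    segment between [(1, 0)] and [(sqrt kappa, 0)], where [T - l] is
    Fredholm. *)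

(** * Linear functions given by a predicate *)

Section LinearFor.
Context (K : pzRingType) (V W : lmodType K).
Implicit Types f : V -> W.

Lemma linear_sub f u v : linear f -> f (u - v) = f u - f v.
Proof. by move=> lf; rewrite addrC -scaleN1r lf scaleN1r addrC. Qed.

Lemma linear_zero f : linear f -> f 0 = 0.
Proof. by move=> lf; rewrite -[X in f X](subrr 0) linear_sub// subrr. Qed.

Lemma linear_scale f c u : linear f -> f (c *: u) = c *: f u.
Proof. by move=> lf; rewrite -[X in f X]addr0 lf linear_zero// addr0. Qed.

Lemma linear_add f u v : linear f -> f (u + v) = f u + f v.
Proof. by move=> lf; rewrite -[u in LHS]scale1r lf scale1r. Qed.

End LinearFor.

(** * The Hilbert space of square summable families *)

Section Hilbert.
Context (R : realType) (I : choiceType).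
Local Notation C := R[i].
Local Notation normc := (@Normc.normc R).
Implicit Types (x y z : l2 R I) (f g : I -> R).

Lemma l2norm_ge0 x : 0 <= l2norm x.
Proof. exact: sqrtr_ge0. Qed.

Lemma l2norm0 : l2norm (0 : l2 R I) = 0.
Proof. by rewrite -(scale0r (0 : l2 R I)) l2normZ Normc.normc0 mul0r. Qed.

Lemma l2normN x : l2norm (- x) = l2norm x.
Proof. by rewrite -scaleN1r l2normZ normcN Normc.normc1 mul1r. Qed.

Lemma l2normB x y : l2norm (x - y) <= l2norm x + l2norm y.
Proof. by rewrite -(l2normN y) l2normD. Qed.

Lemma l2dotDl x y z : l2dot (x + y) z = l2dot x z + l2dot y z.
Proof. exact: linearDl. Qed.

Lemma l2dotDr x y z : l2dot x (y + z) = l2dot x y + l2dot x z.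
Proof. exact: linearDr. Qed.

Lemma l2dotBl x y z : l2dot (x - y) z = l2dot x z - l2dot y z.
Proof. exact: linearBl. Qed.

Lemma l2dotBr x y z : l2dot x (y - z) = l2dot x y - l2dot x z.
Proof. exact: linearBr. Qed.

Lemma l2dotZl c x y : l2dot (c *: x) y = c * l2dot x y.
Proof. exact: linearZl_LR. Qed.

Lemma l2dotZr c x y : l2dot x (c *: y) = c^* * l2dot x y.
Proof. exact: linearZr_LR. Qed.

Lemma l2dot_suml n (v : 'I_n -> l2 R I) x :
  l2dot (\sum_i v i) x = \sum_i l2dot (v i) x.
Proof. exact: linear_sumlz. Qed.

Lemma l2dot_sumr n (v : 'I_n -> l2 R I) x :
  l2dot x (\sum_i v i) = \sum_i l2dot x (v i).
Proof. exact: linear_sumr. Qed.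

Lemma l2dot_conj x y : l2dot y x = (l2dot x y)^*.
Proof. by rewrite l2dotC mul1r. Qed.

Lemma mul_conj_normc (c : C) : c * c^* = (normc c ^+ 2)%:C.
Proof. by rewrite -normCK normcCE rmorphXn. Qed.

Lemma normc_real (r : R) : normc r%:C = `|r|.
Proof. by rewrite /= expr0n/= addr0 sqrtr_sqr. Qed.

Lemma normc_conj (c : C) : normc c^* = normc c.
Proof. by case: c => a b /=; rewrite sqrrN. Qed.

Lemma normcV (c : C) : normc c^-1 = (normc c)^-1.
Proof. by apply: complexI; rewrite fmorphV/= -!normcCE normfV. Qed.

Lemma normcX (c : C) n : normc (c ^+ n) = normc c ^+ n.
Proof. by apply: complexI; rewrite rmorphXn/= -!normcCE normrX. Qed.

Lemma l2dot_CauchySchwarz x y : normc (l2dot x y) <= l2norm x * l2norm y.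
Proof.
have [->|y0] := eqVneq y 0.
  rewrite (_ : l2dot x 0 = 0) ?Normc.normc0 ?mulr_ge0 ?l2norm_ge0//.
  by rewrite -(scale0r (0 : l2 R I)) l2dotZr rmorph0 mul0r.
have n0 : 0 < l2norm y.
  by rewrite lt0r l2norm_ge0 andbT; apply: contra_neq y0; exact: l2norm_eq0.
set c := l2dot x y; set N : C := (l2norm y ^+ 2)%:C.
have Nc : N^* = N by rewrite /N; apply/CrealP/complex_realP; exists (l2norm y ^+ 2).
have : 0 <= l2dot (N *: x - c *: y) (N *: x - c *: y).
  by rewrite l2dotE lecR sqr_ge0.
rewrite !(l2dotBl, l2dotBr, l2dotZl, l2dotZr) Nc (l2dot_conj x y) -/c !l2dotE -/N.
have -> : N * (N * (l2norm x ^+ 2)%:C) - N * (c^* * c) - (c * (N * c^*) - c * (c^* * N))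
   = N * (N * (l2norm x ^+ 2)%:C - c * c^*) by ring.
rewrite mul_conj_normc /N -!(rmorphM, rmorphB)/= lecR pmulr_rge0 ?exprn_gt0//.
rewrite subr_ge0 -exprMn ler_pXn2r ?nnegrE ?mulr_ge0 ?normc_ge0 ?l2norm_ge0//.
by rewrite mulrC.
Qed.

Lemma l2dot_inj y z : (forall x, l2dot x y = l2dot x z) -> y = z.
Proof.
move=> yz; apply/eqP; rewrite -subr_eq0; apply/eqP/l2norm_eq0/eqP.
rewrite -sqrf_eq0; apply/eqP/complexI.
by rewrite -l2dotE l2dotBr yz subrr.
Qed.

Lemma sum_le_nnsum f (r : seq I) : (forall i, 0 <= f i) -> rsummable f ->
  uniq r -> \sum_(i <- r) f i <= nnsum f.
Proof.
move=> f0 sf ur; rewrite -lee_fin nnsumE//; apply: esum_ge.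
exists [set` r]; first by split => //; exact: finite_seq.
by rewrite -fsbig_seq//= -sumEFin.
Qed.

Lemma nnsum_le f (B : R) : (forall i, 0 <= f i) ->
  (forall r : seq I, uniq r -> \sum_(i <- r) f i <= B) ->
  rsummable f /\ nnsum f <= B.
Proof.
move=> f0 fB.
have e : (\esum_(i in [set: I]) (f i)%:E <= B%:E)%E.
  apply: ge_ereal_sup => _ [A [fA _] <-].
  by rewrite fsbig_finite//= sumEFin lee_fin fB// fset_uniq.
have sf : rsummable f.
  rewrite /rsummable /summable; under eq_esum do rewrite /= ger0_norm//.
  by rewrite (le_lt_trans e)// ltry.
by split => //; rewrite -lee_fin nnsumE.
Qed.

Lemma normc_coord x i : normc (x i) <= l2norm x.
Proof.
rewrite -(@ler_pXn2r _ 2)// ?nnegrE ?normc_ge0 ?l2norm_ge0// sqr_l2norm.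
have := @sum_le_nnsum (fun i => normc (x i) ^+ 2) [:: i]
  (fun i => sqr_ge0 _) (l2_summable x) isT.
by rewrite big_seq1.
Qed.

(** Adding to each term the geometric tail that bounds all later increments
    makes the sequence monotone. *)
Lemma geometric_is_cvg (a : nat -> R) (c q : R) : 0 <= q < 1 ->
  (forall n, `|a n.+1 - a n| <= c * q ^+ n) -> cvgn a.
Proof.
move=> /andP[q0 q1] ac; have d0 : 0 < 1 - q by rewrite subr_gt0.
have c0 : 0 <= c by have := ac 0%N; rewrite expr0 mulr1; apply: le_trans.
pose D := c / (1 - q).
have Dq : D * (1 - q) = c by rewrite /D divfK// gt_eqF.
have D0 : 0 <= D by rewrite divr_ge0// ltW.
have step n : a n.+1 + D * q ^+ n.+1 <= a n + D * q ^+ n.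
  have := ac n; rewrite ler_norml => /andP[_ h].
  have : c * q ^+ n = D * q ^+ n - D * q ^+ n.+1.
    by rewrite -Dq exprS; ring.
  by lra.
have low n : a 0%N - D + D * q ^+ n <= a n.
  elim: n => [|n IH]; first by rewrite expr0 mulr1 subrK.
  have := ac n; rewrite ler_norml => /andP[h _].
  have : c * q ^+ n = D * q ^+ n - D * q ^+ n.+1.
    by rewrite -Dq exprS; ring.
  by lra.
have cb : cvgn (fun n => a n + D * q ^+ n).
  apply: nonincreasing_is_cvgn; first exact/nonincreasing_seqP.
  exists (a 0%N - D) => _ [n _ <-]; have := low n.
  by have : 0 <= D * q ^+ n by [rewrite mulr_ge0// exprn_ge0|]; lra.
have cg : cvgn (fun n => D * q ^+ n).
  by apply/cvg_ex; exists 0; apply: cvg_geometric; rewrite ger0_norm.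
have -> : a = (fun n => a n + D * q ^+ n) \- (fun n => D * q ^+ n).
  by apply/funext => n /=; rewrite addrK.
exact: is_cvgB.
Qed.

Lemma geometric_le0 (a D q : R) (N : nat) : 0 <= q < 1 ->
  (forall n, (N <= n)%N -> a <= D * q ^+ n) -> a <= 0.
Proof.
move=> /andP[q0 q1] h.
have cg : (fun n => D * q ^+ n) @ \oo --> (0 : R).
  by apply: cvg_geometric; rewrite ger0_norm.
rewrite -(cvg_lim (@Rhausdorff R) cg); apply: limr_ge.
  by apply/cvg_ex; exists 0.
by exists N => //= n /h.
Qed.

Lemma abs_Re_le (c : C) : `|complex.Re c| <= normc c.
Proof.
by case: c => a b /=; rewrite -sqrtr_sqr ler_sqrt ?lerDl ?addr_ge0 ?sqr_ge0.
Qed.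

Lemma abs_Im_le (c : C) : `|complex.Im c| <= normc c.
Proof.
by case: c => a b /=; rewrite -sqrtr_sqr ler_sqrt ?lerDr ?addr_ge0 ?sqr_ge0.
Qed.

(** Coordinates are bounded by the norm, so they converge; the tail estimates
    pass to the limit on finite sets of indices, hence to the norm. *)
Lemma l2_complete (z : nat -> l2 R I) (c q : R) : 0 <= q < 1 ->
  (forall n, l2norm (z n.+1 - z n) <= c * q ^+ n) ->
  exists y, forall n, l2norm (y - z n) <= c / (1 - q) * q ^+ n.
Proof.
move=> q01 zc; have /andP[q0 q1] := q01.
have d0 : 0 < 1 - q by rewrite subr_gt0.
pose D := c / (1 - q); have Dq : D * (1 - q) = c by rewrite /D divfK// gt_eqF.
have tail n m : l2norm (z (n + m)%N - z n) <= D * q ^+ n - D * q ^+ (n + m).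
  elim: m => [|m IH]; first by rewrite addn0 !subrr l2norm0.
  rewrite addnS -(subrKA (z (n + m)%N)) (le_trans (l2normD _ _))//.
  have -> : D * q ^+ n - D * q ^+ (n + m).+1 =
     c * q ^+ (n + m) + (D * q ^+ n - D * q ^+ (n + m)).
    by rewrite -Dq exprS; ring.
  exact: lerD.
have cr i : cvgn (fun n => complex.Re (z n i)).
  apply: (@geometric_is_cvg _ c q) => // n; apply: le_trans (zc n).
  apply: le_trans (normc_coord _ i); apply: le_trans (abs_Re_le _).
  by rewrite l2D l2N; case: (z n.+1 i) (z n i) => ? ? [].
have ci i : cvgn (fun n => complex.Im (z n i)).
  apply: (@geometric_is_cvg _ c q) => // n; apply: le_trans (zc n).
  apply: le_trans (normc_coord _ i); apply: le_trans (abs_Im_le _).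
  by rewrite l2D l2N; case: (z n.+1 i) (z n i) => ? ? [].
pose y i : C := limn (fun n => complex.Re (z n i)) +i*
                limn (fun n => complex.Im (z n i)).
have D0 : 0 <= D.
  rewrite /D divr_ge0// ?(ltW d0)//; have := zc 0%N; rewrite expr0 mulr1.
  by apply: le_trans; exact: l2norm_ge0.
have Dn n : 0 <= D * q ^+ n by rewrite (mulr_ge0 D0)// exprn_ge0.
have yz n : rsummable (fun i => normc (y i - z n i) ^+ 2) /\
    nnsum (fun i => normc (y i - z n i) ^+ 2) <= (D * q ^+ n) ^+ 2.
  apply: nnsum_le => [i|r ur]; first exact: sqr_ge0.
  pose s m := \sum_(i <- r) normc (z m i - z n i) ^+ 2.
  have cs : s m @[m --> \oo] --> \sum_(i <- r) normc (y i - z n i) ^+ 2.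
    apply: cvg_big => [|i _]; first exact: add_continuous.
    rewrite sqr_normcE.
    under eq_fun do rewrite sqr_normcE.
    have e (u v : C) : complex.Re (u - v) = complex.Re u - complex.Re v.
      by case: u v => ? ? [].
    have e' (u v : C) : complex.Im (u - v) = complex.Im u - complex.Im v.
      by case: u v => ? ? [].
    rewrite e e'; under eq_fun do rewrite e e'.
    rewrite !expr2; under eq_fun do rewrite !expr2.
    have re : complex.Re (z m i) - complex.Re (z n i) @[m --> \oo] -->
        complex.Re (y i) - complex.Re (z n i).
      by apply: cvgB; [exact: cr|exact: cvg_cst].
    have im : complex.Im (z m i) - complex.Im (z n i) @[m --> \oo] -->
        complex.Im (y i) - complex.Im (z n i).
      by apply: cvgB; [exact: ci|exact: cvg_cst].
    by apply: cvgD; apply: cvgM.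
  rewrite -(cvg_lim (@Rhausdorff R) cs); apply: limr_le.
    by apply/cvg_ex; eexists; exact: cs.
  exists n => //= m /= nm.
  have := @sum_le_nnsum (fun i => normc ((z m - z n) i) ^+ 2) r
    (fun i => sqr_ge0 _) (l2_summable (z m - z n)) ur.
  move/le_trans; apply; rewrite -sqr_l2norm.
  rewrite ler_pXn2r ?nnegrE ?l2norm_ge0 ?Dn//.
  rewrite -(subnKC nm); apply: (le_trans (tail _ _)).
  by rewrite gerBl Dn.
have yP n : (fun i => y i - z n i) \in @l2_pred R I.
  by apply/asboolP; have [] := yz n.
exists (z 0%N + L2 (yP 0%N)); move=> m.
have e i : (z 0%N + L2 (yP 0%N) - z m) i = y i - z m i.
  by rewrite !(l2D, l2N) /= [z 0%N i + _]addrC subrK.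
rewrite -(@ler_pXn2r _ 2)// ?nnegrE ?l2norm_ge0 ?Dn//.
rewrite sqr_l2norm; have [_] := yz m; congr (nnsum _ <= _).
by apply/funext => i; rewrite e.
Qed.

(** The Neumann series: the iterates of the affine contraction
    [z |-> x + K z] converge. *)
Lemma neumann (K : l2 R I -> l2 R I) (q : R) : linear K -> 0 <= q < 1 ->
  (forall x, l2norm (K x) <= q * l2norm x) ->
  forall x, exists2 z, z = x + K z & l2norm z <= l2norm x / (1 - q).
Proof.
move=> lK q01 Kq x; have /andP[q0 q1] := q01.
have KB u v : K (u - v) = K u - K v by exact: linear_sub.
pose z n := iter n (fun u => x + K u) 0.
have zS n : z n.+1 = x + K (z n) by [].
have [y yz] : exists y, forall n, l2norm (y - z n) <= l2norm x / (1 - q) * q ^+ n.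
  apply: l2_complete => // n; elim: n => [|n IH].
    by rewrite zS /= subr0 (linear_zero lK) addr0 expr0 mulr1.
  rewrite [z n.+2]zS {2}zS opprD addrACA subrr add0r -KB.
  by rewrite (le_trans (Kq _))// exprS mulrCA ler_wpM2l.
exists y; last first.
  by have := yz 0%N; rewrite /z /= subr0 expr0 mulr1.
apply/eqP; rewrite -subr_eq0; apply/eqP/l2norm_eq0.
apply/eqP; rewrite eq_le l2norm_ge0 andbT.
have h n : l2norm (y - (x + K y)) <= (l2norm x / (1 - q) * (q + q)) * q ^+ n.
  have -> : y - (x + K y) = (y - z n.+1) - K (y - z n).
    by rewrite KB zS; apply: l2P => i; rewrite !(l2D, l2N); ring.
  rewrite (le_trans (l2normB _ _))// mulrDr mulrDl lerD//.
    by rewrite -mulrA -exprS.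
  by rewrite (le_trans (Kq _))// -mulrA mulrCA ler_wpM2l.
by apply: (@geometric_le0 _ (l2norm x / (1 - q) * (q + q)) _ 0%N q01) => n _.
Qed.

End Hilbert.

(** * Finite-dimensional quotients *)

Section Quotients.
Context (R : realType).
Local Notation C := R[i].

(** If [f] maps [Z] into [P] plus a line and [B] contains the part of [Z] that
    [f] maps into [P], then [Z / B] embeds into that line. *)
Lemma fin_dim_quotient_line (E F : lmodType C) (Z B : set E) (P : set F)
    (f : E -> F) (w : F) : linear f ->
  (forall c z z', Z z -> Z z' -> Z (z - c *: z')) ->
  (forall c z z', P z -> P z' -> P (z - c *: z')) ->
  (forall z, Z z -> exists c : C, P (f z - c *: w)) ->
  (forall z, Z z -> P (f z) -> B z) ->
  fin_dim_quotient Z B.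
Proof.
move=> lf subZ subP fZ PB.
have [ZB|] := pselect (forall z, Z z -> B z).
  exists 0%N, (fun=> 0); split=> [[]//|z Zz]; exists (fun=> 0).
  by rewrite big_ord0 subr0; exact: ZB.
move=> /existsNP[z1 /not_implyP[Zz1 NBz1]].
have [c1 c1P] := fZ _ Zz1.
have c10 : c1 != 0.
  apply/eqP => c0; apply: NBz1; apply: PB => //.
  by move: c1P; rewrite c0 scale0r subr0.
exists 1%N, (fun=> z1); split=> // z Zz; have [c cP] := fZ _ Zz.
exists (fun=> c / c1); rewrite big_ord1; apply: PB; first exact: subZ.
rewrite linear_sub// linear_scale//.
have := subP (c / c1) _ _ cP c1P.
by rewrite scalerBr scalerA divfK// opprB addrA subrK.
Qed.

End Quotients.

(** * Rows of operators *)

Section AbstractOperators.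
Context (R : realType) (I : choiceType).
Local Notation C := R[i].
Local Notation H := (l2 R I).
Local Notation normc := (@Normc.normc R).
Implicit Types (x y z v : H) (A B : H -> H).

Definition adjoint_pair A B := forall x y, l2dot (A x) y = l2dot x (B y).

Lemma adjoint_pairE A B : adjoint_pair A B -> adjoint A = B.
Proof.
move=> AB; apply/funext => y; apply: l2dot_inj => x; rewrite -AB.
by rewrite [RHS](xgetPex (fun=> 0) (ex_intro _ B AB)).
Qed.

Lemma adjoint_pair_linear A B : adjoint_pair A B -> linear B.
Proof.
move=> AB c x y; apply: l2dot_inj => z.
by rewrite -AB !(l2dotDr, l2dotZr) -!AB.
Qed.

Lemma adjoint_pair_shift A B (c : C) : adjoint_pair A B ->
  adjoint_pair (op_shift A c) (op_shift B c^*).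
Proof.
by move=> AB x y; rewrite /op_shift l2dotBl l2dotBr AB l2dotZl l2dotZr conjCK.
Qed.

Definition op_le A (M : R) := forall x, l2norm (A x) <= M * l2norm x.

Lemma bounded_opP A : bounded_op A <-> linear A /\ exists2 M, 0 <= M & op_le A M.
Proof.
split=> [[lA [M AM]]|[lA [M M0 AM]]]; split=> //; last first.
  by exists M%:C => x; rewrite !l2_normE -rmorphM lecR.
exists (normc M) => [|x]; first exact: normc_ge0.
rewrite -lecR rmorphM/= -normcCE -!l2_normE -[`|x|]normr_id -normrM.
by rewrite (le_trans (AM x))// real_ler_norm// ger0_real// (le_trans _ (AM x)).
Qed.

(** Because [|B y|^2 = <A (B y), y>]. *)
Lemma adjoint_pair_le A B M : adjoint_pair A B -> op_le A M -> op_le B M.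
Proof.
move=> AB AM y.
have [->|y0] := eqVneq (l2norm (B y)) 0.
  have := AM y; have := l2norm_ge0 (A y); have := l2norm_ge0 y.
  by move=> h1 h2 h3; exact: le_trans h3.
have p : 0 < l2norm (B y) by rewrite lt0r y0 l2norm_ge0.
rewrite -(ler_pM2l p) -expr2.
have : normc (l2dot (A (B y)) y) <= l2norm (A (B y)) * l2norm y.
  exact: l2dot_CauchySchwarz.
rewrite AB l2dotE normc_real ger0_norm ?sqr_ge0// => /le_trans; apply.
by rewrite mulrCA mulrA ler_wpM2r ?l2norm_ge0.
Qed.

Lemma op_shift_linear A c : linear A -> linear (op_shift A c).
Proof.
by move=> lA a x y; rewrite /op_shift lA; apply: l2P => i; rewrite !(l2D, l2N, l2Z); ring.
Qed.

Lemma op_shift_le A c M : op_le A M -> op_le (op_shift A c) (M + normc c).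
Proof.
by move=> AM x; rewrite (le_trans (l2normB _ _))// l2normZ mulrDl lerD2r.
Qed.

(** Lax--Milgram, by a Neumann series: if [c |x|^2 <= Re <G x, x>] and
    [|G x| <= N |x|] with [c <= N], then [1 - t G] is a contraction for
    [t = c / N^2]. *)
Lemma coercive_invertible (G : H -> H) (c M : R) : 0 < c -> linear G ->
  op_le G M -> (forall x, c * l2norm x ^+ 2 <= complex.Re (l2dot (G x) x)) ->
  invertible_op G.
Proof.
move=> c0 lG GM Gc.
have low x : c * l2norm x <= l2norm (G x).
  have [->|x0] := eqVneq (l2norm x) 0; first by rewrite mulr0 l2norm_ge0.
  have p : 0 < l2norm x by rewrite lt0r x0 l2norm_ge0.
  rewrite -(ler_pM2r p) -mulrA -expr2 (le_trans (Gc x))//.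
  rewrite (le_trans (ler_norm _))// (le_trans (abs_Re_le _))//.
  exact: l2dot_CauchySchwarz.
have injG x y : G x = G y -> x = y.
  move=> xy; apply/eqP; rewrite -subr_eq0; apply/eqP/l2norm_eq0/eqP.
  rewrite eq_le l2norm_ge0 andbT -(ler_pM2l c0) mulr0 (le_trans (low _))//.
  by rewrite linear_sub// xy subrr l2norm0.
have surj x : exists y, G y = x.
  pose N := `|M| + c.
  have N0 : 0 < N by rewrite ltr_wpDl.
  have GN : op_le G N.
    move=> u; rewrite (le_trans (GM u))// ler_wpM2r ?l2norm_ge0//.
    by rewrite (le_trans (ler_norm _))// lerDl ltW.
  pose t := c / N ^+ 2; have t0 : 0 < t by rewrite divr_gt0 ?exprn_gt0.
  have tN : t * N ^+ 2 = c by rewrite /t divfK// gt_eqF// exprn_gt0.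
  pose K u := u - t%:C *: G u.
  have lK : linear K.
    move=> a u w; rewrite /K lG.
    by apply: l2P => i; rewrite !(l2D, l2N, l2Z); ring.
  have tc0 : 0 < t * c by rewrite mulr_gt0.
  have tc1 : t * c <= 1.
    rewrite /t -mulrA mulrCA -expr2 mulrC ler_pdivrMr ?exprn_gt0// mul1r.
    by rewrite ler_pXn2r ?nnegrE ?(ltW c0) ?(ltW N0)// lerDr.
  pose q := Num.sqrt (1 - t * c).
  have q2 : q ^+ 2 = 1 - t * c by rewrite sqr_sqrtr// subr_ge0.
  have q01 : 0 <= q < 1.
    rewrite sqrtr_ge0/= -(ltr_pXn2r (n := 2))// ?nnegrE ?sqrtr_ge0// q2 expr1n.
    by rewrite gtrBl.
  have Kq u : l2norm (K u) <= q * l2norm u.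
    have /andP[q0 _] := q01.
    rewrite -(@ler_pXn2r _ 2)// ?nnegrE ?l2norm_ge0 ?mulr_ge0 ?l2norm_ge0//.
    rewrite exprMn q2.
    have -> : l2norm (K u) ^+ 2 =
        l2norm u ^+ 2 - 2 * t * complex.Re (l2dot (G u) u) +
        t ^+ 2 * l2norm (G u) ^+ 2.
      apply: complexI; rewrite -l2dotE /K.
      rewrite !(l2dotBl, l2dotBr, l2dotZl, l2dotZr) !l2dotE.
      have -> : (t%:C)^* = t%:C by apply/CrealP/complex_realP; exists t.
      rewrite (l2dot_conj (G u) u).
      case: (l2dot (G u) u) => a b.
      by apply/eqP; rewrite eq_complex /=; apply/andP; split; apply/eqP; ring.
    have h1 := Gc u.
    have h2 : l2norm (G u) ^+ 2 <= N ^+ 2 * l2norm u ^+ 2.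
      by rewrite -exprMn ler_pXn2r ?nnegrE ?l2norm_ge0// ?(le_trans _ (GN u)) ?l2norm_ge0.
    have h3 : t ^+ 2 * l2norm (G u) ^+ 2 <= t * c * l2norm u ^+ 2.
      have -> : t * c * l2norm u ^+ 2 = t ^+ 2 * (N ^+ 2 * l2norm u ^+ 2).
        by rewrite -[X in t * X]tN; ring.
      by rewrite ler_wpM2l ?sqr_ge0.
    have h4 : t * (c * l2norm u ^+ 2) <= t * complex.Re (l2dot (G u) u).
      by rewrite ler_pM2l.
    by lra.
  have [z zE _] := neumann lK q01 Kq (t%:C *: x).
  exists z; have : t%:C *: G z = t%:C *: x.
    have : z - K z = t%:C *: x by rewrite [X in X - _]zE addrK.
    by rewrite /K opprB addrC subrK.
  by move/scalerI; apply; rewrite fmorph_eq0; exact: lt0r_neq0.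
have [F FE] := choice surj.
exists F; split=> //; last by move=> x; apply: injG; rewrite FE.
apply/bounded_opP; split=> [a x y|].
  by apply: injG; rewrite lG !FE.
exists c^-1 => [|x]; first by rewrite invr_ge0 ltW.
by rewrite -(ler_pM2l c0) mulrA divff ?mul1r ?gt_eqF// -{2}(FE x) low.
Qed.

(** The bound on [z1], [z2] and [c] is a quantitative form of surjectivity
    modulo the line of [v]; by duality it bounds the adjoint row from below. *)
Definition row_solvable A1 A2 v := exists2 b, 0 <= b &
  forall x, exists z1 z2 (c : C), [/\ x = A1 z1 + A2 z2 + c *: v,
    l2norm z1 <= b * l2norm x, l2norm z2 <= b * l2norm x &
    normc c <= b * l2norm x].

Section RowSquare.
Variables (A1 A2 B1 B2 : H -> H) (v : H).
Hypotheses (AB1 : adjoint_pair A1 B1) (AB2 : adjoint_pair A2 B2).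
Hypotheses (bA1 : bounded_op A1) (bA2 : bounded_op A2).

Let G x := row_square (A1, A2) x + l2dot x v *: v.

(** Pairing [x = A1 z1 + A2 z2 + c v] with [x] bounds [|x|] by the norms of
    [A1^* x], [A2^* x] and [<x, v>], that is, by the quadratic form of
    [A1 A1^* + A2 A2^*] plus a rank one correction. *)
Lemma row_square_rank1_invertible : row_solvable A1 A2 v -> invertible_op G.
Proof.
move=> [b b0 solv].
have GE x : G x = A1 (B1 x) + A2 (B2 x) + l2dot x v *: v.
  by rewrite /G /row_square (adjoint_pairE AB1) (adjoint_pairE AB2).
have /bounded_opP[lA1 [M1 M10 AM1]] := bA1.
have /bounded_opP[lA2 [M2 M20 AM2]] := bA2.
have lB1 := adjoint_pair_linear AB1; have lB2 := adjoint_pair_linear AB2.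
have BM1 := adjoint_pair_le AB1 AM1; have BM2 := adjoint_pair_le AB2 AM2.
have Gdot x : l2dot (G x) x = (l2norm (B1 x) ^+ 2 + l2norm (B2 x) ^+ 2 +
    normc (l2dot x v) ^+ 2)%:C.
  rewrite GE !l2dotDl AB1 AB2 !l2dotE l2dotZl (l2dot_conj x v).
  by rewrite mul_conj_normc -!rmorphD.
(* The factor 3 is from the square of a sum of three terms; adding 1 keeps the
   denominator positive when [b = 0]. *)
apply: (@coercive_invertible _ (3 * b ^+ 2 + 1)^-1
  (M1 ^+ 2 + M2 ^+ 2 + l2norm v ^+ 2)).
- by rewrite invr_gt0 ltr_wpDl// mulr_ge0// sqr_ge0.
- move=> a x y; rewrite !GE lB1 lB2 lA1 lA2 l2dotDl l2dotZl.
  by apply: l2P => i; rewrite !(l2D, l2N, l2Z); ring.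
- move=> x; rewrite GE !mulrDl.
  rewrite (le_trans (l2normD _ _))// lerD//.
    rewrite (le_trans (l2normD _ _))// lerD//.
      by rewrite (le_trans (AM1 _))// expr2 -mulrA ler_wpM2l.
    by rewrite (le_trans (AM2 _))// expr2 -mulrA ler_wpM2l.
  rewrite l2normZ expr2 -mulrA mulrC ler_wpM2l ?l2norm_ge0// mulrC.
  exact: l2dot_CauchySchwarz.
move=> x; rewrite Gdot/= mulrC ler_pdivrMr; last first.
  by rewrite ltr_wpDl// mulr_ge0// sqr_ge0.
have [z1 [z2 [c [xE z1b z2b cb]]]] := solv x.
set p1 := l2norm (B1 x); set p2 := l2norm (B2 x); set p3 := normc (l2dot x v).
have p10 : 0 <= p1 := l2norm_ge0 _; have p20 : 0 <= p2 := l2norm_ge0 _.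
have p30 : 0 <= p3 := normc_ge0 _.
have nx : l2norm x <= b * (p1 + p2 + p3).
  have [->|x0] := eqVneq (l2norm x) 0; first by rewrite mulr_ge0// !addr_ge0.
  have p : 0 < l2norm x by rewrite lt0r x0 l2norm_ge0.
  rewrite -(ler_pM2l p) -expr2.
  have -> : l2norm x ^+ 2 = normc (l2dot x x).
    by rewrite l2dotE normc_real ger0_norm ?sqr_ge0.
  rewrite {1}xE !l2dotDl AB1 AB2 l2dotZl (l2dot_conj x v).
  rewrite !mulrDr (le_trans (normcD_le _ _))// lerD//.
    rewrite (le_trans (normcD_le _ _))// lerD//.
      rewrite (le_trans (l2dot_CauchySchwarz _ _))// mulrA ler_wpM2r//.
      by rewrite mulrC.
    rewrite (le_trans (l2dot_CauchySchwarz _ _))// mulrA ler_wpM2r//.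
    by rewrite mulrC.
  by rewrite Normc.normcM normc_conj mulrA ler_wpM2r// mulrC.
have : l2norm x ^+ 2 <= b ^+ 2 * (p1 + p2 + p3) ^+ 2.
  by rewrite -exprMn ler_pXn2r ?nnegrE ?l2norm_ge0 ?mulr_ge0 ?addr_ge0.
have : (p1 + p2 + p3) ^+ 2 <= 3 * (p1 ^+ 2 + p2 ^+ 2 + p3 ^+ 2).
  have := sqr_ge0 (p1 - p2); have := sqr_ge0 (p1 - p3).
  by have := sqr_ge0 (p2 - p3); nra.
move/(ler_wpM2l (sqr_ge0 b)) => h1 h2.
rewrite (le_trans (le_trans h2 h1))//.
set S := p1 ^+ 2 + _ + _; have S0 : 0 <= S by rewrite !addr_ge0 ?sqr_ge0.
by clearbody S; lra.
Qed.

End RowSquare.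

Lemma row_square_invertible A1 A2 B1 B2 :
  adjoint_pair A1 B1 -> adjoint_pair A2 B2 -> bounded_op A1 -> bounded_op A2 ->
  row_solvable A1 A2 0 -> invertible_op (row_square (A1, A2)).
Proof.
move=> AB1 AB2 bA1 bA2 /(row_square_rank1_invertible AB1 AB2 bA1 bA2).
by under eq_fun do rewrite scaler0 addr0.
Qed.

Lemma koszul1_linear A1 A2 : linear A1 -> linear A2 -> linear (koszul1 (A1, A2)).
Proof.
move=> l1 l2 a u w; rewrite /koszul1 /= l1 l2.
by apply: l2P => i; rewrite !(l2D, l2N, l2Z); ring.
Qed.

Lemma range_linear_sub (E F : lmodType C) (f : E -> F) : linear f ->
  forall (c : C) u w, range f u -> range f w -> range f (u - c *: w).
Proof.
move=> lf c _ _ [u _ <-] [w _ <-]; exists (u - c *: w) => //.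
by rewrite linear_sub// linear_scale.
Qed.

(** The operator differs by a rank one operator from the invertible one of
    [row_square_rank1_invertible]. *)
Lemma row_square_fredholm A1 A2 B1 B2 v :
  adjoint_pair A1 B1 -> adjoint_pair A2 B2 -> bounded_op A1 -> bounded_op A2 ->
  row_solvable A1 A2 v -> fredholm_op (row_square (A1, A2)).
Proof.
move=> AB1 AB2 bA1 bA2.
move=> /(row_square_rank1_invertible AB1 AB2 bA1 bA2)[F [/bounded_opP[lF _] FG GF]].
have lrs : linear (row_square (A1, A2)).
  rewrite /row_square (adjoint_pairE AB1) (adjoint_pairE AB2) /= => a x y.
  have [lA1 _] := bA1; have [lA2 _] := bA2.
  rewrite (adjoint_pair_linear AB1) (adjoint_pair_linear AB2) lA1 lA2.
  by apply: l2P => i; rewrite !(l2D, l2N, l2Z); ring.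
have idl : linear (idfun : H -> H) by [].
split.
  apply: (@fin_dim_quotient_line _ _ _ _ _ [set 0] idfun (F v)) => //.
  - move=> c x y /= xk yk.
    by rewrite /ker /= linear_sub// linear_scale// xk yk scaler0 subr0.
  - by move=> c x y /= -> ->; rewrite scaler0 subr0.
  move=> x xk; exists (l2dot x v); rewrite -linear_scale//.
  by move: (FG x); rewrite /= xk add0r => ->; rewrite subrr.
apply: (@fin_dim_quotient_line _ _ _ _ _ _ idfun v idl) => //.
  exact: (range_linear_sub lrs).
2: by [].
move=> y _; exists (l2dot (F y) v); exists (F y) => //.
by apply/eqP; rewrite eq_sym subr_eq; apply/eqP; rewrite [RHS]GF.
Qed.

(** A singular sequence for the adjoint row. If [y = A1 z2 - A2 z1] then
    [<y, x_k>] is at most [(|z1| + |z2|) 4^-k]; but the vectors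
    [sum_k 2^-k x_k], with [k] running over the classes modulo [n + 1], are
    [n + 1] vectors none of whose nontrivial combinations has coefficients that
    small, so that the range has codimension more than [n]. *)
Lemma singular_sequence_infinite_codim A1 A2 B1 B2 (x : nat -> H) :
  adjoint_pair A1 B1 -> adjoint_pair A2 B2 -> linear A1 -> linear A2 ->
  (forall k l, l2dot (x k) (x l) = (k == l)%:R) ->
  (forall k, l2norm (B1 (x k)) <= (4^-1) ^+ k) ->
  (forall k, l2norm (B2 (x k)) <= (4^-1) ^+ k) ->
  ~ fin_dim_quotient [set: H] (range (koszul1 (A1, A2))).
Proof.
move=> AB1 AB2 lA1 lA2 xo B1x B2x [n [b [_ bspan]]].
have h01 : 0 <= (2^-1 : R) < 1 by apply/andP; split; lra.
have nx k : l2norm (x k) = 1.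
  have := xo k k; rewrite eqxx l2dotE => -[] /eqP.
  by rewrite sqrp_eq1 ?l2norm_ge0// => /eqP.
(* [y s] collects the [2^-k x_k] with [k] congruent to [s] modulo [n + 1]. *)
pose cf (s : 'I_n.+1) k : R := (k %% n.+1 == s)%N%:R * 2^-1 ^+ k.
have cf0 s k : 0 <= cf s k by rewrite mulr_ge0 ?ler0n ?exprn_ge0 ?invr_ge0 ?ler0n.
have yE s : exists y : H, forall N,
    l2norm (y - \sum_(k < N) (cf s k)%:C *: x k) <= 2 * 2^-1 ^+ N.
  have [N|y yP] := @l2_complete _ _ (fun N => \sum_(k < N) (cf s k)%:C *: x k) 1 _ h01.
    rewrite big_ord_recr/= addrAC subrr add0r l2normZ nx mulr1 mul1r.
    rewrite normc_real ger0_norm// ler_piMl ?exprn_ge0 ?invr_ge0//.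
    by case: (_ == _).
  exists y => N; have := yP N; congr (_ <= _ * _).
  by rewrite (_ : 1 - 2^-1 = 2^-1) ?invrK ?mul1r//; lra.
have [y yP] := choice yE.
have dy s k : l2dot (y s) (x k) = (cf s k)%:C.
  apply/eqP; rewrite -subr_eq0; apply/eqP/Normc.eq0_normc/eqP.
  rewrite eq_le normc_ge0 andbT.
  apply: (@geometric_le0 _ _ 2 _ k.+1 h01) => N kN.
  have -> : (cf s k)%:C = l2dot (\sum_(j < N) (cf s j)%:C *: x j) (x k).
    rewrite l2dot_suml (bigD1 (Ordinal kN))//= l2dotZl xo eqxx mulr1.
    rewrite big1 ?addr0// => j; rewrite -val_eqE/= => jk.
    by rewrite l2dotZl xo (negbTE jk) mulr0.
  rewrite -l2dotBl (le_trans (l2dot_CauchySchwarz _ _))// nx mulr1.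
  exact: yP.
have [c cP] := choice (fun s => bspan (y s) Logic.I).
have uE s : exists u, koszul1 (A1, A2) u = y s - \sum_i c s i *: b i.
  by have [w _ wE] := cP s; exists w.
have [u uP] := choice uE.
(* More rows than columns: some combination of the [y s] is in the range. *)
pose Cm : 'M[C]_(n.+1, n) := \matrix_(s, i) c s i.
have : kermx Cm != 0.
  rewrite kermx_eq0 /row_free; apply: contraTN (rank_leq_col Cm) => /eqP ->.
  by rewrite ltnn.
move/rowV0Pn => [d /sub_kermxP dC d0].
have [s0 ds0] : exists s0, d 0 s0 != 0.
  apply/existsP; apply: contraNT d0; rewrite negb_exists => /forallP h.
  by apply/eqP/rowP => s; rewrite mxE; apply/eqP; rewrite -[_ == _]negbK h.
pose U := \sum_s d 0 s *: u s; pose Y := \sum_s d 0 s *: y s.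
have lk : linear (koszul1 (A1, A2)) by exact: koszul1_linear.
have UY : koszul1 (A1, A2) U = Y.
  have -> : koszul1 (A1, A2) U = \sum_s d 0 s *: koszul1 (A1, A2) (u s).
    rewrite /U; elim/big_ind2: _ => [||s _]; first exact: linear_zero.
    - by move=> p1 q1 p2 q2 <- <-; rewrite linear_add.
    - exact: linear_scale.
  under eq_bigr do rewrite uP scalerBr.
  rewrite sumrB [X in _ - X](_ : _ = 0) ?subr0//.
  under eq_bigr do rewrite scaler_sumr.
  rewrite exchange_big big1//= => i _.
  under eq_bigr do rewrite scalerA.
  rewrite -scaler_suml; have /rowP/(_ i) := dC.
  rewrite !mxE => e; rewrite (_ : \sum_s _ = 0) ?scale0r// -[RHS]e.
  by apply: eq_bigr => s _; rewrite mxE.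
have Yb k : normc (l2dot Y (x k)) <= (l2norm U.2 + l2norm U.1) * (4^-1) ^+ k.
  have -> : l2dot Y (x k) = l2dot (A1 U.2 - A2 U.1) (x k) by rewrite -UY.
  rewrite l2dotBl AB1 AB2.
  rewrite (le_trans (normcD_le _ _))// normcN mulrDl.
  by rewrite lerD// (le_trans (l2dot_CauchySchwarz _ _))// ler_wpM2l ?l2norm_ge0.
have Yd m : l2dot Y (x (s0 + m * n.+1)%N) = d 0 s0 * (2^-1 ^+ (s0 + m * n.+1))%:C.
  rewrite /Y l2dot_suml (bigD1 s0)//= l2dotZl dy /cf.
  have e : ((s0 + m * n.+1) %% n.+1 = s0)%N.
    by rewrite addnC modnMDl modn_small.
  rewrite e eqxx mul1r big1 ?addr0// => s ss0.
  rewrite l2dotZl dy /cf e eq_sym.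
  by move: ss0; rewrite -val_eqE => /negbTE/= ->; rewrite mul0r mulr0.
have : normc (d 0 s0) <= 0.
  apply: (@geometric_le0 _ _ (l2norm U.2 + l2norm U.1) _ 0%N h01) => m _.
  pose k := (s0 + m * n.+1)%N.
  have p : 0 < 2^-1 ^+ k :> R by rewrite exprn_gt0// invr_gt0 ltr0n.
  rewrite -(ler_pM2r p) -{1}[2^-1 ^+ k]ger0_norm ?(ltW p)// -normc_real -Normc.normcM.
  rewrite -Yd (le_trans (Yb _))// -mulrA ler_wpM2l ?addr_ge0 ?l2norm_ge0//.
  have -> : 4^-1 = 2^-1 * 2^-1 :> R by rewrite -invfM -natrM.
  rewrite exprMn ler_pM2r//.
  have mk : (m <= k)%N by rewrite /k mulnS addnA -addnAC leq_addl.
  by apply: ler_wiXn2l mk; lra.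
rewrite le_eqVlt ltNge normc_ge0 orbF => /eqP/Normc.eq0_normc/eqP.
by rewrite (negbTE ds0).
Qed.

End AbstractOperators.

(** * Weighted shifts along an injection *)

Section Pullback.
Context (R : realType) (I J : choiceType).
Local Notation C := R[i].
Local Notation normc := (@Normc.normc R).
Variables (s : I -> J) (c : I -> R).

Definition pull_coord (y : l2 R J) : I -> C := fun i => (c i)%:C * y (s i).

(** Backward shifts, coordinate projections and diagonal operators are of this
    form. If [c] is bounded and [s] is injective on the support of [c], the
    default value of [insubd] is never reached. *)
Definition pull (y : l2 R J) : l2 R I := insubd (0 : l2 R I) (pull_coord y).

Variable M : R.
Hypotheses (M0 : 0 <= M) (cM : forall i, `|c i| <= M).
Hypothesis s_inj : forall i k, c i != 0 -> c k != 0 -> s i = s k -> i = k.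

Let pull_nnsum (y : l2 R J) :
  rsummable (fun i => normc (pull_coord y i) ^+ 2) /\
  nnsum (fun i => normc (pull_coord y i) ^+ 2) <= (M * l2norm y) ^+ 2.
Proof.
apply: nnsum_le => [i|r ur]; first exact: sqr_ge0.
pose t := [seq i <- r | c i != 0].
rewrite (bigID (fun i => c i != 0)) /= [X in _ + X]big1 ?addr0; last first.
  by move=> i /negPn/eqP ci; rewrite /pull_coord ci mul0r Normc.normc0 expr0n.
rewrite -big_filter -/t.
apply: (@le_trans _ _ (\sum_(i <- t) M ^+ 2 * normc (y (s i)) ^+ 2)).
  apply: ler_sum => i _; rewrite /pull_coord Normc.normcM normc_real exprMn.
  by rewrite ler_wpM2r ?sqr_ge0// ler_pXn2r ?nnegrE.
rewrite -mulr_sumr exprMn ler_wpM2l ?sqr_ge0// sqr_l2norm.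
rewrite -(big_map s predT (fun j => normc (y j) ^+ 2)).
apply: sum_le_nnsum => [j||]; [exact: sqr_ge0|exact: l2_summable|].
rewrite map_inj_in_uniq ?filter_uniq// => i k.
by rewrite !mem_filter => /andP[ci _] /andP[ck _]; exact: s_inj.
Qed.

Lemma pullE y i : pull y i = (c i)%:C * y (s i).
Proof.
rewrite /pull -[l2_fun _]/(val _) insubdK//.
by apply/asboolP; have [] := pull_nnsum y.
Qed.

Lemma pull_le y : l2norm (pull y) <= M * l2norm y.
Proof.
rewrite -(@ler_pXn2r _ 2)// ?nnegrE ?mulr_ge0 ?l2norm_ge0//.
rewrite sqr_l2norm; have [_] := pull_nnsum y; congr (nnsum _ <= _).
by apply/funext => i; rewrite pullE.
Qed.

Lemma pull_linear : linear pull.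
Proof.
move=> a x y; apply: l2P => i; rewrite l2D l2Z !pullE l2D l2Z; ring.
Qed.

End Pullback.

Section Reindexing.
Context (R : realType) (I J : choiceType) (s : I -> J).
Hypothesis s_inj : injective s.

Lemma nnsum_push (f : J -> R) : (forall j, 0 <= f j) ->
  (forall j, (forall i, j <> s i) -> f j = 0) -> nnsum f = nnsum (f \o s).
Proof.
move=> fge0 f0; congr fine; rewrite (esumID (range s)); last first.
  by move=> j _; rewrite lee_fin.
rewrite !setTI [X in (_ + X)%E]esum1 ?adde0; last first.
  by move=> j Nj; rewrite f0// => i ji; apply: Nj; exists i.
by rewrite esum_image// => i k _ _; exact: s_inj.
Qed.

Lemma rsum_push (f : J -> R) :
  (forall j, (forall i, j <> s i) -> f j = 0) -> rsum f = rsum (f \o s).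
Proof.
move=> f0; rewrite /rsum !nnsum_push//.
- by move=> j; rewrite le_max lexx orbT.
- by move=> j /f0 ->; rewrite oppr0 maxxx.
- by move=> j; rewrite le_max lexx orbT.
- by move=> j /f0 ->; rewrite maxxx.
Qed.

Lemma csum_push (f : J -> R[i]) :
  (forall j, (forall i, j <> s i) -> f j = 0) -> csum f = csum (f \o s).
Proof. by move=> f0; rewrite /csum !rsum_push// => j /f0 ->. Qed.

End Reindexing.

Section Projection.
Context (R : realType) (I : choiceType).
Implicit Types (x : l2 R I) (m : pred I).

Definition restrict m x : l2 R I := pull id (fun i => (m i)%:R) x.

Let rM m i : `|(m i)%:R : R| <= 1.
Proof. by case: (m i); rewrite ?normr1 ?normr0. Qed.

Lemma restrictE m x i : restrict m x i = if m i then x i else 0.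
Proof.
rewrite (pullE ler01 (rM m))//; case: (m i); first by rewrite mul1r.
by rewrite mul0r.
Qed.

Lemma restrict_le m x : l2norm (restrict m x) <= l2norm x.
Proof. by rewrite -[leRHS]mul1r; exact: (pull_le ler01 (rM m)). Qed.

Lemma restrict_linear m : linear (restrict m).
Proof. exact: (pull_linear ler01 (rM m)). Qed.

Definition supported m x := forall i, ~~ m i -> x i = 0.

Lemma restrict_supported m x : supported m (restrict m x).
Proof. by move=> i; rewrite restrictE => /negbTE ->. Qed.

End Projection.

(** The two members of a 2-variable weighted shift are both weighted shifts
    along an injection [s] of the index set. The map [pr] inverts [s], and the
    indices outside the range of [s] are those with [s (pr q) != q]; the height
    [h] excludes orbits that are infinite in the backward direction. *)
Section ShiftAlong.
Context (R : realType) (I : choiceType) (s pr : I -> I) (h : I -> nat).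
Local Notation C := R[i].
Local Notation normc := (@Normc.normc R).
Local Notation H := (l2 R I).
Hypotheses (sK : cancel s pr) (hs : forall p, h (s p) = (h p).+1).
Variables (w : I -> R) (M : R) (T : H -> H).
Hypotheses (M0 : 0 <= M) (wM : forall p, `|w p| <= M).
Hypothesis TE : forall x q,
  T x q = (if s (pr q) == q then w (pr q) else 0)%:C * x (pr q).

Let s_inj : injective s. Proof. exact: can_inj sK. Qed.

Let pr_inj (q q' : I) : s (pr q) == q -> s (pr q') == q' -> pr q = pr q' -> q = q'.
Proof. by move=> /eqP e /eqP e' pq; rewrite -e -e' pq. Qed.

Lemma shift_alongE x p : T x (s p) = (w p)%:C * x p.
Proof. by rewrite TE sK eqxx. Qed.

Lemma shift_along0 x q : s (pr q) != q -> T x q = 0.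
Proof. by rewrite TE => /negbTE ->; rewrite mul0r. Qed.

Lemma shift_along_linear : linear T.
Proof. by move=> a x y; apply: l2P => i; rewrite l2D l2Z !TE l2D l2Z; ring. Qed.

Definition coshift : H -> H := pull s w.

Lemma coshiftE x p : coshift x p = (w p)%:C * x (s p).
Proof. by apply: (pullE M0 wM) => i k _ _; exact: s_inj. Qed.

Lemma coshift_adjoint : adjoint_pair T coshift.
Proof.
move=> x y; rewrite /l2dot (csum_push s_inj) => [|q Nq].
  congr csum; apply/funext => p /=; rewrite shift_alongE coshiftE rmorphM/=.
  have -> : ((w p)%:C)^* = (w p)%:C by apply/CrealP/complex_realP; exists (w p).
  by ring.
by rewrite shift_along0 ?mul0r//; apply/eqP => e; apply: (Nq (pr q)).
Qed.

Lemma shift_along_restrict_le (m : pred I) (rho : R) : 0 <= rho ->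
  (forall p, m p -> `|w p| <= rho) ->
  forall x, l2norm (T (restrict m x)) <= rho * l2norm x.
Proof.
move=> rho0 wr x.
pose c q := if (s (pr q) == q) && m (pr q) then w (pr q) else 0.
have cr q : `|c q| <= rho.
  by rewrite /c; case: ifP => [/andP[_ /wr]//|_]; rewrite normr0.
have ci i k : c i != 0 -> c k != 0 -> pr i = pr k -> i = k.
  rewrite /c; case: ifP => [/andP[e _] _|]; last by rewrite eqxx.
  by case: ifP => [/andP[e' _] _|]; [exact: pr_inj|rewrite eqxx].
have -> : T (restrict m x) = pull pr c x.
  apply: l2P => q; rewrite (pullE rho0 cr ci) TE restrictE /c.
  by case: eqP => _ /=; case: (m _); rewrite ?mul0r ?mulr0.
exact: pull_le.
Qed.

Lemma shift_along_le : op_le T M.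
Proof.
move=> x; have := @shift_along_restrict_le predT M M0 (fun p _ => wM p) x.
by congr (l2norm (T _) <= _); apply: l2P => i; rewrite restrictE.
Qed.

Lemma shift_along_bounded : bounded_op T.
Proof.
apply/bounded_opP; split; first exact: shift_along_linear.
by exists M => //; exact: shift_along_le.
Qed.

Variable lam : C.
Local Notation A := (op_shift T lam).

Lemma op_shiftE x p : A x (s p) = (w p)%:C * x p - lam * x (s p).
Proof. by rewrite l2D l2N shift_alongE. Qed.

Lemma op_shift0 x q : s (pr q) != q -> A x q = - (lam * x q).
Proof. by move=> sq; rewrite l2D l2N shift_along0// sub0r. Qed.

Lemma op_shift_bounded : bounded_op A.
Proof.
apply/bounded_opP; split; first exact: op_shift_linear shift_along_linear.
exists (M + normc lam); first by rewrite addr_ge0 ?normc_ge0.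
exact: op_shift_le shift_along_le.
Qed.

(** The equation determines [x] at [s p] from its value at [p], starting from
    the indices outside the range of [s], where [x] vanishes unless
    [lam = 0]. *)
Lemma op_shift_injective x : (forall p, w p != 0) -> A x = 0 -> x = 0.
Proof.
move=> w0 Ax; apply: l2P => q; rewrite l20.
have Aq p : A x p = 0 by rewrite Ax.
have [l0|l0] := eqVneq lam 0.
  have := Aq (s q); rewrite op_shiftE l0 mul0r subr0 => /eqP.
  by rewrite mulf_eq0 fmorph_eq0 (negbTE (w0 q)) => /eqP.
have [n] := ubnP (h q); elim: n q => // n IH q hq.
have [e|e] := eqVneq (s (pr q)) q.
  have hp : (h (pr q) < n)%N by move: hq; rewrite -{1}e hs ltnS.
  have := Aq q; rewrite -{1}e op_shiftE IH// mulr0 sub0r e => /eqP.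
  by rewrite oppr_eq0 mulf_eq0 (negbTE l0) => /eqP.
by have /eqP := Aq q; rewrite op_shift0// oppr_eq0 mulf_eq0 (negbTE l0) => /eqP.
Qed.

(** On an invariant set of indices where the weights stay below [|lam|], the
    operator [T - lam] is inverted by a Neumann series. *)
Lemma forward_solve (m : pred I) (rho : R) : 0 <= rho < normc lam ->
  (forall p, m p -> m (s p)) -> (forall p, m p -> `|w p| <= rho) ->
  exists2 b, 0 <= b & forall x, supported m x ->
    exists z, [/\ A z = x, supported m z & l2norm z <= b * l2norm x].
Proof.
move=> /andP[rho0 rl] ms wr.
have l0 : 0 < normc lam by exact: le_lt_trans rl.
have lam0 : lam != 0 by apply: contraTneq l0 => ->; rewrite Normc.normc0 ltxx.
pose q := rho / normc lam.
have q01 : 0 <= q < 1 by rewrite divr_ge0 ?(ltW l0)//= ltr_pdivrMr// mul1r.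
have d0 : 0 < 1 - q by rewrite subr_gt0; case/andP: q01.
pose K x : H := lam^-1 *: T (restrict m x).
have lK : linear K.
  move=> a x y; rewrite /K restrict_linear shift_along_linear.
  by apply: l2P => i; rewrite !(l2D, l2Z); ring.
have nV : normc lam^-1 = (normc lam)^-1.
  by apply: complexI; rewrite fmorphV/= -!normcCE normfV.
have Kq x : l2norm (K x) <= q * l2norm x.
  rewrite l2normZ nV /q mulrAC mulrC ler_pM2r ?invr_gt0//.
  exact: shift_along_restrict_le.
exists ((normc lam)^-1 / (1 - q)).
  by rewrite divr_ge0 ?invr_ge0 ?normc_ge0// ltW.
move=> x xm; have [z zE zb] := neumann lK q01 Kq (- lam^-1 *: x).
have zm : supported m z.
  move=> i Nm; rewrite zE l2D l2Z xm// mulr0 add0r /K l2Z TE restrictE.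
  case: eqP => e; last by rewrite mul0r mulr0.
  case: ifPn => [/ms|_]; last by rewrite !mulr0.
  by rewrite e (negbTE Nm).
exists z; split=> //.
  have rz : restrict m z = z.
    by apply: l2P => i; rewrite restrictE; case: ifPn => // /zm.
  apply: (scalerI (invr_neq0 lam0)); rewrite /op_shift scalerBr scalerA mulVf// scale1r.
  have := zE; rewrite /K rz scaleNr => e.
  by apply/eqP; rewrite subr_eq eq_sym {1}e addrA subrr add0r.
rewrite (le_trans zb)// scaleNr l2normN l2normZ nV mulrAC.
by rewrite lexx.
Qed.

(** The recursion below determines [z] backwards, so that small [lam] is the
    easy case; the weight [d] is a similarity that trades [w] for the constant
    weight [rho]. *)
Lemma backward_solve (d : I -> R) (lo hi rho : R) : 0 < lo -> 0 <= hi ->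
  (forall p, lo <= d p <= hi) -> normc lam < rho -> (forall p, 0 < w p) ->
  (forall p, rho * d (s p) <= w p * d p) ->
  exists2 b, 0 <= b & forall x : H, exists2 z : H, l2norm z <= b * l2norm x &
    forall p, (w p)%:C * z p - lam * z (s p) = x (s p).
Proof.
move=> lo0 hi0 dP lrho w0 wd.
have rho0 : 0 < rho by rewrite (le_lt_trans _ lrho)// normc_ge0.
have d0 p : 0 < d p by rewrite (lt_le_trans lo0)//; case/andP: (dP p).
have dhi p : d p <= hi by case/andP: (dP p).
have wd0 p : 0 < w p * d p by rewrite mulr_gt0.
pose k p := (w p * d p)^-1.
have kM p : `|k p| <= (rho * lo)^-1.
  rewrite gtr0_norm ?invr_gt0// lef_pV2 ?posrE ?mulr_gt0//.
  by rewrite (le_trans _ (wd p))// ler_pM2l//; case/andP: (dP (s p)).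
pose e p := d (s p) / (w p * d p).
have eM p : `|e p| <= rho^-1.
  rewrite gtr0_norm ?divr_gt0// ler_pdivrMr// -(ler_pM2l rho0) mulrA.
  by rewrite divff ?gt_eqF// mul1r.
pose B x : H := pull s k x; pose K x : H := lam *: pull s e x.
have ss (u : I -> R) i j : u i != 0 -> u j != 0 -> s i = s j -> i = j.
  by move=> _ _; exact: s_inj.
have rV : 0 <= rho^-1 by rewrite invr_ge0 ltW.
have rlV : 0 <= (rho * lo)^-1 by rewrite invr_ge0 ltW// mulr_gt0.
pose q := normc lam / rho.
have q01 : 0 <= q < 1.
  by rewrite divr_ge0 ?normc_ge0 ?(ltW rho0)//= ltr_pdivrMr// mul1r.
have dq : 0 < 1 - q by rewrite subr_gt0; case/andP: q01.
have lK : linear K.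
  move=> a x y; rewrite /K (pull_linear rV eM (ss e)).
  by apply: l2P => i; rewrite !(l2D, l2Z); ring.
have Kq x : l2norm (K x) <= q * l2norm x.
  rewrite l2normZ /q -mulrA ler_wpM2l ?normc_ge0//.
  exact: (pull_le rV eM (ss e)).
have dM p : `|d p| <= hi by rewrite gtr0_norm.
have idi (i j : I) : d i != 0 -> d j != 0 -> id i = id j -> i = j by [].
exists (hi * ((rho * lo)^-1 / (1 - q))) => [|x].
  by rewrite mulr_ge0// divr_ge0// ltW.
(* The coordinates of [z] are those of the solution divided by [d]. *)
have [z zE zb] := neumann lK q01 Kq (B x).
exists (pull id d z) => [|p].
  rewrite (le_trans (pull_le hi0 dM idi _))// -mulrA ler_wpM2l//.
  rewrite (le_trans zb)// mulrAC ler_wpM2r ?invr_ge0 ?(ltW dq)//.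
  exact: (pull_le rlV kM (ss k)).
rewrite !(pullE hi0 dM idi) mulrA -rmorphM [in X in X - _]zE.
rewrite l2D /B /K l2Z (pullE rlV kM (ss k)) (pullE rV eM (ss e)).
rewrite mulrDr mulrA -rmorphM /k mulfV ?gt_eqF// rmorph1 mul1r.
rewrite (_ : _%:C * (lam * _) = lam * ((w p * d p) * e p)%:C * z (s p)).
  by rewrite /e mulrCA mulfV ?gt_eqF// mulr1 !mulrA addrK.
by rewrite rmorphM/=; ring.
Qed.
End ShiftAlong.

(** * Points where the Koszul complex is exact or Fredholm *)

Section RegularPoints.
Context (R : realType) (kappa y0 : R).
Hypotheses (kappa_gt1 : 1 < kappa) (y0_gt0 : 0 < y0).
Local Notation C := R[i].
Local Notation normc := (@Normc.normc R).
Local Notation H := (l2 R (nat * nat)%type).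
Implicit Types (x y z : H).

Definition right (p : nat * nat) := (p.1.+1, p.2).
Definition left (p : nat * nat) := (p.1.-1, p.2).
Definition up (p : nat * nat) := (p.1, p.2.+1).
Definition down (p : nat * nat) := (p.1, p.2.-1).

Lemma rightK : cancel right left. Proof. by case. Qed.
Lemma upK : cancel up down. Proof. by case. Qed.

Definition wt1 (p : nat * nat) := alpha kappa p.1 p.2.
Definition wt2 (p : nat * nat) := beta kappa y0 p.1 p.2.

Let T1 := wshift1 (alpha kappa).
Let T2 := wshift2 (beta kappa y0).

Lemma wshift1_alongE x q : T1 x q =
  (if right (left q) == q then wt1 (left q) else 0)%:C * x (left q).
Proof.
rewrite /T1 wshift1E; last exact: alpha_bounded.
by case: q => [[|i] j]; rewrite /shift1_coord/= ?eqxx// mul0r.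
Qed.

Lemma wshift2_alongE x q : T2 x q =
  (if up (down q) == q then wt2 (down q) else 0)%:C * x (down q).
Proof.
rewrite /T2 wshift2E; last exact: beta_bounded.
by case: q => [i [|j]]; rewrite /shift2_coord/= ?eqxx// ?xpair_eqE/= ?andbF mul0r.
Qed.

Lemma wt1_gt0 p : 0 < wt1 p. Proof. exact: alpha_gt0. Qed.
Lemma wt2_gt0 p : 0 < wt2 p. Proof. exact: beta_gt0. Qed.

Lemma wt1_ge1 p : 1 <= wt1 p.
Proof. by case: p => i [|j]//; exact: xweight_ge1. Qed.

Lemma wt1_le p : `|wt1 p| <= Num.sqrt kappa.
Proof.
rewrite gtr0_norm ?wt1_gt0//; case: p => i [|j]; first exact: xweight_le.
by rewrite (le_trans (xweight_ge1 kappa_gt1 0))// xweight_le.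
Qed.

Lemma wt2_le p : `|wt2 p| <= y0 + 1.
Proof.
rewrite gtr0_norm ?wt2_gt0//; case: p => i [|j]; rewrite /wt2/=; last first.
  by rewrite lerDr ltW.
rewrite (le_trans (y := y0))// ?lerDl//.
have p1 := prod_xweight_ge1 kappa_gt1 i.
by rewrite ler_pdivrMr ?(lt_le_trans ltr01)// ler_peMr// ltW.
Qed.

Let r0 : 0 <= Num.sqrt kappa. Proof. exact: sqrtr_ge0. Qed.
Let b0 : 0 <= y0 + 1. Proof. by rewrite addr_ge0 ?ltW. Qed.

Definition adj1 : H -> H := coshift right wt1.
Definition adj2 : H -> H := coshift up wt2.

Lemma adj1E x p : adj1 x p = (wt1 p)%:C * x (right p).
Proof. exact: (coshiftE rightK r0 wt1_le). Qed.

Lemma adj2E x p : adj2 x p = (wt2 p)%:C * x (up p).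
Proof. exact: (coshiftE upK b0 wt2_le). Qed.

Section Point.
Variables l1 l2 : C.
Local Notation A1 := (op_shift T1 l1).
Local Notation A2 := (op_shift T2 l2).

Lemma adjoint_A1 : adjoint_pair A1 (op_shift adj1 l1^*).
Proof.
exact/adjoint_pair_shift/(coshift_adjoint rightK r0 wt1_le wshift1_alongE).
Qed.

Lemma adjoint_A2 : adjoint_pair A2 (op_shift adj2 l2^*).
Proof.
exact/adjoint_pair_shift/(coshift_adjoint upK b0 wt2_le wshift2_alongE).
Qed.

Lemma A1_bounded : bounded_op A1.
Proof. exact: (op_shift_bounded r0 wt1_le wshift1_alongE). Qed.

Lemma A2_bounded : bounded_op A2.
Proof. exact: (op_shift_bounded b0 wt2_le wshift2_alongE). Qed.

Lemma A1_linear : linear A1. Proof. by have [] := A1_bounded. Qed.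
Lemma A2_linear : linear A2. Proof. by have [] := A2_bounded. Qed.

Lemma A1S x i j : A1 x (i.+1, j) = (wt1 (i, j))%:C * x (i, j) - l1 * x (i.+1, j).
Proof. exact: (op_shiftE rightK wshift1_alongE l1 x (i, j)). Qed.

Lemma A2S x i j : A2 x (i, j.+1) = (wt2 (i, j))%:C * x (i, j) - l2 * x (i, j.+1).
Proof. exact: (op_shiftE upK wshift2_alongE l2 x (i, j)). Qed.

Lemma A10 x j : A1 x (0%N, j) = - (l1 * x (0%N, j)).
Proof. exact: (op_shift0 wshift1_alongE). Qed.

Lemma A20 x i : A2 x (i, 0%N) = - (l2 * x (i, 0%N)).
Proof. by apply: (op_shift0 wshift2_alongE); rewrite xpair_eqE/= andbF. Qed.

Lemma A1_inj x : A1 x = 0 -> x = 0.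
Proof.
apply: (@op_shift_injective _ _ right left fst rightK _ wt1 _ wshift1_alongE) => // p.
by rewrite gt_eqF ?wt1_gt0.
Qed.

Lemma A2_inj x : A2 x = 0 -> x = 0.
Proof.
apply: (@op_shift_injective _ _ up down snd upK _ wt2 _ wshift2_alongE) => // p.
by rewrite gt_eqF ?wt2_gt0.
Qed.

Lemma A1_A2_comm x : A1 (A2 x) = A2 (A1 x).
Proof.
have [lT1 _] := shift_along_bounded r0 wt1_le wshift1_alongE.
have [lT2 _] := shift_along_bounded b0 wt2_le wshift2_alongE.
have c : T1 (T2 x) = T2 (T1 x) by exact: (shift_pair_comm kappa_gt1 y0_gt0 x).
rewrite /op_shift (linear_sub _ _ lT1) (linear_sub _ _ lT2).
rewrite (linear_scale _ _ lT1) (linear_scale _ _ lT2) c.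
by apply: l2P => i; rewrite !(l2D, l2N, l2Z); ring.
Qed.

Let T := pair_shift (shift_pair kappa y0) (l1, l2).

Lemma ker_koszul0 : ker (koszul0 T) = [set 0].
Proof.
apply/seteqP; split=> [x /(congr1 fst) Ax|_ ->]; first exact: (@A1_inj x Ax).
by rewrite /ker/= /koszul0/= (linear_zero A1_linear) (linear_zero A2_linear).
Qed.

Lemma koszul1_koszul0 x : koszul1 T (koszul0 T x) = 0.
Proof. by rewrite /koszul1 /koszul0 /= A1_A2_comm subrr. Qed.

(** By injectivity and commutation, a syzygy is trivial as soon as one of its
    two components is in the range. *)
Lemma koszul_syzygy x y : koszul1 T (x, y) = 0 ->
  (exists z, A1 z = x \/ A2 z = y) -> range (koszul0 T) (x, y).
Proof.
move=> /eqP; rewrite subr_eq0 => /eqP/= e [z [zx|zy]].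
  exists z => //; congr pair => //; apply/eqP; rewrite -subr_eq0; apply/eqP.
  by apply: A1_inj; rewrite (linear_sub _ _ A1_linear) A1_A2_comm zx e subrr.
exists z => //; congr pair => //; apply/eqP; rewrite -subr_eq0; apply/eqP.
by apply: A2_inj; rewrite (linear_sub _ _ A2_linear) -A1_A2_comm zy e subrr.
Qed.

(** Exactness of the Koszul complex in the middle, in view of
    [koszul_syzygy]. *)
Definition middle_exact := forall x y, A1 y = A2 x -> exists z, A1 z = x \/ A2 z = y.

Lemma middle_exactP : middle_exact -> ker (koszul1 T) = range (koszul0 T).
Proof.
move=> me; apply/seteqP; split=> [[x y] k|_ [x _ <-]]; last exact: koszul1_koszul0.
by apply: koszul_syzygy => //; apply: me; apply/eqP; rewrite -subr_eq0; apply/eqP.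
Qed.

Lemma exact_point : row_solvable A1 A2 0 -> middle_exact ->
  koszul_exact T /\ invertible_op (row_square T).
Proof.
move=> rs me; split.
  split; [exact: ker_koszul0|exact: middle_exactP|].
  apply/seteqP; split=> // x _; have [b _ /(_ x)[z1 [z2 [c [-> _ _ _]]]]] := rs.
  exists (- z2, z1) => //; rewrite scaler0 addr0 /koszul1 /=.
  by rewrite -(sub0r z2) (linear_sub _ _ A2_linear) (linear_zero A2_linear) sub0r opprK.
exact: row_square_invertible adjoint_A1 adjoint_A2 A1_bounded A2_bounded rs.
Qed.

Lemma fredholm_point v : row_solvable A1 A2 v ->
  fin_dim_quotient (ker (koszul1 T)) (range (koszul0 T)) ->
  koszul_fredholm T /\ fredholm_op (row_square T).
Proof.
move=> rs fq; split; last first.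
  exact: row_square_fredholm adjoint_A1 adjoint_A2 A1_bounded A2_bounded rs.
have k1 : linear (koszul1 T) by apply: koszul1_linear; [exact: A1_linear|exact: A2_linear].
split=> //.
  exists 0%N, (fun=> 0); split=> [[]//|z]; rewrite ker_koszul0 => ->.
  by exists (fun=> 0); rewrite big_ord0 subr0.
have idl : linear (idfun : H -> H) by [].
apply: (@fin_dim_quotient_line _ _ _ _ _ _ idfun v idl) => //.
  exact: (range_linear_sub k1).
2: by [].
move=> x _; have [b _ /(_ x)[z1 [z2 [c [-> _ _ _]]]]] := rs.
exists c, (- z2, z1) => //; rewrite addrK /koszul1 /=.
by rewrite -(sub0r z2) (linear_sub _ _ A2_linear) (linear_zero A2_linear) sub0r opprK.
Qed.

Lemma middle_exact_fin_dim : middle_exact ->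
  fin_dim_quotient (ker (koszul1 T)) (range (koszul0 T)).
Proof.
move=> /middle_exactP <-; exists 0%N, (fun=> 0); split=> [[]//|z kz].
by exists (fun=> 0); rewrite big_ord0 subr0.
Qed.

Definition upper (p : nat * nat) := (0 < p.2)%N.

Lemma forward_upper1 : 1 < normc l1 -> exists2 b, 0 <= b &
  forall x, supported upper x ->
    exists z, [/\ A1 z = x, supported upper z & l2norm z <= b * l2norm x].
Proof.
move=> l11; apply: (forward_solve wshift1_alongE (rho := 1)) => //.
  by rewrite ler01.
by case=> i [|j]// _; rewrite normr1.
Qed.

Lemma forward_upper2 : 1 < normc l2 -> exists2 b, 0 <= b &
  forall x, supported upper x ->
    exists z, [/\ A2 z = x, supported upper z & l2norm z <= b * l2norm x].
Proof.
move=> l21; apply: (forward_solve wshift2_alongE (rho := 1)) => //.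
  by rewrite ler01.
by case=> i [|j]// _; rewrite normr1.
Qed.

Lemma A2_lower x : l2 != 0 ->
  supported upper (x - A2 (- l2^-1 *: restrict (predC upper) x)).
Proof.
move=> l20 [i [|j]]// _; rewrite l2D l2N A20 l2Z restrictE/= mulNr mulrN opprK.
by rewrite mulrA divff// mul1r subrr.
Qed.

(** Modulo the rows above it, [T2] vanishes on the bottom row, where [T2 - l2]
    is therefore invertible; on the upper rows both operators are isometries. *)
Lemma exact_l2_neq0 : l2 != 0 -> 1 < normc l1 \/ 1 < normc l2 ->
  row_solvable A1 A2 0 /\ middle_exact.
Proof.
move=> l20 l12; pose low x : H := - l2^-1 *: restrict (predC upper) x.
have lowb x : l2norm (low x) <= (normc l2)^-1 * l2norm x.
  rewrite l2normZ normcN normcV ler_wpM2l ?invr_ge0 ?normc_ge0//.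
  exact: restrict_le.
have [_ [M M0 AM]] := (bounded_opP _).1 A2_bounded.
pose c := (normc l2)^-1; have c0 : 0 <= c by rewrite invr_ge0 normc_ge0.
have restb x : l2norm (x - A2 (low x)) <= (1 + M * c) * l2norm x.
  rewrite (le_trans (l2normB _ _))// mulrDl mul1r lerD2l (le_trans (AM _))//.
  by rewrite -mulrA ler_wpM2l.
have rest0 : 0 <= 1 + M * c by rewrite addr_ge0// mulr_ge0.
split.
  case: l12 => [/forward_upper1|/forward_upper2] [b b0' bP].
  - exists (b * (1 + M * c) + c) => [|x]; first by rewrite addr_ge0 ?mulr_ge0.
    have [z [zE _ zb]] := bP _ (A2_lower x l20).
    have nx := l2norm_ge0 x.
    exists z, (low x), 0; split.
    + by rewrite zE scaler0 addr0 subrK.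
    + rewrite (le_trans zb)// mulrDl ler_wpDr ?(mulr_ge0 c0)// -mulrA.
      by rewrite ler_wpM2l.
    + by rewrite (le_trans (lowb x))// ler_wpM2r// lerDr mulr_ge0.
    + by rewrite Normc.normc0 mulr_ge0// addr_ge0// mulr_ge0.
  - exists (b * (1 + M * c) + c) => [|x]; first by rewrite addr_ge0 ?mulr_ge0.
    have [z [zE _ zb]] := bP _ (A2_lower x l20).
    have nx := l2norm_ge0 x.
    exists 0, (low x + z), 0; split.
    + rewrite (linear_add _ _ A2_linear) zE (linear_zero A1_linear).
      by rewrite scaler0 addr0 add0r addrC subrK.
    + by rewrite l2norm0 mulr_ge0// addr_ge0// mulr_ge0.
    + rewrite (le_trans (l2normD _ _))// addrC mulrDl lerD//.
      by rewrite (le_trans zb)// -mulrA ler_wpM2l.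
    + by rewrite Normc.normc0 mulr_ge0// addr_ge0// mulr_ge0.
move=> x y e; pose z0 := low y.
have yU : supported upper (y - A2 z0) by exact: A2_lower.
have e' : A1 (y - A2 z0) = A2 (x - A1 z0).
  by rewrite (linear_sub _ _ A1_linear) (linear_sub _ _ A2_linear) A1_A2_comm e.
have xU : supported upper (x - A1 z0).
  move=> [i [|j]]// _.
  have : A2 (x - A1 z0) (i, 0%N) = 0.
    rewrite -e'; case: i => [|i]; rewrite ?A10 ?A1S.
      by rewrite yU// mulr0 oppr0.
    by rewrite !yU// !mulr0 subr0.
  by rewrite A20 => /eqP; rewrite oppr_eq0 mulf_eq0 (negbTE l20) => /eqP.
case: l12 => [/forward_upper1|/forward_upper2] [b _ bP].
  have [z [zE _ _]] := bP _ xU; exists (z0 + z); left.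
  by rewrite (linear_add _ _ A1_linear) zE addrC subrK.
have [z [zE _ _]] := bP _ yU; exists (z0 + z); right.
by rewrite (linear_add _ _ A2_linear) zE addrC subrK.
Qed.

(** The weights of [T1] are at most [sqrt kappa], so that [T1 - l1] is
    invertible. *)
Lemma exact_l1_large : Num.sqrt kappa < normc l1 ->
  row_solvable A1 A2 0 /\ middle_exact.
Proof.
move=> l1k.
have [||b b0' bP] := forward_solve wshift1_alongE (m := predT)
  (rho := Num.sqrt kappa) (lam := l1) _ _ (fun p _ => wt1_le p).
- by rewrite r0.
- by [].
have solve x : exists z, A1 z = x /\ l2norm z <= b * l2norm x.
  by have [//|z [zE _ zb]] := bP x; exists z.
split.
  exists b => // x; have [z [zE zb]] := solve x.
  exists z, 0, 0; split => //.
  - by rewrite (linear_zero A2_linear) zE scaler0 !addr0.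
  - by rewrite l2norm0 mulr_ge0 ?l2norm_ge0.
  - by rewrite Normc.normc0 mulr_ge0 ?l2norm_ge0.
by move=> x y _; have [z [zE _]] := solve x; exists z; left.
Qed.

Definition e00 : H := l2_delta R (0%N, 0%N).

Lemma e00E i j : e00 (i, j) = ((i == 0%N) && (j == 0%N))%:R.
Proof. by rewrite l2_deltaE xpair_eqE. Qed.

Lemma e00S i j : e00 (i.+1, j) = 0.
Proof. by rewrite e00E. Qed.

(** The bottom row of [T1] has weights [g (i+1) / g i] with
    [g i ^ 2 = (1 + kappa ^ i) / 2], hence is similar to [sqrt kappa] times the
    unweighted shift by the diagonal operator with entries
    [g i / sqrt kappa ^ i]. *)
Let sim (p : nat * nat) : R := Num.sqrt ((1 + kappa ^+ p.1) / (2 * kappa ^+ p.1)).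

Lemma bottom_row_solve : normc l1 < Num.sqrt kappa -> exists2 b, 0 <= b &
  forall x, exists2 z, l2norm z <= b * l2norm x &
    forall i, A1 z (i.+1, 0%N) = x (i.+1, 0%N) /\
      forall j, z (i, j.+1) = 0.
Proof.
move=> l1k; have k0 : 0 < kappa := lt_trans ltr01 kappa_gt1.
have kn n : 0 < kappa ^+ n by rewrite exprn_gt0.
have kn1 n : 1 <= kappa ^+ n by rewrite exprn_ege1// ltW.
have sim_bound p : Num.sqrt (2^-1) <= sim p <= 1.
  apply/andP; split.
    rewrite ler_wsqrtr// ler_pdivlMr ?mulr_gt0//.
    by rewrite mulrA mulVf ?mul1r ?lerDr.
  rewrite -sqrtr1 ler_wsqrtr// ler_pdivrMr ?mulr_gt0// mul1r.
  by have := kn1 p.1; lra.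
have [||p||p|p|b b0' bP] := @backward_solve _ _ right left rightK
    (fun p => xweight kappa p.1) l1 sim (Num.sqrt 2^-1) 1 (Num.sqrt kappa).
- by rewrite sqrtr_gt0 invr_gt0.
- exact: ler01.
- exact: sim_bound.
- exact: l1k.
- exact: (@alpha_gt0 _ _ kappa_gt1 p.1 0).
- have d0 n : 0 <= 1 + kappa ^+ n by rewrite addr_ge0// ltW.
  rewrite /sim /xweight /= -(sqrtrM _ (ltW k0)) -(sqrtrM _ (divr_ge0 (d0 _) (d0 _))).
  rewrite ler_wsqrtr// le_eqVlt; apply/orP; left; apply/eqP.
  rewrite exprS; field.
  by rewrite !gt_eqF// ?mulr_gt0// addr_gt0.
exists b => // x; have [z zb zE] := bP x.
exists (restrict (predC upper) z) => [|i].
  exact: le_trans (restrict_le _ _) zb.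
split=> [|j]; last by rewrite restrictE.
by rewrite A1S !restrictE/= -(zE (i, 0%N)).
Qed.

(** Here [T1 - l1] alone has a range of codimension one: it is invertible on
    the upper rows and misses [e00] in the bottom row. A syzygy [(x, y)] is
    trivial if [x] is in that range, which leaves at most one dimension of
    homology in the middle. *)
Lemma fredholm_bottom_row : l2 = 0 -> 1 < normc l1 < Num.sqrt kappa ->
  row_solvable A1 A2 e00 /\
  fin_dim_quotient (ker (koszul1 T)) (range (koszul0 T)).
Proof.
move=> l20 /andP[l11 l1k].
have [b b0' bP] := forward_upper1 l11.
have [c c0 cP] := bottom_row_solve l1k.
have solve x : exists z a, [/\ x = A1 z + a *: e00,
    l2norm z <= (b + c) * l2norm x & normc a <= (1 + normc l1 * c) * l2norm x].
  have nx := l2norm_ge0 x.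
  have [z [zE zU zb]] := bP _ (@restrict_supported R _ upper x).
  have [u ub uE] := cP x.
  exists (z + u), (x (0%N, 0%N) + l1 * u (0%N, 0%N)); split.
  - rewrite (linear_add _ _ A1_linear) zE; apply: l2P => -[i j].
    rewrite l2D l2D l2Z restrictE e00E /upper [(i, j).2]/=.
    case: j => [|j]; rewrite ?ltnn ?ltn0Sn; last first.
      rewrite andbF mulr0 addr0; case: i => [|i].
        by rewrite A10 (uE _).2 mulr0 oppr0 addr0.
      by rewrite A1S !(uE _).2 !mulr0 subr0 addr0.
    case: i => [|i]; last by rewrite (uE i).1 andFb mulr0 addr0 add0r.
    by rewrite A10 !eqxx mulr1 add0r addrCA addNr addr0.
  - rewrite (le_trans (l2normD _ _))// mulrDl lerD// (le_trans zb)//.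
    by rewrite ler_wpM2l// restrict_le.
  rewrite (le_trans (normcD_le _ _))// mulrDl mul1r lerD ?normc_coord//.
  rewrite Normc.normcM -mulrA ler_wpM2l ?normc_ge0//.
  exact: le_trans (normc_coord _ _) ub.
have n0 : 0 <= 1 + normc l1 * c by rewrite addr_ge0// mulr_ge0 ?normc_ge0.
split.
  exists ((b + c) + (1 + normc l1 * c)) => [|x].
    by rewrite !addr_ge0 ?mulr_ge0 ?normc_ge0.
  have nx := l2norm_ge0 x.
  have [z [a [xE zb ab]]] := solve x; exists z, 0, a; split.
  - by rewrite (linear_zero A2_linear) addr0.
  - by rewrite (le_trans zb)// ler_wpM2r// lerDl.
  - by rewrite l2norm0 mulr_ge0// !addr_ge0 ?mulr_ge0 ?normc_ge0.
  - by rewrite (le_trans ab)// ler_wpM2r// lerDr addr_ge0.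
have lk : linear (koszul1 T) by apply: koszul1_linear; [exact: A1_linear|exact: A2_linear].
have lf : linear (fst : H * H -> H) by [].
apply: (@fin_dim_quotient_line _ _ _ _ _ (range A1) fst e00 lf).
- move=> a u v /= ku kv.
  by rewrite /ker /= (linear_sub _ _ lk) (linear_scale _ _ lk) ku kv scaler0 subr0.
- exact: (range_linear_sub A1_linear).
- move=> [x y] _; have [z [a [xE _ _]]] := solve x; exists a, z => //=.
  by rewrite {1}xE addrK.
by move=> [x y] /koszul_syzygy h [z _ zx]; apply: h; exists z; left.
Qed.

Definition positive_col (p : nat * nat) := (0 < p.1)%N.

(** As the weights are at least [1], moving right multiplies [x] by at least
    [1 / |l1|], which a square summable family does not allow. *)
Lemma A1_backward_injective x : normc l1 < 1 ->
  (forall i j, A1 x (i.+1, j) = 0) -> x = 0.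
Proof.
move=> l11 h; have h01 : 0 <= normc l1 < 1 by rewrite normc_ge0.
have step i j : normc (x (i, j)) <= normc l1 * normc (x (i.+1, j)).
  have /eqP := h i j; rewrite A1S subr_eq0 => /eqP e.
  rewrite -Normc.normcM -e Normc.normcM normc_real gtr0_norm ?wt1_gt0//.
  by rewrite ler_peMl ?normc_ge0// wt1_ge1.
apply: l2P => -[i j]; apply: Normc.eq0_normc; apply/eqP.
rewrite eq_le normc_ge0 andbT; apply: (@geometric_le0 _ _ (l2norm x) _ 0%N h01) => n _.
apply: (@le_trans _ _ (normc l1 ^+ n * normc (x ((i + n)%N, j)))).
  elim: n => [|n IH]; first by rewrite expr0 mul1r addn0.
  rewrite (le_trans IH)// exprSr -mulrA addnS ler_wpM2l// exprn_ge0 ?normc_ge0//.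
by rewrite mulrC ler_wpM2r ?exprn_ge0 ?normc_ge0// normc_coord.
Qed.

(** Inside the unit bidisk, [T1 - l1] reaches everything but the leftmost
    column and, on that column, [T2 - l2] reaches everything but its bottom. *)
Lemma fredholm_bidisk : normc l1 < 1 -> normc l2 < 1 ->
  row_solvable A1 A2 e00 /\ middle_exact.
Proof.
move=> l11 l21.
have [?|p|b b0' bP] := @backward_solve _ _ right left rightK wt1 l1 (fun=> 1) 1 1 1
  ltr01 ler01 (fun=> _) l11 wt1_gt0 (fun p => _).
- by rewrite !lexx.
- by rewrite !mulr1 wt1_ge1.
have [_ [M M0 AM]] := (bounded_opP _).1 A1_bounded.
have col x : exists2 z, l2norm z <= b * l2norm x &
    forall i j, (x - A1 z) (i.+1, j) = 0.
  have [z zb zE] := bP x; exists z => // i j.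
  by rewrite l2D l2N A1S (zE (i, j)) subrr.
(* In the leftmost column the weights are [y0, 1, 1, ...]; the similarity with
   entries [1, y0, y0, ...] makes them all equal to [1]. *)
pose y1 := Num.min 1 y0.
have y10 : 0 < y1 by rewrite lt_min ltr01.
have [||p||p|p|c c0 cP] := @backward_solve _ _ up down upK (fun p => beta kappa y0 0 p.2) l2
  (fun p => if p.2 is 0 then 1 else y0) y1 (1 + y0) 1.
- exact: y10.
- by rewrite addr_ge0// ltW.
- case: p => i [|j] /=; rewrite /y1 ge_min lexx ?orbT/=.
    by rewrite lerDl ltW.
  by rewrite lerDr.
- exact: l21.
- exact: beta_gt0.
- case: p => i [|j] /=; rewrite ?mul1r//.
  by rewrite big_ord0 divr1 mulr1.
have solve x : exists z a, [/\ forall j, A2 z (0%N, j) + a * e00 (0%N, j) = x (0%N, j),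
    forall i j, z (i.+1, j) = 0,
    l2norm z <= c * l2norm x & normc a <= (1 + normc l2 * c) * l2norm x].
  have [z zb zE] := cP x.
  have zb' : l2norm (restrict (predC positive_col) z) <= c * l2norm x.
    exact: le_trans (restrict_le _ _) zb.
  exists (restrict (predC positive_col) z), (x (0%N, 0%N) + l2 * z (0%N, 0%N)).
  split=> // [j|i j|].
  - rewrite e00E; case: j => [|j]; last first.
      by rewrite A2S !restrictE/= mulr0 addr0 -(zE (0%N, j)).
    by rewrite A20 restrictE/= mulr1 addrCA addNr addr0.
  - by rewrite restrictE.
  rewrite (le_trans (normcD_le _ _))// mulrDl mul1r lerD ?normc_coord//.
  rewrite Normc.normcM -mulrA ler_wpM2l ?normc_ge0//.
  exact: le_trans (normc_coord _ _) zb.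
split.
  pose rr := 1 + M * b; have rr0 : 0 <= rr by rewrite addr_ge0 ?mulr_ge0.
  pose k := 1 + normc l2 * c.
  have k0 : 0 <= k by rewrite addr_ge0 ?mulr_ge0 ?normc_ge0.
  exists (b + c * rr + k * rr) => [|x]; first by rewrite !addr_ge0 ?mulr_ge0.
  have nx := l2norm_ge0 x.
  have [z1 z1b z1E] := col x; have [z2 [a [z2E z20 z2b ab]]] := solve (x - A1 z1).
  have rb : l2norm (x - A1 z1) <= rr * l2norm x.
    rewrite (le_trans (l2normB _ _))// mulrDl mul1r lerD2l (le_trans (AM _))//.
    by rewrite -mulrA ler_wpM2l.
  exists z1, z2, a; split.
  - suff e : A2 z2 + a *: e00 = x - A1 z1 by rewrite -addrA e addrC subrK.
    apply: l2P => -[[|i] j]; rewrite l2D l2Z; first by rewrite z2E.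
    rewrite z1E e00S mulr0 addr0; case: j => [|j]; first by rewrite A20 z20 mulr0 oppr0.
    by rewrite A2S !z20 !mulr0 subr0.
  - by rewrite (le_trans z1b)// ler_wpM2r// -addrA lerDl addr_ge0 ?mulr_ge0.
  - rewrite (le_trans z2b)// (le_trans (ler_wpM2l c0 rb))// mulrA ler_wpM2r//.
    by rewrite addrAC lerDr addr_ge0 ?mulr_ge0.
  - rewrite (le_trans ab)// (le_trans (ler_wpM2l k0 rb))// mulrA ler_wpM2r//.
    by rewrite lerDr addr_ge0 ?mulr_ge0.
move=> x y e; have [z _ zE] := col x; exists z; left.
apply/eqP; rewrite -subr_eq0 -opprB oppr_eq0; apply/eqP.
have e' : A1 (y - A2 z) = A2 (x - A1 z).
  by rewrite (linear_sub _ _ A1_linear) (linear_sub _ _ A2_linear) A1_A2_comm e.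
apply: A2_inj; rewrite -e'; suff -> : y - A2 z = 0 by exact: linear_zero A1_linear.
apply: (A1_backward_injective l11) => i j; rewrite e'.
case: j => [|j]; first by rewrite A20 zE mulr0 oppr0.
by rewrite A2S !zE !mulr0 subr0.
Qed.

End Point.
End RegularPoints.

(** * Estimates for product vectors *)

Section TensorEstimates.
Context (R : realType).
Local Notation C := R[i].
Local Notation normc := (@Normc.normc R).
Local Notation H := (l2 R (nat * nat)%type).

Lemma sum_le_support (J : eqType) (f : J -> R) (r t : seq J) :
  (forall i, 0 <= f i) -> uniq r -> uniq t ->
  (forall i, i \in r -> f i != 0 -> i \in t) ->
  \sum_(i <- r) f i <= \sum_(i <- t) f i.
Proof.
move=> f0 ur ut rt.
rewrite (bigID (mem t)) /= [X in _ + X]big_seq_cond [X in _ + X]big1 ?addr0; last first.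
  by move=> i /andP[ir it]; apply/eqP; apply: contraNT it; exact: rt.
rewrite -big_filter [leRHS](bigID (mem r)) /= -[in leRHS]big_filter.
rewrite (perm_big [seq i <- t | i \in r]) /=.
  by rewrite lerDl sumr_ge0.
apply: uniq_perm; rewrite ?filter_uniq// => i.
by rewrite !mem_filter andbC.
Qed.

(** A bound on all finite partial sums, in any order: the form in which
    [nnsum_le] uses summability. *)
Definition sums_le (u : nat -> R) (U : R) :=
  forall r : seq nat, uniq r -> \sum_(i <- r) u i <= U.

Lemma sums_leD u v U V : sums_le u U -> sums_le v V ->
  sums_le (fun i => u i + v i) (U + V).
Proof. by move=> uU vV r ur; rewrite big_split/= lerD ?uU ?vV. Qed.

Lemma sums_le_support u (t : seq nat) : (forall i, 0 <= u i) -> uniq t ->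
  (forall i, u i != 0 -> i \in t) -> sums_le u (\sum_(i <- t) u i).
Proof. by move=> u0 ut h r ur; apply: sum_le_support => // i _; exact: h. Qed.

Lemma sums_le_point c k : 0 <= c -> sums_le (fun i => c * (i == k)%:R) c.
Proof.
move=> c0 r ur; have := @sums_le_support (fun i => c * (i == k)%:R) [:: k].
rewrite big_seq1 eqxx mulr1; apply=> // i; first by rewrite mulr_ge0.
by rewrite inE; case: (i == k) => //; rewrite mulr0n mulr0 eqxx.
Qed.

Lemma sums_le_pred_point c k : 0 <= c -> sums_le (fun i => c * (i.+1 == k)%:R) c.
Proof.
case: k => [|k] c0; last by move=> r ur; under eq_bigr do rewrite eqSS; exact: sums_le_point.
by move=> r _; rewrite big1// => i _; rewrite mulr0.
Qed.

Lemma sums_le_arc c M L : 0 <= c ->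
  sums_le (fun i => c * (M <= i < M + L)%N%:R) (c * L%:R).
Proof.
move=> c0 r ur.
have := @sums_le_support (fun i => c * (M <= i < M + L)%N%:R) (iota M L).
rewrite [X in sums_le _ X](_ : _ = c * L%:R).
  apply=> //; [by move=> i; rewrite mulr_ge0|exact: iota_uniq|].
  move=> i; rewrite mem_iota; case: (_ && _) => //. by rewrite mulr0n mulr0 eqxx.
rewrite big_seq (eq_bigr (fun=> c)) -?big_seq.
  by rewrite big_const_seq count_predT size_iota iter_addr_0 mulr_natr.
by move=> i; rewrite mem_iota => ->; rewrite mulr1.
Qed.

Definition geo (q : R) L := \sum_(i <- iota 0 L) q ^+ i.

Lemma sums_le_trunc q L : 0 <= q ->
  sums_le (fun i => (i < L)%N%:R * q ^+ i) (geo q L).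
Proof.
move=> q0 r ur; have := @sums_le_support (fun i => (i < L)%N%:R * q ^+ i) (iota 0 L).
rewrite [X in sums_le _ X](_ : _ = geo q L).
  apply=> //; [by move=> i; rewrite mulr_ge0// exprn_ge0|exact: iota_uniq|].
  by move=> i; rewrite mem_iota; case: (i < L)%N => //; rewrite mul0r eqxx.
rewrite /geo !big_seq; apply: eq_bigr => i.
by rewrite mem_iota => /= ->; rewrite mul1r.
Qed.

Lemma sums_le_geometric q : 0 <= q < 1 -> sums_le (fun i => q ^+ i) (1 - q)^-1.
Proof.
move=> /andP[q0 q1] r ur; have d0 : 0 < 1 - q by rewrite subr_gt0.
pose N := (\max_(i <- r) i).+1.
apply: (@le_trans _ _ (\sum_(i <- iota 0 N) q ^+ i)).
  apply: sum_le_support => //; first by move=> i; rewrite exprn_ge0.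
    exact: iota_uniq.
  by move=> i ir _; rewrite mem_iota add0n ltnS leq_bigmax_seq.
rewrite -(ler_pM2l d0) divff ?gt_eqF// -{1}[N]subn0 -/(index_iota 0 N) big_mkord.
have -> : (1 - q) * \sum_(i < N) q ^+ i = 1 - q ^+ N.
  by rewrite -opprB mulNr -subrX1 opprB.
by rewrite gerBl exprn_ge0.
Qed.

Lemma sum_tensor_le (u v : nat -> R) U V (r : seq (nat * nat)) :
  (forall i, 0 <= u i) -> (forall i, 0 <= v i) -> sums_le u U -> sums_le v V ->
  uniq r -> \sum_(p <- r) u p.1 * v p.2 <= U * V.
Proof.
move=> u0 v0 uU vV ur.
(* Enlarge the set of indices to the product of its projections. *)
pose r1 := undup (map fst r); pose r2 := undup (map snd r).
apply: (@le_trans _ _ (\sum_(p <- [seq (i, j) | i <- r1, j <- r2]) u p.1 * v p.2)).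
  apply: sum_le_support => //; first by move=> p; rewrite mulr_ge0.
    by apply: allpairs_uniq; rewrite ?undup_uniq// => -[? ?] [? ?] _ _ [-> ->].
  move=> [i j] ir _; apply/allpairsP; exists (i, j); split=> //=.
    by rewrite mem_undup; apply/mapP; exists (i, j).
  by rewrite mem_undup; apply/mapP; exists (i, j).
rewrite big_allpairs/=.
under eq_bigr do rewrite -mulr_sumr.
rewrite -mulr_suml ler_pM ?sumr_ge0//; [exact/uU/undup_uniq|exact/vV/undup_uniq].
Qed.

Section Tensor.
Variables (u v : nat -> R) (U V : R).
Hypotheses (u0 : forall i, 0 <= u i) (v0 : forall i, 0 <= v i).
Hypotheses (uU : sums_le u U) (vV : sums_le v V).

Lemma tensor_summable (y : nat * nat -> C) :
  (forall i j, normc (y (i, j)) ^+ 2 <= u i * v j) ->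
  y \in @l2_pred R (nat * nat)%type.
Proof.
move=> yuv; apply/asboolP.
apply: (@nnsum_le _ _ _ (U * V) _ _).1 => [p|r ur]; first exact: sqr_ge0.
apply: le_trans (sum_tensor_le u0 v0 uU vV ur).
by apply: ler_sum => -[i j] _; exact: yuv.
Qed.

Lemma tensor_norm_le (y : H) :
  (forall i j, normc (y (i, j)) ^+ 2 <= u i * v j) -> l2norm y ^+ 2 <= U * V.
Proof.
move=> yuv; rewrite sqr_l2norm.
apply: (@nnsum_le _ _ _ (U * V) _ _).2 => [p|r ur]; first exact: sqr_ge0.
apply: le_trans (sum_tensor_le u0 v0 uU vV ur).
by apply: ler_sum => -[i j] _; exact: yuv.
Qed.

End Tensor.

Lemma tensor_norm_ge (x : H) (a b : nat -> C) (r1 r2 : seq nat) :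
  (forall i j, x (i, j) = a i * b j) -> uniq r1 -> uniq r2 ->
  (\sum_(i <- r1) normc (a i) ^+ 2) * (\sum_(j <- r2) normc (b j) ^+ 2)
    <= l2norm x ^+ 2.
Proof.
move=> xE ur1 ur2; rewrite sqr_l2norm.
have := @sum_le_nnsum _ _ (fun p => normc (x p) ^+ 2) [seq (i, j) | i <- r1, j <- r2]
  (fun=> sqr_ge0 _) (l2_summable x).
rewrite big_allpairs/= => h; apply: le_trans (h _); last first.
  by apply: allpairs_uniq => // -[? ?] [? ?] _ _ [-> ->].
rewrite mulr_suml; apply: ler_sum => i _; rewrite mulr_sumr; apply: ler_sum => j _.
by rewrite xE Normc.normcM exprMn.
Qed.

Definition arc (om : C) M L i : C := if (M <= i < M + L)%N then om ^+ i else 0.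

Definition trunc_powers (m : C) L i : C := if (i < L)%N then m ^+ i else 0.

Lemma arc_norm om M L i : normc om = 1 ->
  normc (arc om M L i) ^+ 2 = (M <= i < M + L)%N%:R.
Proof.
move=> om1; rewrite /arc; case: ifP => _; last by rewrite Normc.normc0 expr0n.
by rewrite normcX om1 !expr1n.
Qed.

Lemma trunc_norm m L i :
  normc (trunc_powers m L i) ^+ 2 = (i < L)%N%:R * (normc m ^+ 2) ^+ i.
Proof.
rewrite /trunc_powers; case: ifP => _; last by rewrite Normc.normc0 expr0n mul0r.
by rewrite normcX mul1r -!exprM mulnC.
Qed.

Lemma sum_arc om M L : normc om = 1 ->
  \sum_(i <- iota M L) normc (arc om M L i) ^+ 2 = L%:R.
Proof.
move=> om1; rewrite big_seq (eq_bigr (fun=> 1)) -?big_seq.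
  by rewrite big_const_seq count_predT size_iota iter_addr_0.
by move=> i; rewrite mem_iota arc_norm// => ->.
Qed.

Lemma sum_trunc m L :
  \sum_(i <- iota 0 L) normc (trunc_powers m L i) ^+ 2 = geo (normc m ^+ 2) L.
Proof.
rewrite /geo !big_seq; apply: eq_bigr => i.
by rewrite mem_iota trunc_norm /= => ->; rewrite mul1r.
Qed.

Definition arc_err (rho delta : R) M L i : R :=
  rho ^+ 2 * (i.+1 == M)%:R + rho ^+ 2 * (i.+1 == M + L)%N%:R +
  delta * (M <= i < M + L)%N%:R.

Lemma arc_err_ge0 rho delta M L i : 0 <= delta -> 0 <= arc_err rho delta M L i.
Proof. by move=> d0; rewrite /arc_err !addr_ge0 ?(mulr_ge0 (sqr_ge0 _)) ?(mulr_ge0 d0). Qed.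

Lemma sums_le_arc_err rho delta M L : 0 <= delta ->
  sums_le (arc_err rho delta M L) (rho ^+ 2 + rho ^+ 2 + delta * L%:R).
Proof.
move=> d0; have p k := sums_le_pred_point k (sqr_ge0 rho).
exact: (sums_leD (sums_leD (p M) (p (M + L)%N)) (sums_le_arc M L d0)).
Qed.

Lemma sums_le_shift u U : (forall i, 0 <= u i) -> sums_le u U ->
  sums_le (fun j => if j is j'.+1 then u j' else 0) U.
Proof.
move=> u0 uU r ur; pose t := [seq j.-1 | j <- r & (0 < j)%N].
apply: (@le_trans _ _ (\sum_(j <- t) u j)); last first.
  apply: uU; rewrite map_inj_in_uniq ?filter_uniq// => i j.
  rewrite !mem_filter => /andP[i0 _] /andP[j0 _] e.
  by rewrite -(prednK i0) e prednK.
rewrite big_map big_filter (bigID (fun j => 0 < j)%N) /= [X in _ + X]big1 ?addr0.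
  by rewrite le_eqVlt; apply/orP; left; apply/eqP/eq_bigr; case.
by case.
Qed.

(** The powers of [om], cut off to an arc of length [L], are an approximate
    eigenvector, for the eigenvalue [rho * om], of a backward shift whose weights
    are close to [rho]: apart from the two ends, the error at each index is the
    defect of a weight, against a squared norm [L]. *)
Lemma arc_error (w : nat -> R) (rho delta : R) om M L i : normc om = 1 ->
  (forall i, 0 <= w i <= rho) ->
  (forall i, (M <= i)%N -> (rho - w i) ^+ 2 <= delta) ->
  normc ((w i)%:C * arc om M L i.+1 - rho%:C * om * arc om M L i) ^+ 2 <=
  arc_err rho delta M L i.
Proof.
move=> om1 wr wd; rewrite /arc_err.
have r0 : 0 <= rho by case/andP: (wr 0%N) => /le_trans; exact.
have d0 : 0 <= delta by exact: le_trans (sqr_ge0 _) (wd M (leqnn _)).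
have n1 n : normc (om ^+ n) = 1 by rewrite normcX om1 expr1n.
have [h1|h1] := boolP (M <= i < M + L)%N; rewrite {2}/arc ?h1 ?(negbTE h1).
  have -> : (i.+1 == M) = false by move: h1; case: eqP => [<-|//]; rewrite ltnn.
  rewrite mulr0 add0r mulr1 /arc.
  have [h2|h2] := boolP (M <= i.+1 < M + L)%N.
    rewrite -mulrA -exprS -mulrBl -rmorphB Normc.normcM n1 mulr1 normc_real.
    rewrite real_normK ?num_real// -sqrrN opprB (le_trans (wd i _))//.
      by case/andP: h1.
    by rewrite lerDr mulr_ge0// sqr_ge0.
  have -> : (i.+1 == M + L)%N.
    move: h1 h2 => /andP[h1 h1']; rewrite (leq_trans h1)//= -leqNgt => h2.
    by rewrite eqn_leq h1'.
  rewrite mulr0 sub0r normcN -mulrA -exprS Normc.normcM n1 normc_real mulr1.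
  by rewrite real_normK ?num_real// mulr1 lerDl.
rewrite !mulr0 addr0 subr0 /arc.
have [h2|h2] := boolP (M <= i.+1 < M + L)%N; last first.
  by rewrite mulr0 Normc.normc0 expr0n/= addr_ge0// mulr_ge0// sqr_ge0.
have -> : i.+1 == M.
  move: h2 h1 => /andP[h2 h2']; rewrite (ltn_trans _ h2')// andbT -ltnNge => h1.
  by rewrite eqn_leq h2 h1.
rewrite Normc.normcM n1 normc_real mulr1 real_normK ?num_real//.
rewrite mulr1 ler_wpDr ?mulr_ge0 ?sqr_ge0//.
by have /andP[w0 wr'] := wr i; rewrite ler_pXn2r ?nnegrE.
Qed.

Lemma trunc_error m L i : normc (trunc_powers m L i.+1 - m * trunc_powers m L i) ^+ 2
  = (normc m ^+ 2) ^+ L * (i.+1 == L)%:R.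
Proof.
rewrite /trunc_powers; have [h|h|h] := ltngtP i.+1 L.
- by rewrite -exprS subrr Normc.normc0 expr0n mulr0.
- by rewrite mulr0 subrr Normc.normc0 expr0n mulr0.
by rewrite -h sub0r normcN mulr1 -exprS normcX -!exprM mulnC.
Qed.

Lemma geo_ge1 q L : 0 <= q -> (0 < L)%N -> 1 <= geo q L.
Proof.
case: L => // L q0 _; rewrite /geo /= big_cons expr0 lerDl.
by rewrite sumr_ge0// => i _; rewrite exprn_ge0.
Qed.

Lemma geo_ge q L : 0 <= q <= 1 -> q ^+ L * L%:R <= geo q L.
Proof.
move=> /andP[q0 q1]; rewrite /geo.
apply: (@le_trans _ _ (\sum_(i <- iota 0 L) q ^+ L)).
  by rewrite big_const_seq count_predT size_iota iter_addr_0 mulr_natr.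
rewrite !big_seq; apply: ler_sum => i; rewrite mem_iota => /= iL.
by rewrite ler_wiXn2l// ltnW.
Qed.

End TensorEstimates.

(** * Points of the spectrum and of the essential spectrum *)

Section WanderingVectors.
Context (R : realType).
Local Notation C := R[i].
Local Notation normc := (@Normc.normc R).
Local Notation H := (l2 R (nat * nat)%type).
Implicit Types (A B : H -> H) (x y : H).

Lemma l2dot_disjoint x y : (forall p, x p = 0 \/ y p = 0) -> l2dot x y = 0.
Proof.
move=> xy; rewrite /l2dot (_ : (fun _ => _) = (fun=> 0)); last first.
  by apply/funext => p; have [->|->] := xy p; rewrite ?rmorph0 ?mul0r ?mulr0.
have r0 : rsum (fun _ : (nat * nat)%type => 0 : R) = 0.
  by rewrite rsum_ge0E// /nnsum esum1.
by rewrite /csum /= r0.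
Qed.

(** Approximate null vectors of the adjoint row that can be found arbitrarily
    far out: with disjoint supports, they form a singular sequence. *)
Definition wandering B1 B2 := forall e N, 0 < e -> exists x N',
  [/\ 0 < l2norm x, forall p, x p != 0 -> (N <= p.1 + p.2 < N')%N,
      l2norm (B1 x) <= e * l2norm x & l2norm (B2 x) <= e * l2norm x].

Lemma wandering_infinite_codim A1 A2 B1 B2 :
  adjoint_pair A1 B1 -> adjoint_pair A2 B2 -> linear A1 -> linear A2 ->
  wandering B1 B2 -> ~ fin_dim_quotient [set: H] (range (koszul1 (A1, A2))).
Proof.
move=> AB1 AB2 lA1 lA2 wand.
have lB1 := adjoint_pair_linear AB1; have lB2 := adjoint_pair_linear AB2.
have q0 k : 0 < (4^-1 : R) ^+ k by rewrite exprn_gt0// invr_gt0.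
have unit_wand (kN : nat * nat) : exists xN : H * nat, [/\ l2norm xN.1 = 1,
    forall p, xN.1 p != 0 -> (kN.2 <= p.1 + p.2 < xN.2)%N,
    l2norm (B1 xN.1) <= (4^-1) ^+ kN.1 & l2norm (B2 xN.1) <= (4^-1) ^+ kN.1].
  have [x [N' [x0 xs B1x B2x]]] := wand _ kN.2 (q0 kN.1).
  have n1 : normc (l2norm x)^-1%:C = (l2norm x)^-1.
    by rewrite normc_real gtr0_norm// invr_gt0.
  pose y := (l2norm x)^-1%:C *: x; exists (y, N').
  split; rewrite [(_, _).1]/= ?[(_, _).2]/= ?/y.
  - by rewrite l2normZ n1 mulVf// gt_eqF.
  - by move=> p; rewrite l2Z mulf_eq0 negb_or => /andP[_ /xs].
  - by rewrite linear_scale// l2normZ n1 mulrC ler_pdivrMr.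
  - by rewrite linear_scale// l2normZ n1 mulrC ler_pdivrMr.
have [F FP] := choice unit_wand.
(* [x k] is supported on the strip [N k <= i + j < N (k + 1)]. *)
pose N := fix N k := if k is k'.+1 then (F (k', N k')).2 else 0%N.
pose x k := (F (k, N k)).1.
have x1 k : l2norm (x k) = 1 by have [] := FP (k, N k).
have xs k p : x k p != 0 -> (N k <= p.1 + p.2 < N k.+1)%N.
  by have [_ h _ _] := FP (k, N k); exact: h.
have NS k : (N k <= N k.+1)%N.
  have [p xp] : exists p, x k p != 0.
    apply/not_existsP => h; have : l2norm (x k) = 0.
      rewrite (_ : x k = 0) ?l2norm0//; apply: l2P => p.
      by apply/eqP/negPn/negP/h.
    by rewrite x1 => /eqP; rewrite oner_eq0.
  by have /andP[h1 h2] := xs _ _ xp; exact: leq_trans h1 (ltnW h2).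
have Nle k l : (k <= l)%N -> (N k <= N l)%N.
  move=> kl; rewrite -(subnKC kl); elim: (l - k)%N => [|d IH]; first by rewrite addn0.
  by rewrite addnS (leq_trans IH).
have orth k l : (k < l)%N -> forall p, x k p = 0 \/ x l p = 0.
  move=> kl p; have [->|/xs/andP[_ h]] := eqVneq (x k p) 0; first by left.
  have [->|/xs/andP[h' _]] := eqVneq (x l p) 0; first by right.
  by have := leq_ltn_trans (leq_trans (Nle _ _ kl) h') h; rewrite ltnn.
apply: (@singular_sequence_infinite_codim _ _ A1 A2 B1 B2 x) => //.
- move=> k l; have [kl|kl|->] := ltngtP k l.
  + exact/l2dot_disjoint/orth.
  + by apply: l2dot_disjoint => p; have [] := orth _ _ kl p; [right|left].
  + by rewrite l2dotE x1 expr1n.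
- by move=> k; have [] := FP (k, N k).
- by move=> k; have [] := FP (k, N k).
Qed.

End WanderingVectors.

Section SpectralPoints.
Context (R : realType) (kappa y0 : R).
Hypotheses (kappa_gt1 : 1 < kappa) (y0_gt0 : 0 < y0).
Local Notation C := R[i].
Local Notation normc := (@Normc.normc R).
Local Notation H := (l2 R (nat * nat)%type).
Implicit Types (x y z : H).
Local Notation wt1 := (@wt1 R kappa).
Local Notation wt2 := (@wt2 R kappa y0).

Variables l1 l2 : C.
Local Notation A1 := (op_shift (wshift1 (alpha kappa)) l1).
Local Notation A2 := (op_shift (wshift2 (beta kappa y0)) l2).
Local Notation B1 := (op_shift (adj1 kappa) l1^*).
Local Notation B2 := (op_shift (adj2 kappa y0) l2^*).
Let T := pair_shift (shift_pair kappa y0) (l1, l2).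

Let AB1 : adjoint_pair A1 B1. Proof. exact: adjoint_A1. Qed.
Let AB2 : adjoint_pair A2 B2. Proof. exact: adjoint_A2. Qed.
Let lA1 : linear A1. Proof. exact: A1_linear. Qed.
Let lA2 : linear A2. Proof. exact: A2_linear. Qed.

Lemma B1E x i j : B1 x (i, j) = (wt1 (i, j))%:C * x (i.+1, j) - l1^* * x (i, j).
Proof. by rewrite l2D l2N l2Z adj1E. Qed.

Lemma B2E x i j : B2 x (i, j) = (wt2 (i, j))%:C * x (i, j.+1) - l2^* * x (i, j).
Proof. by rewrite l2D l2N l2Z adj2E. Qed.

Lemma row_square_koszul1 x : range (koszul1 T) (row_square T x).
Proof.
exists (- B2 x, B1 x) => //.
rewrite /koszul1 /row_square /= (adjoint_pairE AB1) (adjoint_pairE AB2).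
by rewrite -(sub0r (B2 x)) (linear_sub _ _ lA2) (linear_zero lA2) sub0r opprK.
Qed.

Lemma not_onto_point v : ~ range (koszul1 T) v ->
  ~ koszul_exact T /\ ~ invertible_op (row_square T).
Proof.
move=> Nv; split=> [[_ _ e]|[F [_ _ FK]]]; apply: Nv; first by rewrite e.
by rewrite -(FK v); exact: row_square_koszul1.
Qed.

Lemma infinite_codim_point : ~ fin_dim_quotient [set: H] (range (koszul1 T)) ->
  (~ koszul_fredholm T /\ ~ fredholm_op (row_square T)) /\
  (~ koszul_exact T /\ ~ invertible_op (row_square T)).
Proof.
move=> Nf; split.
  split=> [[_ _]//|[_ [n [b [_ bP]]]]]; apply: Nf; exists n, b; split=> // z _.
  have [c [x _ xE]] := bP z Logic.I; exists c; rewrite -xE.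
  exact: row_square_koszul1.
have [v Nv] : exists v, ~ range (koszul1 T) v.
  apply/existsNP => h; apply: Nf; exists 0%N, (fun=> 0); split=> // z _.
  by exists (fun=> 0); rewrite big_ord0 subr0.
exact: not_onto_point Nv.
Qed.

Lemma wandering_point : wandering B1 B2 ->
  (~ koszul_fredholm T /\ ~ fredholm_op (row_square T)) /\
  (~ koszul_exact T /\ ~ invertible_op (row_square T)).
Proof.
by move=> w; apply: infinite_codim_point; exact: wandering_infinite_codim AB1 AB2 lA1 lA2 w.
Qed.

Lemma kappaX_gt0 n : 0 < kappa ^+ n.
Proof. by rewrite exprn_gt0// (lt_trans ltr01). Qed.

Lemma moment_gt0 n : 0 < 1 + kappa ^+ n.
Proof. by rewrite addr_gt0// kappaX_gt0. Qed.

Lemma sqr_xweight n : xweight kappa n ^+ 2 = (1 + kappa ^+ n.+1) / (1 + kappa ^+ n).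
Proof. by rewrite sqr_sqrtr// divr_ge0// ltW// moment_gt0. Qed.

Lemma sqr_prod_xweight n :
  (\prod_(k < n) xweight kappa k) ^+ 2 = (1 + kappa ^+ n) / 2.
Proof.
elim: n => [|n IH]; first by rewrite big_ord0 expr1n expr0 divff// pnatr_eq0.
rewrite big_ord_recr/= exprMn IH sqr_xweight.
by field; rewrite gt_eqF ?moment_gt0.
Qed.

Lemma moment_decay (e : R) N : 0 < e -> exists2 M, (N < M)%N &
  forall i, (M <= i)%N -> (1 + kappa ^+ i)^-1 <= e.
Proof.
move=> e0; pose d := kappa - 1; have d0 : 0 < d by rewrite subr_gt0.
have bern i : i%:R * d <= kappa ^+ i.
  elim: i => [|i IH]; first by rewrite mul0r expr0.
  have h1 : 1 <= kappa ^+ i by rewrite exprn_ege1// ltW.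
  rewrite -natr1 mulrDl mul1r exprS.
  have -> : kappa = 1 + d by rewrite /d addrCA subrr addr0.
  rewrite mulrDl mul1r; move: IH h1; have -> : kappa = 1 + d by rewrite /d addrCA subrr addr0.
  by move=> IH h1; rewrite lerD// ler_peMr// ltW.
pose n := Num.bound ((e * d)^-1).
have nP : (e * d)^-1 < n%:R by apply: archi_boundP; rewrite invr_ge0 ltW// mulr_gt0.
exists (maxn N.+1 n) => [|i]; first by rewrite leq_max ltnS leqnn.
rewrite geq_max => /andP[_ ni].
rewrite -[leRHS]invrK lef_pV2 ?posrE ?moment_gt0 ?invr_gt0//.
apply: (@le_trans _ _ (kappa ^+ i)); last by rewrite lerDr.
apply: le_trans (bern i); rewrite -ler_pdivrMr// -invfM (le_trans (ltW nP))//.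
by rewrite ler_nat.
Qed.

Lemma nat_ge (a : R) : exists2 n, (0 < n)%N & a <= n%:R.
Proof.
exists (Num.bound `|a|).+1 => //.
rewrite (le_trans (ler_norm a))// (le_trans (ltW (archi_boundP (normr_ge0 a))))//.
by rewrite ler_nat.
Qed.

Lemma norm_le_of_sqr (e U S : R) x y : 0 <= e -> l2norm y ^+ 2 <= U ->
  S <= l2norm x ^+ 2 -> U <= e ^+ 2 * S -> l2norm y <= e * l2norm x.
Proof.
move=> e0 yU Sx US.
rewrite -(@ler_pXn2r _ 2)// ?nnegrE ?l2norm_ge0 ?mulr_ge0 ?l2norm_ge0//.
rewrite exprMn (le_trans yU)// (le_trans US)// ler_wpM2l ?sqr_ge0//.
Qed.

Lemma l2norm_gt0 (S : R) x : 0 < S -> S <= l2norm x ^+ 2 -> 0 < l2norm x.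
Proof.
move=> S0 Sx; rewrite lt0r l2norm_ge0 andbT -sqrf_eq0 gt_eqF//.
exact: lt_le_trans Sx.
Qed.

(** The last term of a decreasing geometric sum is at most the mean of the sum,
    hence small against the sum if there are many terms. *)
Lemma geo_absorb (q e : R) J : 0 <= q <= 1 -> 2 <= e ^+ 2 * J%:R -> (0 < J)%N ->
  2 * q ^+ J <= e ^+ 2 * geo q J.
Proof.
move=> q01 eJ J0; have Jp : 0 < J%:R :> R by rewrite ltr0n.
have := geo_ge J q01 => h; have q0 : 0 <= q ^+ J by case/andP: q01 => *; rewrite exprn_ge0.
apply: (@le_trans _ _ (e ^+ 2 * J%:R * q ^+ J)); first by rewrite ler_wpM2r.
by rewrite -mulrA ler_wpM2l ?sqr_ge0// mulrC.
Qed.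

Lemma l2fun_ofP (f : nat * nat -> C) : f \in @l2_pred R (nat * nat)%type ->
  exists x : H, forall p, x p = f p.
Proof. by move=> fP; exists (Defs.L2 fP). Qed.

(** Far to the right on the upper rows, truncated powers of [conj l1] and
    [conj l2]: the weight that leads from the bottom row to the first one
    tends to [0], so that cutting off the bottom row costs nothing. *)
Lemma wandering_circle_disk : normc l1 = 1 -> normc l2 <= 1 -> wandering B1 B2.
Proof.
move=> l11 l21 e N e0; have e20 : 0 < e ^+ 2 by rewrite exprn_gt0.
have [J J0 eJ'] := nat_ge (2 / e ^+ 2).
have eJ : 2 <= e ^+ 2 * J%:R by rewrite mulrC -ler_pdivrMr.
(* From the column [M] on, the squared weights [y0^2 * 2 / (1 + kappa^i)] that
   lead out of the bottom row are at most [e^2 / 2]. *)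
have [M NM MP] := @moment_decay (e ^+ 2 / (4 * y0 ^+ 2)) N
  (divr_gt0 e20 (mulr_gt0 (ltr0Sn _ 3) (exprn_gt0 2 y0_gt0))).
pose q := normc l2 ^+ 2.
have q01 : 0 <= q <= 1 by rewrite sqr_ge0 expr_le1// normc_ge0.
have q0 : 0 <= q by case/andP: q01.
have m1 : normc l1^* = 1 by rewrite normc_conj.
have mq : normc l2^* ^+ 2 = q by rewrite normc_conj.
pose b j : C := if j is j'.+1 then trunc_powers l2^* J j' else 0.
pose v (j : nat) : R := if j is j'.+1 then (j' < J)%N%:R * q ^+ j' else 0.
have bv j : normc (b j) ^+ 2 = v j.
  by case: j => [|j]; rewrite /b/v ?Normc.normc0 ?expr0n// trunc_norm mq.
have v0 j : 0 <= v j by rewrite -bv sqr_ge0.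
pose G := geo q J; have G1 : 1 <= G := geo_ge1 q0 J0.
have vG : sums_le v G.
  apply: (@sums_le_shift _ (fun j => (j < J)%N%:R * q ^+ j)); last exact: sums_le_trunc.
  by move=> i; rewrite mulr_ge0// exprn_ge0.
pose a := arc l1^* M J; pose u (i : nat) : R := 1 * (M <= i < M + J)%N%:R.
have au i : normc (a i) ^+ 2 = u i by rewrite arc_norm// /u mul1r.
have u0 i : 0 <= u i by rewrite -au sqr_ge0.
have uL : sums_le u (1 * J%:R) := sums_le_arc M J ler01.
have [x xE] : exists x : H, forall p, x p = a p.1 * b p.2.
  apply: l2fun_ofP; apply: (tensor_summable u0 v0 uL vG) => i j.
  by rewrite Normc.normcM exprMn au bv.
have xE' i j : x (i, j) = a i * b j by rewrite xE.
have low : J%:R * G <= l2norm x ^+ 2.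
  have := @tensor_norm_ge _ x a b (iota M J) (iota 1 J) xE' (iota_uniq _ _) (iota_uniq _ _).
  rewrite sum_arc// (iotaDl 1 0 J) big_map.
  by rewrite (eq_bigr (fun j => normc (trunc_powers l2^* J j) ^+ 2))// sum_trunc mq.
have Jp : 0 < J%:R :> R by rewrite ltr0n.
have G0 : 0 < G := lt_le_trans ltr01 G1.
exists x, (M + J + J).+1; split.
- by apply: l2norm_gt0 low; rewrite mulr_gt0.
- move=> [i j]; rewrite xE mulf_eq0 negb_or /= => /andP[].
  rewrite /a /arc; case: ifP => [/andP[h1 h2] _|]; last by rewrite eqxx.
  rewrite (leq_trans (ltnW NM) (leq_trans h1 (leq_addr _ _)))/=.
  case: j => [|j]; first by rewrite eqxx.
  rewrite /b /trunc_powers; case: ifP => [h3 _|]; last by rewrite eqxx.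
  by rewrite ltnS leq_add// ltnW.
- have e1 : normc l1 = 1 := l11.
  apply: (norm_le_of_sqr (ltW e0) _ low (U := (1 ^+ 2 + 1 ^+ 2 + 0 * J%:R) * G)).
    apply: (tensor_norm_le (u := arc_err 1 0 M J) (v := v)) => //.
    + by move=> i; exact: arc_err_ge0.
    + exact: sums_le_arc_err.
    move=> i j; rewrite B1E !xE'.
    have -> : (wt1 (i, j))%:C * (a i.+1 * b j) - l1^* * (a i * b j) =
       (1%:C * a i.+1 - 1%:C * l1^* * a i) * b j.
      case: j => [|j]; first by rewrite /b !mulr0 subr0.
      by rewrite /wt1 /= rmorph1; ring.
    rewrite Normc.normcM exprMn bv ler_wpM2r//.
    apply: (@arc_error _ (fun=> 1)) => // k; first by rewrite ler01 lexx.
    by rewrite subrr expr0n.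
  rewrite !expr1n mul0r addr0 mulrA ler_wpM2r ?(ltW G0)//.
- pose eta := e ^+ 2 / 2.
  have eta0 : 0 < eta by rewrite divr_gt0.
  pose v' (j : nat) := eta * (j == 0%N)%:R + q ^+ J * (j == J)%:R.
  have qJ0 : 0 <= q ^+ J by rewrite exprn_ge0.
  apply: (norm_le_of_sqr (ltW e0) _ low (U := (1 * J%:R) * (eta + q ^+ J))).
    apply: (tensor_norm_le (u := u) (v := v')) => //.
    + by move=> j; rewrite addr_ge0 ?(mulr_ge0 (ltW eta0)) ?(mulr_ge0 qJ0).
    + by apply: sums_leD; apply: sums_le_point => //; exact: ltW.
    move=> i j; rewrite B2E !xE'.
    case: j => [|j]; last first.
      have -> : (wt2 (i, j.+1))%:C * (a i * b j.+2) - l2^* * (a i * b j.+1) =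
          a i * (trunc_powers l2^* J j.+1 - l2^* * trunc_powers l2^* J j).
        by rewrite /b /wt2 /= rmorph1; ring.
      rewrite Normc.normcM exprMn au trunc_error mq /v' mulr0 add0r.
      by rewrite ler_wpM2l.
    rewrite [b 0%N]/= !mulr0 subr0 !Normc.normcM !exprMn au /v' eqxx mulr1.
    have -> : normc (b 1%N) ^+ 2 = 1 by rewrite bv /v J0 mul1r expr0.
    rewrite mulr1 normc_real real_normK ?num_real// mulrC.
    rewrite /u mul1r; have [/andP[Mi _]|_] := boolP (M <= i < M + J)%N.
      2: by rewrite !mul0r.
    rewrite !mul1r (@le_trans _ _ eta)// ?lerDl ?(mulr_ge0 qJ0)//.
    rewrite /wt2 /= expr_div_n sqr_prod_xweight invfM invrK mulrA mulrAC.
    have := ler_wpM2l (ltW (exprn_gt0 2 y0_gt0)) (MP i Mi).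
    have -> : y0 ^+ 2 * (e ^+ 2 / (4 * y0 ^+ 2)) = e ^+ 2 / 4.
      by field; rewrite gt_eqF.
    by rewrite /eta; lra.
  rewrite mul1r mulrCA ler_pM2l// /eta.
  have := geo_absorb q01 eJ J0; rewrite -/G.
  have := ler_wpM2l (ltW e20) G1; rewrite mulr1; lra.
Qed.

(** The same vectors with the two directions exchanged: the arc runs upward. It
    starts high enough for all the weights that it meets to be [1]. *)
Lemma wandering_disk_circle : normc l1 <= 1 -> normc l2 = 1 -> wandering B1 B2.
Proof.
move=> l11 l21 e N e0; have e20 : 0 < e ^+ 2 by rewrite exprn_gt0.
have [J J0 eJ'] := nat_ge (2 / e ^+ 2).
have eJ : 2 <= e ^+ 2 * J%:R by rewrite mulrC -ler_pdivrMr.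
pose M := N.+2; pose q := normc l1 ^+ 2.
have q01 : 0 <= q <= 1 by rewrite sqr_ge0 expr_le1// normc_ge0.
have q0 : 0 <= q by case/andP: q01.
have m1 : normc l2^* = 1 by rewrite normc_conj.
have mq : normc l1^* ^+ 2 = q by rewrite normc_conj.
pose a := trunc_powers l1^* J; pose u (i : nat) : R := (i < J)%N%:R * q ^+ i.
have au i : normc (a i) ^+ 2 = u i by rewrite trunc_norm mq.
have u0 i : 0 <= u i by rewrite -au sqr_ge0.
pose G := geo q J; have G1 : 1 <= G := geo_ge1 q0 J0.
have uG : sums_le u G := sums_le_trunc J q0.
pose b := arc l2^* M J; pose v (j : nat) : R := 1 * (M <= j < M + J)%N%:R.
have bv j : normc (b j) ^+ 2 = v j by rewrite arc_norm// /v mul1r.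
have v0 j : 0 <= v j by rewrite -bv sqr_ge0.
have vL : sums_le v (1 * J%:R) := sums_le_arc M J ler01.
have [x xE] : exists x : H, forall p, x p = a p.1 * b p.2.
  apply: l2fun_ofP; apply: (tensor_summable u0 v0 uG vL) => i j.
  by rewrite Normc.normcM exprMn au bv.
have xE' i j : x (i, j) = a i * b j by rewrite xE.
have low : G * J%:R <= l2norm x ^+ 2.
  have := @tensor_norm_ge _ x a b (iota 0 J) (iota M J) xE' (iota_uniq _ _) (iota_uniq _ _).
  by rewrite (sum_arc M J m1) sum_trunc mq.
have Jp : 0 < J%:R :> R by rewrite ltr0n.
have G0 : 0 < G := lt_le_trans ltr01 G1.
exists x, (J + (M + J))%N; split.
- by apply: l2norm_gt0 low; rewrite mulr_gt0.
- move=> [i j]; rewrite xE mulf_eq0 negb_or /= => /andP[].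
  rewrite /a /trunc_powers; case: ifP => [h1 _|]; last by rewrite eqxx.
  rewrite /b /arc; case: ifP => [/andP[h2 h3] _|]; last by rewrite eqxx.
  rewrite (leq_trans _ (leq_trans h2 (leq_addl _ _))) ?leqW//=.
  by rewrite -addSn leq_add// ltnW.
- apply: (norm_le_of_sqr (ltW e0) _ low (U := q ^+ J * (1 * J%:R))).
    apply: (tensor_norm_le (u := fun i => q ^+ J * (i.+1 == J)%:R) (v := v)) => //.
    + by move=> i; rewrite mulr_ge0// exprn_ge0.
    + by apply: sums_le_pred_point; rewrite exprn_ge0.
    move=> i j; rewrite B1E !xE'.
    have -> : (wt1 (i, j))%:C * (a i.+1 * b j) - l1^* * (a i * b j) =
       (a i.+1 - l1^* * a i) * b j.
      case: j => [|j]; first by rewrite /b /arc/= !mulr0 subr0.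
      by rewrite /wt1 /= rmorph1; ring.
    by rewrite Normc.normcM exprMn bv trunc_error mq.
  rewrite mul1r mulrA ler_pM2r//.
  have := geo_absorb q01 eJ J0; rewrite -/G.
  have : 0 <= q ^+ J by rewrite exprn_ge0.
  by lra.
- apply: (norm_le_of_sqr (ltW e0) _ low (U := G * (1 ^+ 2 + 1 ^+ 2 + 0 * J%:R))).
    apply: (tensor_norm_le (u := u) (v := arc_err 1 0 M J)) => //.
    + by move=> i; exact: arc_err_ge0.
    + exact: sums_le_arc_err.
    move=> i j; rewrite B2E !xE'.
    have -> : (wt2 (i, j))%:C * (a i * b j.+1) - l2^* * (a i * b j) =
       a i * (1%:C * b j.+1 - 1%:C * l2^* * b j).
      case: j => [|j]; first by rewrite /b /arc/= !mulr0 subr0 mulr0.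
      by rewrite /wt2 /= rmorph1; ring.
    rewrite Normc.normcM exprMn au ler_wpM2l//.
    apply: (@arc_error _ (fun=> 1)) => // k; first by rewrite ler01 lexx.
    by rewrite subrr expr0n.
  rewrite !expr1n mul0r addr0 mulrCA ler_pM2l//.
Qed.

(** An arc of powers in the bottom row, which [T2^*] annihilates and where the
    weights of [T1] tend to [sqrt kappa]. *)
Lemma wandering_outer_circle : normc l1 = Num.sqrt kappa -> l2 = 0 -> wandering B1 B2.
Proof.
move=> l1k l20 e N e0; have e20 : 0 < e ^+ 2 by rewrite exprn_gt0.
have k0 : 0 < kappa := lt_trans ltr01 kappa_gt1.
have rk0 : 0 < Num.sqrt kappa by rewrite sqrtr_gt0.
have rk2 : Num.sqrt kappa ^+ 2 = kappa by rewrite sqr_sqrtr ?ltW.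
have [J J0 eJ'] := nat_ge (4 * kappa / e ^+ 2).
have eJ : 4 * kappa <= e ^+ 2 * J%:R by rewrite [leRHS]mulrC -ler_pdivrMr.
pose delta := e ^+ 2 / 2; have delta0 : 0 < delta by rewrite divr_gt0.
have d0 : 0 < kappa - 1 by rewrite subr_gt0.
(* The bound below comes from [(sqrt kappa - x_k)^2 <= kappa - x_k^2], which
   equals [(kappa - 1) / (1 + kappa^k)]. *)
have [M NM MP] := @moment_decay (delta / (kappa - 1)) N (divr_gt0 delta0 d0).
pose om := l1^* / (Num.sqrt kappa)%:C.
have rkC : (Num.sqrt kappa)%:C != 0 :> C by rewrite fmorph_eq0 gt_eqF.
have om1 : normc om = 1.
  by rewrite Normc.normcM normcV normc_conj normc_real gtr0_norm// l1k divff// gt_eqF.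
have omE : l1^* = (Num.sqrt kappa)%:C * om by rewrite /om mulrC divfK.
pose a := arc om M J; pose u (i : nat) : R := 1 * (M <= i < M + J)%N%:R.
have au i : normc (a i) ^+ 2 = u i by rewrite arc_norm// /u mul1r.
have u0 i : 0 <= u i by rewrite -au sqr_ge0.
have uL : sums_le u (1 * J%:R) := sums_le_arc M J ler01.
pose b (j : nat) : C := (j == 0%N)%:R; pose v (j : nat) : R := 1 * (j == 0%N)%:R.
have bv j : normc (b j) ^+ 2 = v j.
  rewrite /b /v; case: (j == _); rewrite ?Normc.normc1 ?Normc.normc0;
    by rewrite ?expr1n ?expr0n ?mulr1 ?mulr0.
have v0 j : 0 <= v j by rewrite -bv sqr_ge0.
have vL : sums_le v 1 := sums_le_point 0 ler01.
have [x xE] : exists x : H, forall p, x p = a p.1 * b p.2.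
  apply: l2fun_ofP; apply: (tensor_summable u0 v0 uL vL) => i j.
  by rewrite Normc.normcM exprMn au bv.
have xE' i j : x (i, j) = a i * b j by rewrite xE.
have low : J%:R <= l2norm x ^+ 2.
  have := @tensor_norm_ge _ x a b (iota M J) [:: 0%N] xE' (iota_uniq _ _) isT.
  by rewrite sum_arc// big_seq1 bv /v eqxx !mulr1.
have Jp : 0 < J%:R :> R by rewrite ltr0n.
exists x, (M + J)%N; split.
- exact: l2norm_gt0 low.
- move=> [i j]; rewrite xE mulf_eq0 negb_or /= => /andP[].
  rewrite /a /arc; case: ifP => [/andP[h1 h2] _|]; last by rewrite eqxx.
  rewrite /b; case: j => [_|j]; last by rewrite eqxx.
  by rewrite addn0 h2 (leq_trans (ltnW NM) h1).
- apply: (norm_le_of_sqr (ltW e0) _ low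
    (U := (Num.sqrt kappa ^+ 2 + Num.sqrt kappa ^+ 2 + delta * J%:R) * 1)).
    apply: (tensor_norm_le (u := arc_err (Num.sqrt kappa) delta M J) (v := v)) => //.
    + by move=> i; apply: arc_err_ge0; exact: ltW.
    + by apply: sums_le_arc_err; exact: ltW.
    move=> i j; rewrite B1E !xE' omE.
    have -> : (wt1 (i, j))%:C * (a i.+1 * b j) - (Num.sqrt kappa)%:C * om * (a i * b j) =
       ((xweight kappa i)%:C * a i.+1 - (Num.sqrt kappa)%:C * om * a i) * b j.
      by case: j => [|j]; rewrite /b ?mulr0 ?subr0// /wt1 /=; ring.
    rewrite Normc.normcM exprMn bv ler_wpM2r//.
    have w0 k : 0 < xweight kappa k := alpha_gt0 kappa_gt1 k 0.
    apply: arc_error => // k; first by rewrite (ltW (w0 k)) xweight_le.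
    move=> Mk; have := MP k Mk; rewrite ler_pdivlMr// => h.
    have hw := xweight_le kappa_gt1 k; have hw0 := w0 k.
    have : xweight kappa k ^+ 2 = kappa - (1 + kappa ^+ k)^-1 * (kappa - 1).
      by rewrite sqr_xweight exprS; field; rewrite gt_eqF// moment_gt0.
    move=> w2; apply: le_trans h.
    have -> : (1 + kappa ^+ k)^-1 * (kappa - 1) =
        Num.sqrt kappa ^+ 2 - xweight kappa k ^+ 2 by rewrite rk2 w2 subKr.
    rewrite -subr_ge0.
    have -> : Num.sqrt kappa ^+ 2 - xweight kappa k ^+ 2 -
        (Num.sqrt kappa - xweight kappa k) ^+ 2 =
      2 * (xweight kappa k * (Num.sqrt kappa - xweight kappa k)) by ring.
    by rewrite mulr_ge0// mulr_ge0 ?subr_ge0// ltW.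
  by rewrite mulr1 rk2 /delta; lra.
apply: (@le_trans _ _ 0); last by rewrite mulr_ge0 ?l2norm_ge0// ltW.
rewrite (_ : B2 x = 0) ?l2norm0//; apply: l2P => -[i j].
by rewrite B2E !xE' l20 rmorph0 mul0r subr0 /b mulr0 mulr0.
Qed.

(** A joint eigenvector of the adjoints is orthogonal to the range. *)
Lemma eigenvector_point x : x != 0 -> B1 x = 0 -> B2 x = 0 ->
  ~ koszul_exact T /\ ~ invertible_op (row_square T).
Proof.
move=> x0 B1x B2x; apply: (@not_onto_point x) => -[z _ zx].
have : l2dot x x = 0.
  rewrite -{1}zx /koszul1 /= l2dotBl AB1 AB2 B1x B2x.
  by rewrite -(scale0r (0 : H)) !l2dotZr !rmorph0 !mul0r subrr.
by move/eqP; rewrite gt_eqF// l2dot_gt0.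
Qed.

(** The norm of [T1 ^ i T2 ^ j e_(0,0)], for [p = (i, j)]. *)
Definition gweight (p : nat * nat) : R :=
  if p.2 is 0 then \prod_(k < p.1) xweight kappa k else y0.

Lemma gweight_gt0 p : 0 < gweight p.
Proof.
case: p => i [|j]//; rewrite /gweight/= (lt_le_trans ltr01)//.
exact: prod_xweight_ge1.
Qed.

Lemma gweight_right p : gweight (right p) = wt1 p * gweight p.
Proof.
case: p => i [|j]; rewrite /gweight /wt1 /=; last by rewrite mul1r.
by rewrite big_ord_recr/= mulrC.
Qed.

Lemma gweight_up p : gweight (up p) = wt2 p * gweight p.
Proof.
case: p => i [|j]; rewrite /gweight /wt2 /=; last by rewrite mul1r.
by rewrite divfK// gt_eqF// (lt_le_trans ltr01)// prod_xweight_ge1.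
Qed.

(** In terms of the orthogonal basis [T1 ^ i T2 ^ j e_(0,0)], the elements of the
    space are power series, and the joint eigenvector of the adjoints represents
    evaluation at [(l1, l2)]. The hypothesis bounds its coordinates by a
    geometric family. *)
Lemma evaluation_point (q1 q2 c : R) : 0 <= q1 < 1 -> 0 <= q2 < 1 -> 0 <= c ->
  (forall i j, normc (l1 ^+ i * l2 ^+ j) ^+ 2 <=
     c * gweight (i, j) ^+ 2 * (q1 ^+ i * q2 ^+ j)) ->
  ~ koszul_exact T /\ ~ invertible_op (row_square T).
Proof.
move=> q10 q20 c0 bound.
have [x xE] : exists x : H,
    forall p, x p = l1^* ^+ p.1 * l2^* ^+ p.2 / (gweight p)%:C.
  apply: l2fun_ofP.
  have u0 i : 0 <= c * q1 ^+ i by rewrite mulr_ge0// exprn_ge0//; case/andP: q10.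
  have v0 j : 0 <= q2 ^+ j by rewrite exprn_ge0//; case/andP: q20.
  have uU : sums_le (fun i => c * q1 ^+ i) (c * (1 - q1)^-1).
    by move=> r ur; rewrite -mulr_sumr ler_wpM2l//; exact: sums_le_geometric.
  apply: (tensor_summable u0 v0 uU (sums_le_geometric q20)) => i j /=.
  rewrite Normc.normcM normcV normc_real gtr0_norm ?gweight_gt0// exprMn exprVn.
  rewrite ler_pdivrMr ?exprn_gt0 ?gweight_gt0//.
  rewrite Normc.normcM !normcX !normc_conj -!normcX -Normc.normcM.
  by rewrite (le_trans (bound i j))// mulrAC !mulrA lexx.
have g0 p : (gweight p)%:C != 0 :> C by rewrite fmorph_eq0 gt_eqF// gweight_gt0.
apply: (@eigenvector_point x).
- apply/eqP => x0; have := xE (0%N, 0%N); rewrite x0 l20 => /eqP.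
  by rewrite eq_sym /= !expr0 !mul1r invr_eq0 (negbTE (g0 _)).
- apply: l2P => -[i j]; rewrite B1E !xE l20 /=.
  rewrite (gweight_right (i, j)) rmorphM/= exprS.
  by field; rewrite g0 fmorph_eq0 gt_eqF// wt1_gt0.
- apply: l2P => -[i j]; rewrite B2E !xE l20 /=.
  rewrite (gweight_up (i, j)) rmorphM/= exprS.
  by field; rewrite g0 fmorph_eq0 gt_eqF// wt2_gt0.
Qed.

Lemma bidisk_point : normc l1 < 1 -> normc l2 < 1 ->
  ~ koszul_exact T /\ ~ invertible_op (row_square T).
Proof.
move=> l11 l21; pose c := 1 + (y0 ^+ 2)^-1.
have y2 : 0 < y0 ^+ 2 by rewrite exprn_gt0.
have yV : 0 < (y0 ^+ 2)^-1 by rewrite invr_gt0.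
have c0 : 0 <= c by rewrite addr_ge0// ltW.
apply: (@evaluation_point (normc l1 ^+ 2) (normc l2 ^+ 2) c) => //.
- by rewrite sqr_ge0 expr_lt1// normc_ge0.
- by rewrite sqr_ge0 expr_lt1// normc_ge0.
move=> i j; rewrite Normc.normcM exprMn !normcX -!exprM ![(_ * 2)%N]mulnC.
rewrite ler_peMl ?mulr_ge0 ?exprn_ge0 ?normc_ge0//.
case: j => [|j]; rewrite /gweight /=.
  have : 1 <= (\prod_(k < i) xweight kappa k) ^+ 2.
    by rewrite exprn_ege1// prod_xweight_ge1.
  rewrite /c; nra.
by rewrite /c mulrDl mul1r mulVf ?gt_eqF// lerDr ltW.
Qed.

Lemma bottom_disk_point : normc l1 < Num.sqrt kappa -> l2 = 0 ->
  ~ koszul_exact T /\ ~ invertible_op (row_square T).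
Proof.
move=> l1k l20; have k0 : 0 < kappa := lt_trans ltr01 kappa_gt1.
apply: (@evaluation_point (normc l1 ^+ 2 / kappa) 0 2) => //.
- rewrite divr_ge0 ?sqr_ge0 ?(ltW k0)//= ltr_pdivrMr// mul1r.
  rewrite -[ltRHS](sqr_sqrtr (ltW k0)) ltr_pXn2r// ?nnegrE ?normc_ge0 ?sqrtr_ge0//.
- by rewrite lexx ltr01.
move=> i [|j]; last by rewrite l20 !exprS !mul0r !mulr0 Normc.normc0 expr0n.
rewrite !expr0 !mulr1 normcX /gweight /= sqr_prod_xweight mulrCA divff ?pnatr_eq0// mulr1.
rewrite exprMn exprVn -!exprM mulnC mulrCA ler_peMr ?exprn_ge0 ?normc_ge0//.
by rewrite ler_pdivlMr ?kappaX_gt0// mul1r lerDr.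
Qed.

End SpectralPoints.

(** * Subnormality *)

Section Hyponormality.
Context (R : realType).
Local Notation C := R[i].
Local Notation normc := (@Normc.normc R).

(** The condition of Bram and Halmos. The maps [K1 q], [K2 q] play the part of
    the adjoint of the [q]-th member of a commuting normal family extending
    [S], and [E1], [E2] that of the embedding into the larger space, cut into
    two pieces. For [w = sum_j S_j^* v_j], the form to be bounded below is the
    squared distance between [sum_q K q v_q] and [E w]. *)
Lemma hyponormal_dilation (I J : choiceType) n (S B : 'I_n -> l2 R I -> l2 R I)
    (K1 K2 : 'I_n -> l2 R I -> l2 R J) (E1 E2 : l2 R I -> l2 R J) :
  (forall i, adjoint_pair (S i) (B i)) ->
  (forall p q x y, l2dot (S p x) (S q y) =
     l2dot (K1 q x) (K1 p y) + l2dot (K2 q x) (K2 p y)) ->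
  (forall q x y, l2dot x (S q y) = l2dot (K1 q x) (E1 y) + l2dot (K2 q x) (E2 y)) ->
  (forall x, l2dot x x = l2dot (E1 x) (E1 x) + l2dot (E2 x) (E2 x)) ->
  hyponormal S.
Proof.
move=> SB KK KE EE v; pose w := \sum_j B j (v j).
pose k1 := \sum_q K1 q (v q); pose k2 := \sum_q K2 q (v q).
have ge0 (x : l2 R J) : 0 <= l2dot x x by rewrite l2dotE lecR sqr_ge0.
have dot_adj j x y : l2dot (B j x) y = l2dot x (S j y).
  by rewrite l2dot_conj -SB -l2dot_conj.
have Qk : \sum_q \sum_p l2dot (S p (v q)) (S q (v p)) = l2dot k1 k1 + l2dot k2 k2.
  rewrite /k1 /k2 !l2dot_suml -big_split; apply: eq_bigr => q _ /=.
  by rewrite !l2dot_sumr -big_split; apply: eq_bigr => p _ /=; rewrite KK.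
have Ww : \sum_q \sum_p l2dot (B q (v q)) (B p (v p)) = l2dot w w.
  by rewrite {1}/w l2dot_suml; apply: eq_bigr => q _; rewrite l2dot_sumr.
have kw : l2dot k1 (E1 w) + l2dot k2 (E2 w) = l2dot w w.
  rewrite {3}/w /k1 /k2 !l2dot_suml -big_split; apply: eq_bigr => q _ /=.
  by rewrite -KE dot_adj.
have wk : l2dot (E1 w) k1 + l2dot (E2 w) k2 = l2dot w w.
  by rewrite (l2dot_conj k1) (l2dot_conj k2) -rmorphD/= kw -l2dot_conj.
have -> : \sum_i l2dot (\sum_j commutator (adjoint (S j)) (S i) (v j)) (v i) =
    l2dot (k1 - E1 w) (k1 - E1 w) + l2dot (k2 - E2 w) (k2 - E2 w).
  transitivity (\sum_q \sum_p l2dot (S p (v q)) (S q (v p)) -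
                \sum_q \sum_p l2dot (B q (v q)) (B p (v p))).
    rewrite [X in X - _]exchange_big [X in _ - X]exchange_big -sumrB.
    apply: eq_bigr => i _; rewrite l2dot_suml -sumrB; apply: eq_bigr => j _.
    by rewrite /commutator (adjoint_pairE (SB j)) l2dotBl dot_adj (SB i (B j (v j))).
  rewrite Qk Ww !(l2dotBl, l2dotBr).
  have comb (c1 c2 a1 a2 b1 b2 e1 e2 ww : C) : a1 + a2 = ww -> b1 + b2 = ww ->
      ww = e1 + e2 -> c1 + c2 - ww = c1 - a1 - (b1 - e1) + (c2 - a2 - (b2 - e2)).
    move=> aw bw we; transitivity (c1 + c2 - (a1 + a2) - (b1 + b2) + (e1 + e2)).
      by rewrite aw bw -we subrK.
    by ring.
  by rewrite (comb _ _ _ _ _ _ _ _ _ kw wk (EE w)); congr (_ + _);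
    rewrite opprB addrA addrAC.
exact: addr_ge0.
Qed.

Lemma adjoint_pair_comp (I : choiceType) (A1 A2 B1 B2 : l2 R I -> l2 R I) :
  adjoint_pair A1 B1 -> adjoint_pair A2 B2 ->
  adjoint_pair (A1 \o A2) (B2 \o B1).
Proof. by move=> AB1 AB2 x y; rewrite /= AB1 AB2. Qed.

Lemma adjoint_pair_iter (I : choiceType) (A B : l2 R I -> l2 R I) n :
  adjoint_pair A B -> adjoint_pair (iter n A) (iter n B).
Proof. by move=> AB; elim: n => // n IH x y; rewrite iterS AB IH -iterSr. Qed.

Variable kappa : R.
Hypothesis kappa_gt1 : 1 < kappa.
Local Notation H := (l2 R (nat * nat)%type).
Local Notation y0 := (Num.sqrt (1 / 2) : R).
Local Notation G := (gweight kappa y0).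
Implicit Types (x y : H) (p q : nat * nat).

Let y0_gt0 : 0 < y0. Proof. by rewrite sqrtr_gt0 divr_gt0. Qed.
Let T := shift_pair kappa y0.

Definition monomial_op p : H -> H := iter p.2 T.2 \o iter p.1 T.1.

Let G_gt0 p : 0 < G p. Proof. exact: gweight_gt0. Qed.

Lemma power_tuple_monomial k i :
  exists p, [/\ (p.1 <= k)%N, (p.2 <= k)%N &
    tnth (in_tuple (power_tuple k T)) i = monomial_op p].
Proof.
pose s := [seq (m, r) | m <- iota 1 k, r <- iota 0 m.+1].
pose f (mq : nat * nat) : H -> H := monomial_op (mq.1 - mq.2, mq.2)%N.
have e : power_tuple k T = map f s by rewrite map_allpairs.
have iN : (i < size s)%N by rewrite -(size_map f) -e; exact: ltn_ord.
rewrite (tnth_nth idfun) /=; move: (nat_of_ord i) iN => n nN {i}.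
have : nth (0%N, 0%N) s n \in s by exact: mem_nth.
move=> /allpairsPdep[m [r [mk qm E]]].
move: mk qm; rewrite !mem_iota => /andP[_ mk] /andP[_ qm].
exists (m - r, r)%N; split=> /=.
- by rewrite (leq_trans (leq_subr _ _))// -ltnS.
- by rewrite -ltnS (leq_trans qm).
by rewrite e (nth_map (0%N, 0%N))// E.
Qed.

Lemma monomial_opE a b x i j : monomial_op (a, b) x (i, j) =
  if (a <= i)%N && (b <= j)%N then
    (G (i, j) / G (i - a, j - b)%N)%:C * x (i - a, j - b)%N else 0.
Proof.
rewrite /monomial_op /=.
have G0 p : (G p)%:C != 0 :> C by rewrite fmorph_eq0 gt_eqF.
have T1E y i' j' : T.1 y (i', j') = if i' is i1.+1
    then (G (i', j') / G (i1, j'))%:C * y (i1, j') else 0.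
  rewrite /T /= wshift1E; last exact: alpha_bounded.
  case: i' => // i'; rewrite /shift1_coord /=.
  by rewrite (gweight_right _ _ (i', j')) mulfK ?gt_eqF.
have T2E y i' j' : T.2 y (i', j') = if j' is j1.+1
    then (G (i', j') / G (i', j1))%:C * y (i', j1) else 0.
  rewrite /T /= wshift2E; last exact: beta_bounded.
  case: j' => // j'; rewrite /shift2_coord /=.
  by rewrite (gweight_up y0 kappa_gt1 (i', j')) mulfK ?gt_eqF.
have it1 i' j' : iter a T.1 x (i', j') = if (a <= i')%N
    then (G (i', j') / G (i' - a, j')%N)%:C * x (i' - a, j')%N else 0.
  elim: a i' => [|a IH] i' /=.
    by rewrite subn0 divff ?gt_eqF// rmorph1 mul1r.
  rewrite T1E; case: i' => [|i']//; rewrite IH ltnS subSS.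
  case: ifP => _; last by rewrite mulr0.
  by rewrite mulrA -rmorphM mulrA divfK ?gt_eqF.
elim: b j => [|b IH] j /=.
  by rewrite it1 subn0 andbT.
rewrite T2E; case: j => [|j]; first by rewrite andbF.
rewrite IH ltnS subSS; case: ifP => _; last by rewrite mulr0.
by rewrite mulrA -rmorphM mulrA divfK ?gt_eqF.
Qed.

Lemma sqr_gweight i j : G (i, j) ^+ 2 = (1 + (j == 0%N)%:R * kappa ^+ i) / 2.
Proof.
case: j => [|j]; rewrite /gweight /=; first by rewrite sqr_prod_xweight// mul1r.
by rewrite mul0r addr0 sqr_sqrtr// divr_ge0.
Qed.

Section Dilation.
Variable N : nat.

Definition unshift p (d : nat * nat) := (d.1 + p.1 - N, d.2 + p.2 - N)%N.
Definition unshift_ok p (d : nat * nat) := (N <= d.1 + p.1)%N && (N <= d.2 + p.2)%N.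

(** The measure of the pair gives mass 1/2 to the unit torus and mass 1/2 to the
    circle of radius [sqrt kappa] in the first coordinate axis. In the Fourier
    coordinates of the torus and of that circle, with indices moved by [N] to
    keep them natural numbers, these are the adjoints of multiplication by
    the monomial [p], applied to [x]. *)
Definition torus_coef p d : R :=
  if unshift_ok p d then (Num.sqrt 2 * G (unshift p d))^-1 else 0.

Definition circle_coef p d : R :=
  if [&& unshift_ok p d, p.2 == 0%N & d.2 == N] then
    Num.sqrt kappa ^+ (p.1 + (unshift p d).1) * (Num.sqrt 2 * G (unshift p d))^-1
  else 0.

Definition torus_part p : H -> H := pull (unshift p) (torus_coef p).
Definition circle_part p : H -> H := pull (unshift p) (circle_coef p).

Let rt2 : Num.sqrt 2 ^+ 2 = 2 :> R. Proof. by rewrite sqr_sqrtr. Qed.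
Let rt2_gt0 : 0 < Num.sqrt 2 :> R. Proof. by rewrite sqrtr_gt0. Qed.
Let k0 : 0 < kappa := lt_trans ltr01 kappa_gt1.
Let rk2 : Num.sqrt kappa ^+ 2 = kappa. Proof. by rewrite sqr_sqrtr ?ltW. Qed.
Let rk0 : 0 < Num.sqrt kappa. Proof. by rewrite sqrtr_gt0. Qed.

Let rtG p : 0 < Num.sqrt 2 * G p. Proof. exact: mulr_gt0. Qed.

Let sq_rtG i j : (Num.sqrt 2 * G (i, j)) ^+ 2 = 1 + (j == 0%N)%:R * kappa ^+ i.
Proof. by rewrite exprMn rt2 sqr_gweight mulrC divfK. Qed.

Let unshift_inj p d d' : unshift_ok p d -> unshift_ok p d' ->
  unshift p d = unshift p d' -> d = d'.
Proof.
case: d d' => [d1 d2] [d1' d2'] /andP[/= h1 h2] /andP[/= h1' h2'] [e1 e2].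
by congr pair; lia.
Qed.

Let rtG_ge1 p : 1 <= Num.sqrt 2 * G p.
Proof.
case: p => i j; rewrite -(@ler_pXn2r _ 2)// ?nnegrE ?(ltW (rtG _))//.
by rewrite expr1n sq_rtG lerDl mulr_ge0// exprn_ge0// ltW.
Qed.

Let torus_bound p d : `|torus_coef p d| <= 1.
Proof.
rewrite /torus_coef; case: ifP => _; last by rewrite normr0.
by rewrite gtr0_norm ?invr_gt0// invf_le1.
Qed.

Let circle_bound p d : `|circle_coef p d| <= Num.sqrt kappa ^+ p.1.
Proof.
rewrite /circle_coef; case: ifP => [/and3P[_ /eqP p20 /eqP dN]|_]; last first.
  by rewrite normr0 exprn_ge0// ltW.
rewrite gtr0_norm ?mulr_gt0 ?exprn_gt0 ?invr_gt0//.
rewrite ler_pdivrMr// exprD ler_pM2l ?exprn_gt0//.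
rewrite -(@ler_pXn2r _ 2)// ?nnegrE ?exprn_ge0 ?(ltW rk0) ?(ltW (rtG _))//.
rewrite /unshift p20 dN addn0 subnn sq_rtG eqxx mul1r -exprM mulnC exprM rk2.
by rewrite lerDr.
Qed.

Let torus_inj p d d' : torus_coef p d != 0 -> torus_coef p d' != 0 ->
  unshift p d = unshift p d' -> d = d'.
Proof.
rewrite /torus_coef; case: ifP => [h _|]; last by rewrite eqxx.
by case: ifP => [h' _|]; [exact: unshift_inj|rewrite eqxx].
Qed.

Let circle_inj p d d' : circle_coef p d != 0 -> circle_coef p d' != 0 ->
  unshift p d = unshift p d' -> d = d'.
Proof.
rewrite /circle_coef; case: ifP => [/andP[h _] _|]; last by rewrite eqxx.
by case: ifP => [/andP[h' _] _|]; [exact: unshift_inj|rewrite eqxx].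
Qed.

Let rkX n : 0 <= Num.sqrt kappa ^+ n. Proof. by rewrite exprn_ge0// ltW. Qed.

Lemma torus_partE p x d : torus_part p x d = (torus_coef p d)%:C * x (unshift p d).
Proof. exact: (pullE ler01 (torus_bound p) (@torus_inj p)). Qed.

Lemma circle_partE p x d : circle_part p x d = (circle_coef p d)%:C * x (unshift p d).
Proof. exact: (pullE (rkX _) (circle_bound p) (@circle_inj p)). Qed.

(** In function space, both sides are [<z^p x, z^q y>], the right-hand side in
    the form [<conj(z)^q x, conj(z)^p y>]. *)
Lemma dilation_dot p q x y : (p.1 + q.1 <= N)%N -> (p.2 + q.2 <= N)%N ->
  l2dot (monomial_op p x) (monomial_op q y) =
  l2dot (torus_part q x) (torus_part p y) + l2dot (circle_part q x) (circle_part p y).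
Proof.
case: p q => [a b] [a' b'] /= aN bN.
(* The coordinate [m] on the left corresponds to the Fourier index [m - p - q],
   moved by [N], on the right. *)
pose s (m : nat * nat) := (m.1 + (N - (a + a')), m.2 + (N - (b + b')))%N.
have sI : injective s.
  by move=> [m1 m2] [n1 n2] [/= e1 e2]; congr pair; lia.
pose id1 := pull s (fun=> 1 : R).
have b1 (m : nat * nat) : `|1 : R| <= 1 by rewrite normr1.
have id1E (z : H) m : id1 z m = z (s m).
  by rewrite (pullE ler01 b1) ?mul1r// => ? ? _ _; exact: sI.
have off d : (forall m, d <> s m) -> ~~ (unshift_ok (a, b) d && unshift_ok (a', b') d).
  move=> ds; apply/negP => /andP[/andP[/= h1 h2] /andP[/= h3 h4]].
  apply: (ds (d.1 - (N - (a + a')), d.2 - (N - (b + b')))%N).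
  by case: d {ds} h1 h2 h3 h4 => d1 d2 /= *; congr pair => /=; lia.
have push (K L : H) : (forall d, ~~ (unshift_ok (a, b) d && unshift_ok (a', b') d) ->
    K d = 0 \/ L d = 0) -> l2dot K L = l2dot (id1 K) (id1 L).
  move=> KL; rewrite /l2dot (csum_push sI (f := fun d => K d * (L d)^*)) => [|d /off/KL h].
    by congr csum; apply/funext => m; rewrite !id1E.
  by cbn beta; case: h => ->; rewrite ?mul0r// rmorph0 mulr0.
rewrite (push (torus_part _ x)) => [|d]; last first.
  rewrite negb_and => /orP[h|h]; [right|left];
    by rewrite torus_partE /torus_coef (negbTE h) mul0r.
rewrite (push (circle_part _ x)) => [|d]; last first.
  rewrite negb_and => /orP[h|h]; [right|left];
    by rewrite circle_partE /circle_coef (negbTE h) mul0r.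
rewrite /l2dot -csumD; try exact: l2_csummable.
congr csum; apply/funext => -[i j].
have idT p z := etrans (id1E (torus_part p z) (i, j)) (torus_partE p z (s (i, j))).
have idC p z := etrans (id1E (circle_part p z) (i, j)) (circle_partE p z (s (i, j))).
have subst6 (u u' v v' w w' u1 u1' v1 v1' w1 w1' : C) : u = u1 -> u' = u1' ->
    v = v1 -> v' = v1' -> w = w1 -> w' = w1' ->
    u1 * u1'^* = v1 * v1'^* + w1 * w1'^* -> u * u'^* = v * v'^* + w * w'^*.
  by move=> -> -> -> -> -> ->.
apply: (subst6 _ _ _ _ _ _ _ _ _ _ _ _ (monomial_opE a b x i j)
  (monomial_opE a' b' y i j) (idT _ x) (idT _ y) (idC _ x) (idC _ y)).
have u1 : unshift (a', b') (s (i, j)) = (i - a, j - b)%N.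
  by rewrite /unshift /s /=; congr pair; lia.
have u2 : unshift (a, b) (s (i, j)) = (i - a', j - b')%N.
  by rewrite /unshift /s /=; congr pair; lia.
have ok1 : unshift_ok (a', b') (s (i, j)) = (a <= i)%N && (b <= j)%N.
  by rewrite /unshift_ok /s /=; congr andb; lia.
have ok2 : unshift_ok (a, b) (s (i, j)) = (a' <= i)%N && (b' <= j)%N.
  by rewrite /unshift_ok /s /=; congr andb; lia.
rewrite /torus_coef /circle_coef !u1 !u2 !ok1 !ok2.
have [h1|_] := boolP ((a <= i)%N && (b <= j)%N); last by rewrite !mul0r addr0.
have [h2|_] := boolP ((a' <= i)%N && (b' <= j)%N); last first.
  by rewrite !mul0r !rmorph0 !mulr0 addr0.
have cC (r : R) : (r%:C)^* = r%:C :> C by apply/CrealP/complex_realP; exists r.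
have factor (r r' t t' e e' : R) (z z' : C) : r * r' = t' * t + e' * e ->
    (r%:C * z) * (r'%:C * z')^* =
    (t'%:C * z) * (t%:C * z')^* + (e'%:C * z) * (e%:C * z')^*.
  move=> E; rewrite !rmorphM/= !cC; transitivity ((r * r')%:C * (z * z'^*)).
    by rewrite rmorphM/=; ring.
  by rewrite E rmorphD !rmorphM/=; ring.
apply: factor; move: h1 h2 => /andP[ai bj] /andP[ai' bj'].
set g := G (i - a, j - b)%N; set g' := G (i - a', j - b')%N.
have gn : g != 0 by rewrite /g gt_eqF.
have gn' : g' != 0 by rewrite /g' gt_eqF.
cbn [fst snd andb].
have rn : Num.sqrt 2 != 0 :> R by rewrite gt_eqF.
have -> : G (i, j) / g * (G (i, j) / g') = G (i, j) ^+ 2 / (g * g').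
  by field; rewrite gn gn'.
have halfE : 2^-1 = (Num.sqrt 2 ^+ 2)^-1 :> R by rewrite rt2.
have -> : (Num.sqrt 2 * g)^-1 * (Num.sqrt 2 * g')^-1 = 2^-1 / (g * g').
  by rewrite halfE; field; rewrite rn gn gn'.
rewrite sqr_gweight.
have [j0|j0] := eqVneq j 0%N.
  have b0 : b = 0%N by move: bj; rewrite j0 leqn0 => /eqP.
  have b0' : b' = 0%N by move: bj'; rewrite j0 leqn0 => /eqP.
  have -> : (s (i, j)).2 == N by rewrite /s j0 b0 b0' /= addn0 subn0.
  rewrite b0 b0' eqxx; cbn [andb].
  have e : (a' + (i - a) + (a + (i - a')) = i * 2)%N by clear -ai ai'; lia.
  have -> : Num.sqrt kappa ^+ (a' + (i - a)) * (Num.sqrt 2 * g)^-1 *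
     (Num.sqrt kappa ^+ (a + (i - a')) * (Num.sqrt 2 * g')^-1) =
     kappa ^+ i * (2^-1 / (g * g')).
    rewrite mulrACA -exprD e mulnC exprM rk2; congr (_ * _).
    clearbody g g'.
    by rewrite halfE; field; rewrite rn gn gn'.
  by rewrite mul1r; field; rewrite gn gn'.
rewrite mul0r addr0 div1r.
have [/andP[/eqP b'0 /eqP jN]|_] := boolP ((b' == 0%N) && ((s (i, j)).2 == N)).
  have /negbTE -> : b != 0%N.
    by move: jN; rewrite /s /= b'0 addn0; clear -j0 bN b'0; lia.
  by rewrite mulr0 addr0.
by rewrite mul0r addr0.
Qed.

End Dilation.

Lemma shift_pair_k_hyponormal k : k_hyponormal k T.
Proof.
have [p pP] := choice (power_tuple_monomial (k := k)).
(* A product of two members of the tuple has degree at most [2k] in each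
   variable. *)
pose N := (k + k)%N; pose o : nat * nat := (0%N, 0%N).
have pN i : ((p i).1 <= k)%N /\ ((p i).2 <= k)%N by have [h1 h2 _] := pP i.
have adj1' := coshift_adjoint rightK (sqrtr_ge0 kappa) (wt1_le kappa_gt1)
  (wshift1_alongE kappa_gt1).
have y1 : 0 <= y0 + 1 by rewrite addr_ge0 ?ltW.
have adj2' := coshift_adjoint upK y1 (wt2_le kappa_gt1 y0_gt0)
  (wshift2_alongE kappa_gt1 y0_gt0).
pose B q : H -> H :=
  iter q.1 (coshift right (wt1 kappa)) \o iter q.2 (coshift up (wt2 kappa y0)).
apply: (@hyponormal_dilation _ _ _ _ (fun i => B (p i)) (fun i => torus_part N (p i))
  (fun i => circle_part N (p i)) (torus_part N o) (circle_part N o)).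
- move=> i; have [_ _ ->] := pP i.
  by apply: adjoint_pair_comp; apply: adjoint_pair_iter.
- move=> i j x y; have [h1 h2 ->] := pP i; have [h3 h4 ->] := pP j.
  by apply: dilation_dot; exact: leq_add.
- move=> i x y; have [h1 h2 ->] := pP i.
  by apply: (@dilation_dot N o (p i) x y); rewrite add0n (leq_trans _ (leq_addl _ _)).
- by move=> x; exact: (@dilation_dot N o o x x).
Qed.

End Hyponormality.

(** * The spectra and the outer boundary *)

Section Spectra.
Context (R : realType) (kappa y0 : R).
Hypotheses (kappa_gt1 : 1 < kappa) (y0_gt0 : 0 < y0).
Local Notation C := R[i].
Local Notation normc := (@Normc.normc R).
Implicit Types (l : C * C).

Let T := shift_pair kappa y0.

Let rk1 : 1 < Num.sqrt kappa.
Proof. by rewrite -sqrtr1 ltr_sqrt// (lt_trans ltr01). Qed.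

Definition in_spectrum l := (normc l.1 <= 1 /\ normc l.2 <= 1) \/
  (normc l.1 <= Num.sqrt kappa /\ l.2 = 0).

Definition in_essential_spectrum l := [\/ normc l.1 = Num.sqrt kappa /\ l.2 = 0,
  normc l.1 = 1 /\ normc l.2 <= 1 | normc l.1 <= 1 /\ normc l.2 = 1].

Lemma spectrum_in l : in_spectrum l ->
  ~ koszul_exact (pair_shift T l) /\ ~ invertible_op (row_square (pair_shift T l)).
Proof.
case: l => l1 l2 [[/= h1 h2]|[/= h1 h2]].
  have [e1|n1] := eqVneq (normc l1) 1.
    have w := wandering_circle_disk kappa_gt1 y0_gt0 e1 h2.
    exact: (wandering_point kappa_gt1 y0_gt0 w).2.
  have [e2|n2] := eqVneq (normc l2) 1.
    have w := wandering_disk_circle kappa_gt1 y0_gt0 h1 e2.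
    exact: (wandering_point kappa_gt1 y0_gt0 w).2.
  by apply: bidisk_point; rewrite // lt_neqAle ?n1 ?n2.
have [e1|n1] := eqVneq (normc l1) (Num.sqrt kappa).
  have w := wandering_outer_circle kappa_gt1 y0_gt0 e1 h2.
  exact: (wandering_point kappa_gt1 y0_gt0 w).2.
by apply: bottom_disk_point; rewrite // lt_neqAle n1.
Qed.

Lemma spectrum_out l : ~ in_spectrum l ->
  [/\ koszul_exact (pair_shift T l), invertible_op (row_square (pair_shift T l)),
      koszul_fredholm (pair_shift T l) & fredholm_op (row_square (pair_shift T l))].
Proof.
case: l => l1 l2 Nl.
have [rs me] : row_solvable (op_shift T.1 l1) (op_shift T.2 l2) 0 /\
    middle_exact kappa y0 l1 l2.
  have [e2|n2] := eqVneq l2 0.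
    apply: exact_l1_large => //; rewrite ltNge; apply/negP => h.
    by apply: Nl; right.
  apply: exact_l2_neq0 => //; apply: contrapT => /not_orP[/negP h1 /negP h2].
  by apply: Nl; left; rewrite !leNgt.
have [h1 h2] := exact_point kappa_gt1 y0_gt0 rs me.
have fm := middle_exact_fin_dim kappa_gt1 y0_gt0 me.
have [h3 h4] := fredholm_point kappa_gt1 y0_gt0 rs fm.
by split.
Qed.

Lemma essential_in l : in_essential_spectrum l ->
  ~ koszul_fredholm (pair_shift T l) /\ ~ fredholm_op (row_square (pair_shift T l)).
Proof.
case: l => l1 l2 h.
have w : wandering (op_shift (adj1 kappa) l1^*) (op_shift (adj2 kappa y0) l2^*).
  case: h => -[/= h1 h2].
  - exact: wandering_outer_circle.
  - exact: wandering_circle_disk.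
  - exact: wandering_disk_circle.
exact: (wandering_point kappa_gt1 y0_gt0 w).1.
Qed.

Lemma essential_out l : ~ in_essential_spectrum l ->
  koszul_fredholm (pair_shift T l) /\ fredholm_op (row_square (pair_shift T l)).
Proof.
have [|/spectrum_out[_ _ ? ?]] := pselect (in_spectrum l); last by [].
case: l => l1 l2 h Ne.
have [[l11 l21]|[l20 l11k]] : (normc l1 < 1 /\ normc l2 < 1) \/
    (l2 = 0 /\ 1 < normc l1 < Num.sqrt kappa).
  case: h => [[/= h1 h2]|[/= h1 h2]].
    left; rewrite !lt_neqAle h1 h2 !andbT; split; apply/eqP => e; apply: Ne.
      by constructor 2.
    by constructor 3.
  have [l11|l11|l11] := ltgtP (normc l1) 1.
  - by left; rewrite h2 Normc.normc0.
  - right; split => //=; rewrite lt_neqAle h1 andbT; apply/eqP => e.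
    by apply: Ne; constructor 1.
  - by exfalso; apply: Ne; constructor 2; rewrite /= h2 Normc.normc0 ler01.
- have [rs me] := fredholm_bidisk kappa_gt1 y0_gt0 l11 l21.
  exact: (fredholm_point kappa_gt1 y0_gt0 rs (middle_exact_fin_dim kappa_gt1 y0_gt0 me)).
have [rs fq] := fredholm_bottom_row kappa_gt1 y0_gt0 l20 l11k.
exact: (fredholm_point kappa_gt1 y0_gt0 rs fq).
Qed.

Lemma closed_diskE (z : C) : closed_disk z = (normc z <= 1) :> Prop.
Proof. by rewrite /closed_disk /= normcCE -(lecR _ 1). Qed.

Lemma unit_circleE (z : C) : unit_circle z = (normc z = 1) :> Prop.
Proof.
by rewrite /unit_circle /= normcCE; apply/propext; split=> [[]|->].
Qed.

Lemma dilationE (r : R) (P : R -> Prop) (A : set C) (z : C) : 0 < r ->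
  (forall z, A z = P (normc z)) -> dilation r A z = P (normc z / r).
Proof.
move=> r0 AP; have rC : r%:C != 0 :> C by rewrite fmorph_eq0 gt_eqF.
apply/propext; split=> [[u Au <-]|Pz].
  by rewrite Normc.normcM normc_real gtr0_norm// mulrAC divff ?gt_eqF// mul1r -AP.
exists (z / r%:C); last by rewrite mulrC divfK.
by rewrite AP Normc.normcM normcV normc_real gtr0_norm.
Qed.

Lemma dilation_diskE (r : R) z : 0 < r ->
  dilation r (@closed_disk R) z = (normc z <= r) :> Prop.
Proof.
by move=> r0; rewrite (dilationE (P := fun t => t <= 1 : Prop) z r0 closed_diskE)
  ler_pdivrMr// mul1r.
Qed.

Lemma dilation_circleE (r : R) z : 0 < r ->
  dilation r (@unit_circle R) z = (normc z = r) :> Prop.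
Proof.
move=> r0; rewrite (dilationE (P := fun t => t = 1 : Prop) z r0 unit_circleE).
apply/propext; split=> [/(congr1 (fun t => t * r))|->]; last by rewrite divff// gt_eqF.
by rewrite divfK ?gt_eqF// mul1r.
Qed.

Let rk0 : 0 < Num.sqrt kappa. Proof. exact: lt_trans ltr01 rk1. Qed.

Lemma in_spectrumE : in_spectrum = @closed_disk R `*` @closed_disk R `|`
  dilation (Num.sqrt kappa) (@closed_disk R) `*` [set 0].
Proof.
apply/seteqP; split=> l; rewrite /setU /setX /=; rewrite !closed_diskE dilation_diskE//.
Qed.

Lemma in_essential_spectrumE : in_essential_spectrum =
  dilation (Num.sqrt kappa) (@unit_circle R) `*` [set 0] `|`
  @unit_circle R `*` @closed_disk R `|` @closed_disk R `*` @unit_circle R.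
Proof.
apply/seteqP; split=> l; rewrite /setU /setX /=;
  rewrite !closed_diskE !unit_circleE dilation_circleE//.
  by case=> h; [left; left|left; right|right].
by case=> [[]|] h; [constructor 1|constructor 2|constructor 3].
Qed.

Lemma not_complement (P Q : Prop) : (P -> ~ Q) -> (~ P -> Q) -> (~ Q) = P.
Proof. by move=> PQ NPQ; apply/propext; split=> [NQ|/PQ//]; apply: contrapT => /NPQ. Qed.

Lemma taylor_spectrumE : taylor_spectrum T = in_spectrum.
Proof.
apply/funext => l; apply: not_complement => [/spectrum_in[]|/spectrum_out[]]//.
Qed.

Lemma right_spectrumE : right_spectrum T = in_spectrum.
Proof.
apply/funext => l; apply: not_complement => [/spectrum_in[]|/spectrum_out[]]//.
Qed.

Lemma taylor_essential_spectrumE : taylor_essential_spectrum T = in_essential_spectrum.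
Proof.
apply/funext => l; apply: not_complement => [/essential_in[]|/essential_out[]]//.
Qed.

Lemma right_essential_spectrumE : right_essential_spectrum T = in_essential_spectrum.
Proof.
apply/funext => l; apply: not_complement => [/essential_in[]|/essential_out[]]//.
Qed.

(** For [1 < r < sqrt kappa], the point [(r, 0)] is the end of a half line that
    goes down in the complement of the moduli, so that it lies on their outer
    boundary in the plane, but the pair is Fredholm at the point [(r, 0)]. *)
Lemma reinhardt_boundary_neq : reinhardt_boundary in_spectrum <> in_essential_spectrum.
Proof.
pose r := (1 + Num.sqrt kappa) / 2.
have r1 : 1 < r by rewrite /r; have := rk1; lra.
have rk : r < Num.sqrt kappa by rewrite /r; have := rk1; lra.
have r0 : 0 < r := lt_trans ltr01 r1.
have nr : normc r%:C = r by rewrite normc_real gtr0_norm.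
pose L := (@modulus R) @` in_spectrum.
pose ray := (fun t : R => (r, t)) @` [set` `]-oo, (0 : R)[].
have cont : continuous (fun t : R => (r, t)).
  by move=> t; exact: (cvg_pair (cvg_cst r) cvg_id).
have rayL : ray `<=` ~` L.
  move=> _ [t /= t0 <-] [l _ [_ e]]; move: t0.
  by rewrite in_itv/= -e ltNge normc_ge0.
have ray_conn : connected ray.
  apply: connected_continuous_connected; last exact: continuous_subspaceT.
  exact/connected_intervalP/interval_is_interval.
have ray_mem t : t < 0 -> ray (r, t) by move=> t0; exists t => //=; rewrite in_itv.
have rx : ray (r, -1) by apply: ray_mem; rewrite oppr_lt0.
pose U := connected_component (~` L) (r, -1).
have rayU : ray `<=` U by exact: connected_component_max.
have Lp : L (r, 0).
  have h : normc r%:C <= Num.sqrt kappa by rewrite nr ltW.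
  by exists (r%:C, 0); [right|rewrite /modulus nr Normc.normc0].
move=> e; have : reinhardt_boundary in_spectrum (r%:C, 0).
  change (outer_boundary L (normc r%:C, normc 0)); rewrite nr Normc.normc0.
  exists (r, -1); split; first exact: rayL.
    move=> Ub; have [M MU] := @filter_ex _ (pinfty_nbhs R) _ _ Ub.
    have m0 : - (`|M| + 1) < 0 by rewrite oppr_lt0 ltr_wpDl.
    have : `|(r, - (`|M| + 1))| <= M := MU _ (rayU _ (ray_mem _ m0)).
    rewrite prod_normE ge_max /= => /andP[_]; rewrite normrN ger0_norm ?addr_ge0//.
    by have := ler_norm M; lra.
  split; last by move=> /interior_subset/connected_component_sub; apply.
  apply: (closure_subset rayU) => B /(cont 0)/nbhs_ballP[d d0 dB].
  exists (r, - (d / 2)); split; first by apply: ray_mem; rewrite oppr_lt0 divr_gt0.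
  apply: dB; rewrite /ball /= sub0r opprK gtr0_norm ?divr_gt0//.
  by rewrite ltr_pdivrMr// ltr_pMr// ltr1n.
have nr1 : normc r%:C != 1 by rewrite nr gt_eqF.
have nrk : normc r%:C != Num.sqrt kappa by rewrite nr lt_eqF.
rewrite e => -[[h _]|[h _]|[_ h]].
- exact/(negP nrk)/eqP.
- exact/(negP nr1)/eqP.
by move: h; rewrite Normc.normc0 => /eqP; rewrite eq_sym oner_eq0.
Qed.

End Spectra.

Theorem theorem2p10 (R : realType) (k : nat) (kappa : R)
    (hk : (1 <= k)%N) (hkappa : 1 < kappa) :
  (exists y0 : R, 0 < y0 <= Num.sqrt (1 / 2) /\
     k_hyponormal k (shift_pair kappa y0)) /\
  (forall y0 : R, 0 < y0 ->
     let T := shift_pair kappa y0 in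
     let D := @closed_disk R in
     let S := @unit_circle R in
     [/\ taylor_spectrum T = right_spectrum T,
         right_spectrum T =
           D `*` D `|` dilation (Num.sqrt kappa) D `*` [set 0],
         taylor_essential_spectrum T = right_essential_spectrum T,
         right_essential_spectrum T =
           dilation (Num.sqrt kappa) S `*` [set 0] `|` S `*` D `|` D `*` S &
         reinhardt_boundary (taylor_spectrum T) <>
           taylor_essential_spectrum T]).
Proof.
split; first exists (Num.sqrt (1 / 2)).
  by rewrite lexx andbT sqrtr_gt0 divr_gt0//; split=> //; exact: shift_pair_k_hyponormal.
move=> y0 y0_gt0 /=; split.
- by rewrite (taylor_spectrumE hkappa y0_gt0) (right_spectrumE hkappa y0_gt0).
- by rewrite (right_spectrumE hkappa y0_gt0) in_spectrumE.
- rewrite (taylor_essential_spectrumE hkappa y0_gt0).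
  by rewrite (right_essential_spectrumE hkappa y0_gt0).
- by rewrite (right_essential_spectrumE hkappa y0_gt0) in_essential_spectrumE.
rewrite (taylor_spectrumE hkappa y0_gt0) (taylor_essential_spectrumE hkappa y0_gt0).
exact: reinhardt_boundary_neq.
Qed.
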